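(* Let $A\subseteq M^k$ be a nonempty definable set, and let $\partial(A)=\mathrm{cl}(A)\setminus A$ be its frontier. Then $\dim \partial(A) < \dim A$.
   Context: Setting. $T$ is a complete NIP theory in a multi-sorted language $L$ with a distinguished home sort, $\mathcal M$ is an $|L|^+$-saturated model of $T$, and $M$ is the home sort of $\mathcal M$. ''Definable'' means definable in $\mathcal M$, possibly with parameters. A definable set $A$ has dp-rank greater than $n$ if for $0 \le i \le n$ there are formulas $\phi_i(x,y_i)$ (parameters allowed) and infinite sets $B_i$ of tuples (from the sorts of $y_i$) such that for every $(b_0,\dots,b_n) \in B_0\times\cdots\times B_n$ there is $a \in A$ such that for all $0 \le i \le n$ and $y \in B_i$: $\mathcal M \models \phi_i(a,y)$ if and only if $y=b_i$. A nonempty set has dp-rank at least $0$. $\mathcal M$ is assumed dp-minimal: $M$ has dp-rank $1$. $M$ is equipped with a definable uniform structure $\mathcal B$: a collection of subsets of $M^2$ of the form $\mathcal B=\{\varphi(M^2,\bar c): \bar c \in D\}$ for some formula $\varphi(x,y,\bar z)$ and some definable set $D$, such that (i) $\bigcap \mathcal B$ is the diagonal of $M^2$; (ii) each $U\in\mathcal B$ is symmetric; (iii) for all $U,V \in \mathcal B$ there is $W \in \mathcal B$ with $W \subseteq U\cap V$; (iv) for all $U \in \mathcal B$ there is $V\in\mathcal B$ with $V \circ V \subseteq U$, where $U\circ V=\{(x,z): \exists y\ (x,y)\in U,\ (y,z)\in V\}$. For $x\in M$ put $U[x]=\{y:(x,y)\in U\}$; $M$ has the topology in which a set is open iff it contains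 some $U[x]$ ($U\in\mathcal B$) around each of its points $x$, and $M^k$ has the product topology; $\mathrm{cl}$ denotes closure in $M^k$. It is assumed that $M$ has no isolated points and that every infinite definable subset of $M$ has nonempty interior. Dimension. For a tuple $\bar a \in M^k$ and a small (of cardinality at most $|L|$) parameter set $C$, $\dim(\bar a/C)$ is the minimal $l$ such that some subtuple $\bar a'$ of $\bar a$ of length $l$ satisfies $\bar a \in \mathrm{acl}(C\bar a')$. For a $C$-definable set $A\subseteq M^k$, $\dim(A)=\max\{\dim(\bar a/C):\bar a\in A\}$; it does not depend on the choice of small $C$ over which $A$ is definable. $\dim(\emptyset)=-\infty$. *)

(* Defs.v *)
From HB Require Import structures.
From mathcomp Require Import all_boot all_order all_algebra.
From mathcomp Require Import finmap.
From mathcomp Require Import all_classical constructive_ereal topology.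

Set Implicit Arguments.
Unset Strict Implicit.
Unset Printing Implicit Defensive.

Import Order.TTheory GRing.Theory.
Local Open Scope classical_set_scope.

(* A context is a finite set of sorted variables.  Formulas are indexed by the  *)
(* context of their free variables (rather than by one global stock of variables *)
(* of every sort), so that a structure is allowed to have empty sorts.           *)
Record ctx (S : Type) := Ctx { ctx_var :> finType; ctx_sort : ctx_var -> S }.

Definition ctx0 (S : Type) : ctx S := @Ctx S void (of_void S).

Definition ctx_cat (S : Type) (X Y : ctx S) : ctx S :=
  @Ctx S (X + Y)%type
    (fun v => match v with inl x => ctx_sort x | inr y => ctx_sort y end).

Definition ctx_cons (S : Type) (s : S) (X : ctx S) : ctx S :=
  @Ctx S (option X)
    (fun v => match v with Some x => ctx_sort x | None => s end).

Record language := Language {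
  sorts : Type;
  home_sort : sorts;
  func : Type;
  func_dom : func -> ctx sorts;
  func_cod : func -> sorts;
  reln : Type;
  reln_dom : reln -> ctx sorts }.

(* A type of cardinality |L|, i.e. the number of L-formulas. *)
Definition lang_symb (L : language) : Type :=
  (nat + sorts L + func L + reln L)%type.

Inductive term (L : language) (X : ctx (sorts L)) : sorts L -> Type :=
| tvar (v : X) : term X (ctx_sort v)
| tfun (f : func L) :
    (forall v : func_dom f, term X (ctx_sort v)) -> term X (func_cod f).

Inductive formula (L : language) (X : ctx (sorts L)) : Type :=
| fbot : formula X
| feq (s : sorts L) : term X s -> term X s -> formula X
| frel (r : reln L) :
    (forall v : reln_dom r, term X (ctx_sort v)) -> formula X
| fimp : formula X -> formula X -> formula X
| fall (s : sorts L) : formula (ctx_cons s X) -> formula X.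

Definition fneg (L : language) (X : ctx (sorts L)) (phi : formula X) :=
  fimp phi (fbot X).

Definition sentence (L : language) := formula (ctx0 (sorts L)).

Record structure (L : language) := Structure {
  carrier :> sorts L -> Type;
  func_interp : forall f : func L,
    (forall v : func_dom f, carrier (ctx_sort v)) -> carrier (func_cod f);
  reln_interp : forall r : reln L,
    set (forall v : reln_dom r, carrier (ctx_sort v)) }.

Definition home (L : language) (M : structure L) : Type := M (home_sort L).

(* Tuples of elements of M whose sorts are prescribed by X. *)
Definition vals (L : language) (M : structure L) (X : ctx (sorts L)) : Type :=
  forall v : X, M (ctx_sort v).

Definition vals0 (L : language) (M : structure L) : vals M (ctx0 (sorts L)) :=
  fun v => match v with end.

Definition vals_cat (L : language) (M : structure L) (X Y : ctx (sorts L))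
    (a : vals M X) (b : vals M Y) : vals M (ctx_cat X Y) :=
  fun v => match v with inl x => a x | inr y => b y end.

Definition vals_cons (L : language) (M : structure L) (s : sorts L)
    (X : ctx (sorts L)) (c : M s) (a : vals M X) : vals M (ctx_cons s X) :=
  fun v => match v with Some x => a x | None => c end.

Fixpoint eval (L : language) (M : structure L) (X : ctx (sorts L))
    (a : vals M X) (s : sorts L) (t : term X s) : M s :=
  match t with
  | tvar v => a v
  | tfun f args => func_interp (fun v => eval a (args v))
  end.

Fixpoint sat (L : language) (M : structure L) (X : ctx (sorts L))
    (phi : formula X) : vals M X -> Prop :=
  match phi with
  | fbot => fun _ => False
  | feq _ t u => fun a => eval a t = eval a u
  | frel r args => fun a => reln_interp (fun v => eval a (args v))
  | fimp psi chi => fun a => sat psi a -> sat chi a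
  | fall s psi => fun a => forall c : M s, sat psi (vals_cons c a)
  end.

Definition models (L : language) (M : structure L) (T : set (sentence L)) :=
  forall sigma, T sigma -> sat sigma (vals0 M).

Definition entails (L : language) (T : set (sentence L)) (sigma : sentence L) :=
  forall N : structure L, models N T -> sat sigma (vals0 N).

Definition complete_theory (L : language) (T : set (sentence L)) :=
  (exists N : structure L, models N T) /\
  (forall sigma : sentence L, entails T sigma \/ entails T (fneg sigma)).

Definition shatters (L : language) (N : structure L) (X Y : ctx (sorts L))
    (phi : formula (ctx_cat X Y)) (n : nat) :=
  exists a : 'I_n -> vals N X, forall I : {set 'I_n},
    exists b : vals N Y, forall i, sat phi (vals_cat (a i) b) <-> i \in I.

Definition NIP (L : language) (T : set (sentence L)) :=
  forall (X Y : ctx (sorts L)) (phi : formula (ctx_cat X Y)),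
    exists n, forall N : structure L, models N T -> ~ shatters N phi n.

(* Elements of all sorts; sets of parameters are sets of such elements. *)
Definition elt (L : language) (M : structure L) : Type := {s : sorts L & M s}.

Definition small (L : language) (M : structure L) (C : set (elt M)) : Prop :=
  (C #<= [set: lang_symb L])%card.

(* Parameters are indexed by an ordinal, not an arbitrary ctx, to keep pformula *)
(* in a universe small enough for set (pformula M X).                          *)
Record pformula (L : language) (M : structure L) (X : ctx (sorts L)) := PFormula {
  pf_arity : nat;
  pf_sort : 'I_pf_arity -> sorts L;
  pf_formula : formula (ctx_cat X (Ctx pf_sort));
  pf_params : forall i, M (pf_sort i) }.

Arguments pf_params {L M X} p i : rename.

Definition pf_ctx (L : language) (M : structure L) (X : ctx (sorts L))
  (phi : pformula M X) : ctx (sorts L) := Ctx (@pf_sort L M X phi).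

Definition psat (L : language) (M : structure L) (X : ctx (sorts L))
    (phi : pformula M X) : set (vals M X) :=
  [set a | sat (pf_formula phi)
    (vals_cat a (pf_params phi : vals M (pf_ctx phi)))].

Definition pf_over (L : language) (M : structure L) (X : ctx (sorts L))
    (C : set (elt M)) (phi : pformula M X) : Prop :=
  forall i : 'I_(pf_arity phi), C (existT _ (pf_sort i) (pf_params phi i)).

Definition definable_over (L : language) (M : structure L) (X : ctx (sorts L))
    (C : set (elt M)) (A : set (vals M X)) : Prop :=
  exists2 phi : pformula M X, pf_over C phi & A = psat phi.

Definition definable (L : language) (M : structure L) (X : ctx (sorts L))
    (A : set (vals M X)) : Prop := definable_over setT A.

(* |L|^+-saturation: every type over a set of fewer than |L|^+, i.e. at most  *)
(* |L|, parameters is realized.                                               *)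
Definition saturated (L : language) (M : structure L) : Prop :=
  forall (C : set (elt M)) (X : ctx (sorts L)) (p : set (pformula M X)),
    small C -> p `<=` pf_over C ->
    (forall F : set (pformula M X), F `<=` p -> finite_set F ->
       exists a, forall phi, F phi -> psat phi a) ->
    exists a, forall phi, p phi -> psat phi a.

Definition dp_rank_gt (L : language) (M : structure L) (X : ctx (sorts L))
    (A : set (vals M X)) (n : nat) : Prop :=
  exists (Y : 'I_n.+1 -> ctx (sorts L))
         (phi : forall i, pformula M (ctx_cat X (Y i)))
         (B : forall i, set (vals M (Y i))),
    (forall i, infinite_set (B i)) /\
    (forall b : forall i, vals M (Y i), (forall i, B i (b i)) ->
       exists2 a, A a & forall i y, B i y ->
         (psat (phi i) (vals_cat a y) <-> y = b i)).

Definition dp_rank_ge (L : language) (M : structure L) (X : ctx (sorts L))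
    (A : set (vals M X)) (n : nat) : Prop :=
  if n is m.+1 then dp_rank_gt A m else A !=set0.

Definition has_dp_rank (L : language) (M : structure L) (X : ctx (sorts L))
    (A : set (vals M X)) (n : nat) : Prop :=
  dp_rank_ge A n /\ ~ dp_rank_gt A n.

(* The home sort: vals M (home_ctx L k) is convertible to 'I_k -> home M. *)
Definition home_ctx (L : language) (k : nat) : ctx (sorts L) :=
  @Ctx (sorts L) 'I_k (fun=> home_sort L).

Definition home1 (L : language) (M : structure L) (x : home M) :
  vals M (home_ctx L 1) := fun=> x.

Definition home2 (L : language) (M : structure L) (x y : home M) :
  vals M (home_ctx L 2) := tnth [tuple x; y].

Definition dp_minimal (L : language) (M : structure L) : Prop :=
  has_dp_rank [set: vals M (home_ctx L 1)] 1.

Record definable_uniformity (L : language) (M : structure L)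
    (B : set (set (home M * home M))) : Prop := DefinableUniformity {
  du_definable : exists (Z : ctx (sorts L))
      (phi : formula (ctx_cat (home_ctx L 2) Z)) (D : set (vals M Z)),
      definable D /\
      B = [set [set xy | sat phi (vals_cat (home2 xy.1 xy.2) c)] | c in D];
  du_diagonal : \bigcap_(U in B) U = diagonal;
  du_sym : forall U, B U -> (U^-1)%relation = U;
  du_cap : forall U V, B U -> B V -> exists2 W, B W & W `<=` U `&` V;
  du_comp : forall U, B U -> exists2 V, B V & (V \; V)%relation `<=` U }.

Definition uniform_open (T : Type) (B : set (set (T * T))) : set (set T) :=
  [set O | forall x, O x -> exists2 U, B U & xsection U x `<=` O].

(* T with the topology generated by the family uniform_open B; this family is *)
(* already a topology as soon as B is nonempty and directed, see              *)
(* open_uniform_spaceE.                                                       *)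
Definition uniform_space (T : Type) (B : set (set (T * T))) : Type := T.

HB.instance Definition _ (T : Type) (B : set (set (T * T))) :=
  gen_eqMixin (uniform_space B).
HB.instance Definition _ (T : Type) (B : set (set (T * T))) :=
  gen_choiceMixin (uniform_space B).
HB.instance Definition _ (T : Type) (B : set (set (T * T))) :=
  @isSubBaseTopological.Build (uniform_space B) (set T) (uniform_open B) id.

Lemma open_uniform_spaceE (T : Type) (B : set (set (T * T))) :
  B !=set0 ->
  (forall U V, B U -> B V -> exists2 W, B W & W `<=` U `&` V) ->
  forall O : set (uniform_space B), open O <-> uniform_open B O.
Proof.
move=> [U0 BU0] dirB O; split; last first.
  move=> oO; exists [set O]; last by rewrite bigcup_set1.
  move=> _ /= ->; exists [fset (O : set T)]%fset.
    by move=> V /fset1P ->; exact/mem_set.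
  rewrite predeqE => x; split=> [|Ox V /fset1P ->//].
  by apply; exact/fset1P.
move=> [F sF <-] x [G FG Gx]; have [E sE GE] := sF _ FG.
have EG y : (forall V : set T, V \in E -> V y) -> G y by rewrite -GE.
have Ex (V : set T) : V \in E -> V x by move: Gx; rewrite -GE; apply.
have {GE} [U BU UE] : exists2 U, B U & xsection U x `<=`
    [set y | forall V : set T, V \in (E : seq (set T)) -> V y].
  have {EG sF}: forall V : set T, V \in (E : seq (set T)) ->
      uniform_open B V /\ V x.
    by move=> V EV; split; [exact/set_mem/sE | exact: Ex].
  elim: (E : seq (set T)) => [|V s IHs] sE'; first by exists U0.
  have [W Ws|U BU Us] := IHs; first by apply: sE'; rewrite inE Ws orbT.
  have [oV Vx] := sE' V (mem_head _ _); have [U' BU' U'V] := oV _ Vx.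
  have [W BW sW] := dirB _ _ BU BU'; exists W => // y.
  rewrite /xsection /= => /set_mem /sW [Uxy U'xy] V'.
  rewrite inE => /orP[/eqP ->|V's]; first by apply: U'V; exact/mem_set.
  by apply: Us => //; exact/mem_set.
by exists U => // y /UE Ey; exists G => //; exact: EG.
Qed.

Definition frontier (T : Type) (B : set (set (T * T))) (k : nat)
    (A : set ('I_k -> T)) : set ('I_k -> T) :=
  closure (A : set (prod_topology (fun _ : 'I_k => uniform_space B))) `\` A.

Definition acl (L : language) (M : structure L) (C : set (elt M)) :
    set (home M) :=
  [set x | exists phi : pformula M (home_ctx L 1),
     [/\ pf_over C phi, finite_set (psat phi) & psat phi (home1 x)]].

Definition adjoin (L : language) (M : structure L) (C : set (elt M)) (k : nat)
    (a : 'I_k -> home M) (I : {set 'I_k}) : set (elt M) :=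
  C `|` [set existT _ (home_sort L) (a i) | i in [set` I]].

(* The least length of a subtuple (a_i)_(i in I) of a with                    *)
(* a \in acl (C, (a_i)_(i in I)); I = setT always qualifies.                  *)
Definition dim_tuple (L : language) (M : structure L) (C : set (elt M))
    (k : nat) (a : 'I_k -> home M) : nat :=
  #|[arg min_(I < [set: 'I_k]%SET
      | `[< forall i, acl (adjoin C a I) (a i) >]) #|I|]|.

Definition dim_over (L : language) (M : structure L) (C : set (elt M))
    (k : nat) (A : set ('I_k -> home M)) : \bar int :=
  \big[maxe/-oo%E]_(l < k.+1
    | `[< exists2 a, A a & dim_tuple C a = l >]) (l%:Z%:E)%E.

(* Computed over a chosen small set of parameters defining A. *)
Definition def_dim (L : language) (M : structure L) (k : nat)
    (A : set ('I_k -> home M)) : \bar int :=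
  dim_over (xget set0 [set C : set (elt M) |
    small C /\ definable_over C (A : set (vals M (home_ctx L k)))]) A.

(* Main.v *)
(* Work with algebraic independence in the saturated model; E is a small set over  *)
(* which A and the uniformity are defined.                                         *)
(* - A definable set containing a point a with independent coordinates contains a  *)
(*   neighborhood of a. Since the parameters of the uniformity may be entangled    *)
(*   with a, they are replaced by conjugates, and P. M. Neumann's lemma shows that *)
(*   conjugates define the same neighborhoods of a generic point.                  *)
(* - dp-minimality gives an exchange property: e cannot make two coordinates of an *)
(*   independent pair algebraic. It also says that a scale w infinitesimal over    *)
(*   E x remains so over E e, when x is algebraic over E e but not over E.         *)
(* - Suppose that the frontier has a point of dimension at least dim A. Moving it  *)
(*   inside a box, we get b in the frontier, algebraic over E b_I, with b_I        *)
(*   independent over E and |I| >= dim A. By the first point there are a in A      *)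
(*   with a_I = b_I arbitrarily close to b; take a within a scale w infinitesimal  *)
(*   over E b. As a is algebraic over E a_J with |J| <= |I| and a_I = b_I, the     *)
(*   second point makes w infinitesimal over E a_J, so w separates the distinct    *)
(*   points a and b, which are algebraic over E a_J: a contradiction.              *)
Require Import Defs.
From mathcomp Require Import all_boot all_order all_algebra.
From mathcomp Require Import all_classical constructive_ereal topology.

Set Implicit Arguments.
Unset Strict Implicit.
Unset Printing Implicit Defensive.

Local Open Scope classical_set_scope.

(** * Substitution and definability *)

(** The dimension of a tuple is the size of a minimal generating subtuple, and such a subtuple is
    independent. Three facts about independent tuples carry the proof.

    Openness: a set definable over [E] that contains a point independent over [E] contains a box
    around it ([interior_point], [interior_point_over], [infinite_box]). The obstacle is that the
    parameters of the uniformity may depend on the point; [not_split_at] lets them be replaced by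
    conjugates without changing the neighbourhoods of a generic point. A consequence is that small
    scales can be chosen generically ([generic_scale]).

    Counting: one new parameter destroys at most one coordinate of an independent tuple. This weak
    form of exchange ([exchange], [indep_adjoin1], [indep_adjoin]) holds because an element that
    makes two independent elements algebraic would produce a pattern of dp-rank 2.

    Scales: if [x] is algebraic over [E] and [e] but not over [E], a scale infinitesimal over [E]
    and [x] is infinitesimal over [E] and [e] ([infinitesimal_transfer]). Otherwise [e] would encode
    both [x] and an unrelated scale, again a pattern of dp-rank 2. Replacing basis elements one at a
    time gives [infinitesimal_basis].

    Let a frontier point have dimension at least that of [A]. By [generic_near] and
    [near_same_basis] there are a frontier point [b] and a point [a] of [A] that share a basis of
    [b], with [a] within [w] of [b] and [w] infinitesimal over [b]. A basis of [a] is no larger than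
    that of [b], so [w] is infinitesimal over it too. But [a] and [b] are distinct and algebraic
    over this basis, hence not within [w] of each other ([infinitesimal_apart], [frontier_rank]). *)

Fixpoint tsubst (L : language) (X Y : ctx (sorts L))
    (f : forall v : X, term Y (ctx_sort v)) (s : sorts L) (t : term X s) :
    term Y s :=
  match t with
  | tvar v => f v
  | tfun g args => tfun (fun v => tsubst f (args v))
  end.

Definition tlift (L : language) (X Y : ctx (sorts L)) (s : sorts L)
    (f : forall v : X, term Y (ctx_sort v)) :
    forall v : ctx_cons s X, term (ctx_cons s Y) (ctx_sort v) :=
  fun v => match v with
  | Some x => tsubst (fun y => @tvar L (ctx_cons s Y) (Some y)) (f x)
  | None => @tvar L (ctx_cons s Y) None
  end.

Fixpoint fsubst (L : language) (X Y : ctx (sorts L))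
    (f : forall v : X, term Y (ctx_sort v)) (phi : formula X) : formula Y :=
  match phi in formula _ return formula Y with
  | fbot => fbot Y
  | feq _ t u => feq (tsubst f t) (tsubst f u)
  | Defs.frel r args => Defs.frel (fun v => tsubst f (args v))
  | fimp psi chi => fimp (fsubst f psi) (fsubst f chi)
  | fall s psi => fall (fsubst (tlift f) psi)
  end.

Section Substitution.
Variables (L : language) (M : structure L).

Lemma eval_tsubst (X Y : ctx (sorts L)) (f : forall v : X, term Y (ctx_sort v))
    (s : sorts L) (t : term X s) (a : vals M Y) :
  Defs.eval a (tsubst f t) = Defs.eval (fun v => Defs.eval a (f v)) t.
Proof.
elim: t => //= g args IH; congr func_interp.
by apply/functional_extensionality_dep => v; exact: IH.
Qed.

Lemma sat_fsubst (X : ctx (sorts L)) (phi : formula X) (Y : ctx (sorts L))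
    (f : forall v : X, term Y (ctx_sort v)) (a : vals M Y) :
  sat (fsubst f phi) a <-> sat phi (fun v => Defs.eval a (f v)).
Proof.
elim: phi Y f a => {X} [X|X s t u|X r args|X psi IHpsi chi IHchi|X s psi IH]
  Y f a //=.
- by rewrite !eval_tsubst.
- suff -> : (fun v => Defs.eval a (tsubst f (args v))) =
    (fun v => Defs.eval (fun u => Defs.eval a (f u)) (args v)) by [].
  by apply/functional_extensionality_dep => v; exact: eval_tsubst.
- by rewrite IHpsi IHchi.
- have E c : (fun v => Defs.eval (vals_cons c a) (tlift f v)) =
      vals_cons c (fun v => Defs.eval a (f v)) :> vals M (ctx_cons s X).
    by apply/functional_extensionality_dep => -[v|] //=; rewrite eval_tsubst.
  split=> h c; first by rewrite -E -IH; exact: h.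
  by rewrite IH E; exact: h.
Qed.

Lemma eval_cast (X : ctx (sorts L)) (a : vals M X) (s t : sorts L) (e : s = t)
    (u : term X s) :
  Defs.eval a (ecast z (term X z) e u) = ecast z (M z) e (Defs.eval a u).
Proof. by case: t / e. Qed.

Lemma vals_castE (X : ctx (sorts L)) (a : vals M X) (u v : X) (e : u = v) :
  ecast z (M z) (congr1 (@ctx_sort _ X) e) (a u) = a v.
Proof. by case: v / e. Qed.

(* Quantification over all variables of Y at once; Y is first renamed into an *)
(* isomorphic context so that its variables can be bound one at a time.       *)
Definition quantifiable (Y : ctx (sorts L)) :=
  forall (W : ctx (sorts L)) (phi : formula (ctx_cat W Y)),
    exists psi : formula W, forall a : vals M W,
      sat psi a <-> forall y : vals M Y, sat phi (vals_cat a y).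

Definition reindex_ctx (Y : ctx (sorts L)) (T : finType) (f : T -> Y) :=
  @Ctx (sorts L) T (fun t => ctx_sort (f t)).

Section Reindex.
Variables (Y : ctx (sorts L)) (T : finType) (f : T -> Y) (g : Y -> T).
Hypotheses (fK : cancel f g) (gK : cancel g f).

Definition reindex_term (W : ctx (sorts L)) :
    forall v : ctx_cat W Y, term (ctx_cat W (reindex_ctx f)) (ctx_sort v) :=
  fun v => match v with
  | inl w => @tvar L (ctx_cat W (reindex_ctx f)) (inl w)
  | inr y => ecast z (term _ z) (congr1 (@ctx_sort _ Y) (gK y))
               (@tvar L (ctx_cat W (reindex_ctx f)) (inr (g y)))
  end.

Lemma sat_reindex (W : ctx (sorts L)) (phi : formula (ctx_cat W Y))
    (a : vals M W) (y : vals M Y) :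
  sat (fsubst (reindex_term (W := W)) phi)
    (vals_cat a (fun t => y (f t) : M (@ctx_sort _ (reindex_ctx f) t))) <->
  sat phi (vals_cat a y).
Proof.
rewrite sat_fsubst; set b := fun v => _; suff -> : b = vals_cat a y by [].
apply/functional_extensionality_dep => -[w|v] //=.
by rewrite /b /= eval_cast /=; exact: vals_castE.
Qed.

Lemma reindex_vals (y' : vals M (reindex_ctx f)) :
  exists y : vals M Y, y' = fun t => y (f t).
Proof.
exists (fun v => ecast z (M z) (congr1 (@ctx_sort _ Y) (gK v)) (y' (g v))).
apply/functional_extensionality_dep => t.
move: (gK (f t)); rewrite fK => e.
by rewrite (eq_irrelevance e (erefl _)).
Qed.

Lemma quantifiable_reindex : quantifiable (reindex_ctx f) -> quantifiable Y.
Proof.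
move=> qf W phi; have [psi psiP] := qf W (fsubst (reindex_term (W := W)) phi).
exists psi => a; rewrite psiP; split=> h y.
  by apply/sat_reindex; exact: (h (fun t => y (f t))).
by have [z ->] := reindex_vals y; apply/sat_reindex.
Qed.

End Reindex.

Lemma quantifiable_ord n (s : 'I_n -> sorts L) : quantifiable (Ctx s).
Proof.
elim: n s => [|n IHn] s.
  move=> W phi.
  pose f (v : ctx_cat W (Ctx s)) : term W (ctx_sort v) :=
    match v with inl w => tvar w | inr i => False_rect _ (ltac:(by case: i)) end.
  exists (fsubst f phi) => a; rewrite sat_fsubst.
  have e (y : vals M (Ctx s)) : (fun v => Defs.eval a (f v)) = vals_cat a y.
    by apply/functional_extensionality_dep => -[w|[]].
  have y0 : vals M (Ctx s) by case.
  split=> [h y|/(_ y0)]; first by rewrite -(e y).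
  by rewrite -(e y0).
pose f (o : option 'I_n) : 'I_n.+1 := if o is Some j then lift ord0 j else ord0.
have fK : cancel f (unlift ord0) by case=> [j|] /=; rewrite ?liftK ?unlift_none.
have gK : cancel (unlift ord0) f by move=> i; case: unliftP.
apply: (@quantifiable_reindex (Ctx s) _ f _ fK gK) => W phi.
pose s' j := s (lift ord0 j).
pose W' := ctx_cat (ctx_cons (s ord0) W) (Ctx s').
pose sg (v : ctx_cat W (@reindex_ctx (Ctx s) _ f)) : term W' (ctx_sort v) :=
  match v with
  | inl w => @tvar L W' (inl (Some w))
  | inr None => @tvar L W' (inl None)
  | inr (Some j) => @tvar L W' (inr j)
  end.
have [psi psiP] := IHn s' _ (fsubst sg phi).
exists (fall psi) => a /=; split=> [h y|h c].
  have /psiP/(_ (fun j => y (Some j))) := h (y None); rewrite sat_fsubst.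
  by set b := fun v => _; suff -> : b = vals_cat a y by [];
     apply/functional_extensionality_dep => -[w|[j|]].
apply/psiP => y; rewrite sat_fsubst.
pose y' : vals M (@reindex_ctx (Ctx s) _ f) :=
  fun o => match o with Some j => y j | None => c end.
by set b := fun v => _; suff -> : b = vals_cat a y' by [];
   apply/functional_extensionality_dep => -[w|[j|]].
Qed.

Lemma quantifiableP (Y : ctx (sorts L)) : quantifiable Y.
Proof.
exact: (quantifiable_reindex (@enum_valK Y) (@enum_rankK Y)
  (@quantifiable_ord _ _)).
Qed.

End Substitution.

Section Definable.
Variables (L : language) (M : structure L).
Implicit Types (C : set (elt M)) (X Y P : ctx (sorts L)).

Definition elem (s : sorts L) (x : M s) : elt M := existT _ s x.

Definition rng Y (w : vals M Y) : set (elt M) := [set elem (w v) | v in setT].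

(* definable_over C, with the parameters indexed by an arbitrary context. *)
Definition dfn C X (A : vals M X -> Prop) :=
  exists P (phi : formula (ctx_cat X P)) (q : vals M P),
    (forall v, C (elem (q v))) /\ forall a, A a <-> sat phi (vals_cat a q).

Definition tm C X s (t : vals M X -> M s) :=
  exists P (u : term (ctx_cat X P) s) (q : vals M P),
    (forall v, C (elem (q v))) /\
    forall a, t a = Defs.eval (vals_cat a q) u.

Lemma dfn_ext C X (A B : vals M X -> Prop) :
  (forall a, A a <-> B a) -> dfn C A -> dfn C B.
Proof.
by move=> AB [P [phi [q [Cq h]]]]; exists P, phi, q; split=> // a; rewrite -AB.
Qed.

Lemma dfn_sub C C' X (A : vals M X -> Prop) :
  C `<=` C' -> dfn C A -> dfn C' A.
Proof.
by move=> CC' [P [phi [q [Cq h]]]]; exists P, phi, q; split=> // v; exact: CC'.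
Qed.

Lemma tm_var C X (v : X) : tm C (fun a : vals M X => a v).
Proof.
exists (ctx0 (sorts L)), (@tvar L (ctx_cat X (ctx0 (sorts L))) (inl v)).
by exists (vals0 M); split=> // -[].
Qed.

Lemma tm_const C X s (x : M s) : C (elem x) -> tm C (fun _ : vals M X => x).
Proof.
move=> Cx; pose P := @Ctx (sorts L) unit (fun=> s).
by exists P, (@tvar L (ctx_cat X P) (inr tt)), (fun=> x).
Qed.

Definition sum_ctx Y (P : Y -> ctx (sorts L)) : ctx (sorts L) :=
  @Ctx (sorts L) {v : Y & P v} (fun u => ctx_sort (tagged u)).

(** Each term [g a v] brings its own parameter context [P v]; they are gathered in [sum_ctx P]. *)
Lemma dfn_app C X Y (R : vals M Y -> Prop) (g : vals M X -> vals M Y) :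
  dfn C R -> (forall v, tm C (fun a => g a v)) -> dfn C (fun a => R (g a)).
Proof.
move=> [P0 [phi [q0 [Cq0 Rphi]]]] gtm.
pose P v := projT1 (cid (gtm v)).
have H2 v := projT2 (cid (gtm v)).
pose u v := projT1 (cid (H2 v)).
have H3 v := projT2 (cid (H2 v)).
pose q v := projT1 (cid (H3 v)).
have H4 v : (forall w, C (elem (q v w))) /\
  forall a, g a v = Defs.eval (vals_cat a (q v)) (u v) := projT2 (cid (H3 v)).
pose PP := ctx_cat P0 (sum_ctx P).
pose ren v (w : ctx_cat X (P v)) : term (ctx_cat X PP) (ctx_sort w) :=
  match w with
  | inl x => @tvar L (ctx_cat X PP) (inl x)
  | inr z => @tvar L (ctx_cat X PP) (inr (inr (Tagged P z)))
  end.
pose sg (w : ctx_cat Y P0) : term (ctx_cat X PP) (ctx_sort w) :=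
  match w with
  | inl y => tsubst (@ren y) (u y)
  | inr z => @tvar L (ctx_cat X PP) (inr (inl z))
  end.
pose qq : vals M PP := vals_cat q0
  ((fun t : {v : Y & P v} => q (tag t) (tagged t)) : vals M (sum_ctx P)).
exists PP, (fsubst sg phi), qq; split.
  by case=> [z|[y z]] //=; exact: (H4 y).1.
move=> a; rewrite Rphi sat_fsubst; set b := fun v => _.
suff -> : b = vals_cat (g a) q0 by [].
apply/functional_extensionality_dep => -[y|z] //=; rewrite /b /= eval_tsubst.
rewrite (H4 y).2.
suff -> : (fun v => Defs.eval (vals_cat a qq) (ren y v)) = vals_cat a (q y) by [].
by apply/functional_extensionality_dep => -[x|z].
Qed.

Lemma dfn_sat X (phi : formula X) C : dfn C (fun a : vals M X => sat phi a).
Proof.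
pose f (v : X) : term (ctx_cat X (ctx0 (sorts L))) (ctx_sort v) :=
  @tvar L (ctx_cat X (ctx0 (sorts L))) (inl v).
exists (ctx0 (sorts L)), (fsubst f phi), (vals0 M); split; first by case.
by move=> a; rewrite sat_fsubst.
Qed.

Lemma dfn_False C X : dfn C (fun _ : vals M X => False).
Proof. exact: (dfn_sat (fbot X)). Qed.

Lemma dfn_imp C X (A B : vals M X -> Prop) :
  dfn C A -> dfn C B -> dfn C (fun a => A a -> B a).
Proof.
move=> [P [phi [q [Cq Aphi]]]] [P' [phi' [q' [Cq' Bphi']]]].
pose f (v : ctx_cat X P) : term (ctx_cat X (ctx_cat P P')) (ctx_sort v) :=
  match v with
  | inl x => @tvar L (ctx_cat X (ctx_cat P P')) (inl x)
  | inr x => @tvar L (ctx_cat X (ctx_cat P P')) (inr (inl x))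
  end.
pose f' (v : ctx_cat X P') : term (ctx_cat X (ctx_cat P P')) (ctx_sort v) :=
  match v with
  | inl x => @tvar L (ctx_cat X (ctx_cat P P')) (inl x)
  | inr x => @tvar L (ctx_cat X (ctx_cat P P')) (inr (inr x))
  end.
exists (ctx_cat P P'), (fimp (fsubst f phi) (fsubst f' phi')), (vals_cat q q').
split; first by case.
move=> a /=; rewrite !sat_fsubst Aphi Bphi'.
have -> : (fun v => Defs.eval (vals_cat a (vals_cat q q')) (f v)) = vals_cat a q.
  by apply/functional_extensionality_dep => -[].
suff -> : (fun v => Defs.eval (vals_cat a (vals_cat q q')) (f' v)) =
  vals_cat a q' by [].
by apply/functional_extensionality_dep => -[].
Qed.

Lemma dfn_eq C X s (t u : vals M X -> M s) :
  tm C t -> tm C u -> dfn C (fun a => t a = u a).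
Proof.
move=> tt uu; pose Y := @Ctx (sorts L) bool (fun=> s).
pose R := sat (M := M) (feq (@tvar L Y true) (@tvar L Y false)).
pose g (a : vals M X) : vals M Y := fun b => if b then t a else u a.
by have := @dfn_app C X Y R g (dfn_sat _ _); apply; case.
Qed.

Lemma dfn_forall C X Y (A : vals M X -> vals M Y -> Prop) :
  dfn C (fun b : vals M (ctx_cat X Y) =>
           A (fun v => b (inl v)) (fun v => b (inr v))) ->
  dfn C (fun a => forall y : vals M Y, A a y).
Proof.
move=> [P [phi [q [Cq Aphi]]]].
pose W := ctx_cat (ctx_cat X P) Y.
pose f (v : ctx_cat (ctx_cat X Y) P) : term W (ctx_sort v) :=
  match v with
  | inl (inl x) => @tvar L W (inl (inl x))
  | inl (inr y) => @tvar L W (inr y)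
  | inr p => @tvar L W (inl (inr p))
  end.
have [psi psiP] := quantifiableP M (fsubst f phi).
exists P, psi, q; split=> // a; rewrite psiP.
have E y : (fun v => Defs.eval (vals_cat (vals_cat a q) y) (f v)) =
    vals_cat (vals_cat a y) q.
  by apply/functional_extensionality_dep => -[[x|y']|p].
by split=> h y; have := h y; rewrite sat_fsubst E -Aphi.
Qed.

Lemma dfn_not C X (A : vals M X -> Prop) : dfn C A -> dfn C (fun a => ~ A a).
Proof. by move=> dA; apply: dfn_imp => //; exact: dfn_False. Qed.

Lemma dfn_and C X (A B : vals M X -> Prop) :
  dfn C A -> dfn C B -> dfn C (fun a => A a /\ B a).
Proof.
move=> dA dB; apply: (@dfn_ext _ _ (fun a => ~ (A a -> ~ B a))).
  move=> a; split=> [|[Aa Ba]]; last by apply.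
  by move/not_implyP => -[Aa /contrapT Ba].
by apply: dfn_not; apply: dfn_imp => //; exact: dfn_not.
Qed.

Lemma dfn_or C X (A B : vals M X -> Prop) :
  dfn C A -> dfn C B -> dfn C (fun a => A a \/ B a).
Proof.
move=> dA dB; apply: (@dfn_ext _ _ (fun a => ~ A a -> B a)).
  move=> a; split=> [h|[//|//]].
  by have [?|/h ?] := pselect (A a); [left|right].
by apply: dfn_imp => //; exact: dfn_not.
Qed.

Lemma dfn_iff C X (A B : vals M X -> Prop) :
  dfn C A -> dfn C B -> dfn C (fun a => A a <-> B a).
Proof. by move=> dA dB; apply: dfn_and; exact: dfn_imp. Qed.

Lemma dfn_exists C X Y (A : vals M X -> vals M Y -> Prop) :
  dfn C (fun b : vals M (ctx_cat X Y) =>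
           A (fun v => b (inl v)) (fun v => b (inr v))) ->
  dfn C (fun a => exists y : vals M Y, A a y).
Proof.
move=> dA; apply: (@dfn_ext _ _ (fun a => ~ forall y, ~ A a y)).
  by move=> a; rewrite -existsNE; split=> [[y /contrapT Ay]|[y Ay]]; exists y => //; apply.
by apply: dfn_not; apply: dfn_forall; apply: dfn_not.
Qed.

Lemma dfn_forall_home C X (A : vals M X -> home M -> Prop) :
  dfn C (fun b : vals M (ctx_cat X (home_ctx L 1)) =>
           A (fun v => b (inl v)) (b (inr (ord0 : 'I_1)))) ->
  dfn C (fun a => forall y : home M, A a y).
Proof.
move=> /(@dfn_forall C X (home_ctx L 1) (fun a y => A a (y (ord0 : 'I_1)))); apply: dfn_ext => a.
by split=> h y; [exact: (h (home1 y))|exact: h].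
Qed.

Lemma dfn_exists_home C X (A : vals M X -> home M -> Prop) :
  dfn C (fun b : vals M (ctx_cat X (home_ctx L 1)) =>
           A (fun v => b (inl v)) (b (inr (ord0 : 'I_1)))) ->
  dfn C (fun a => exists y : home M, A a y).
Proof.
move=> /(@dfn_exists C X (home_ctx L 1) (fun a y => A a (y (ord0 : 'I_1)))); apply: dfn_ext => a.
by split=> [[y Ay]|[y Ay]]; [exists (y (ord0 : 'I_1))|exists (home1 y)].
Qed.

Lemma dfn_forall_tuple C X k (A : vals M X -> ('I_k -> home M) -> Prop) :
  dfn C (fun b : vals M (ctx_cat X (home_ctx L k)) =>
           A (fun v => b (inl v)) (fun i => b (inr i))) ->
  dfn C (fun a => forall y : 'I_k -> home M, A a y).
Proof. exact: (@dfn_forall _ _ (home_ctx L k)). Qed.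

Lemma dfn_exists_tuple C X k (A : vals M X -> ('I_k -> home M) -> Prop) :
  dfn C (fun b : vals M (ctx_cat X (home_ctx L k)) =>
           A (fun v => b (inl v)) (fun i => b (inr i))) ->
  dfn C (fun a => exists y : 'I_k -> home M, A a y).
Proof. exact: (@dfn_exists _ _ (home_ctx L k)). Qed.

Lemma dfn_True C X : dfn C (fun _ : vals M X => True).
Proof. by apply: (dfn_ext _ (dfn_not (@dfn_False C X))) => a; split=> // _ []. Qed.

Lemma dfn_cst C X (A : Prop) : dfn C (fun _ : vals M X => A).
Proof.
have [h|h] := pselect A.
  by apply: dfn_ext (@dfn_True C X).
by apply: dfn_ext (@dfn_False C X).
Qed.

Lemma dfn_imp_cst C X (P : Prop) (A : vals M X -> Prop) :
  (P -> dfn C A) -> dfn C (fun a => P -> A a).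
Proof.
have [h|h] := pselect P; last by move=> _; apply: dfn_ext (@dfn_True C X).
by move=> /(_ h); apply: dfn_ext => a; split=> // /(_ h).
Qed.

Lemma dfn_forall_fin C X (T : finType) (A : vals M X -> T -> Prop) :
  (forall i, dfn C (fun a => A a i)) -> dfn C (fun a => forall i, A a i).
Proof.
move=> dA; suff: dfn C (fun a => forall i, i \in enum T -> A a i).
  by apply: dfn_ext => a; split=> h i; have := h i; rewrite ?mem_enum; auto.
elim: (enum T) => [|i s IHs]; first by apply: dfn_ext (@dfn_True C X).
apply: (dfn_ext _ (dfn_and (dA i) IHs)) => a; split.
  by move=> [Ai h] j; rewrite inE => /predU1P[->|/h].
by move=> h; split=> [|j js]; apply: h; rewrite inE ?eqxx ?js ?orbT.
Qed.

Lemma dfn_exists_fin C X (T : finType) (A : vals M X -> T -> Prop) :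
  (forall i, dfn C (fun a => A a i)) -> dfn C (fun a => exists i, A a i).
Proof.
move=> dA; apply: (@dfn_ext _ _ (fun a => ~ forall i, ~ A a i)).
  by move=> a; rewrite -existsNE; split=> [[y /contrapT Ay]|[y Ay]]; exists y => //; apply.
by apply: dfn_not; apply: dfn_forall_fin => i; exact: dfn_not.
Qed.

Lemma definable_overP C X (A : set (vals M X)) : definable_over C A <-> dfn C A.
Proof.
split=> [|].
  move=> [phi oC eA].
  exists (pf_ctx phi), (pf_formula phi), (pf_params phi).
  by split=> [v|a]; [exact: oC|rewrite eA].
move=> [P [phi [q [Cq Aphi]]]].
pose f := @enum_val P P; pose g := @enum_rank P.
have fK : cancel f g := @enum_valK P; have gK : cancel g f := @enum_rankK P.
exists (@PFormula L M X #|P| (fun i => ctx_sort (f i))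
   (fsubst (reindex_term gK (W := X)) phi) (fun i => q (f i))).
  by move=> i; exact: Cq.
apply/seteqP; split=> a.
  by move/Aphi => h; apply/(sat_reindex gK phi a q).
by move=> h; apply/Aphi; apply/(sat_reindex gK phi a q).
Qed.

(** Each parameter lies in [C] or is a coordinate of [w]. Replacing it by a term in fresh variables
    for [w] exhibits [A] as a fibre of a [C]-definable family. *)
Lemma dfn_adjoin C X Y (w : vals M Y) (A : vals M X -> Prop) :
  dfn (C `|` rng w) A ->
  exists R : vals M X -> vals M Y -> Prop,
    dfn C (fun b : vals M (ctx_cat X Y) =>
             R (fun v => b (inl v)) (fun v => b (inr v))) /\
    forall a, A a <-> R a w.
Proof.
move=> [P [phi [q [Cq Aphi]]]].
have H (z : elt M) : (C `|` rng w) z ->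
    exists2 t : vals M Y -> M (tag z), tm C t & t w = tagged z.
  move=> [Cz|[u _ <-]]; last by exists (fun y => y u) => //; exact: tm_var.
  by exists (fun=> tagged z) => //; apply: tm_const; case: z Cz.
pose t v := projT1 (cid2 (H _ (Cq v))).
have tC v : tm C (t v) by rewrite /t; case: cid2.
have tq v : t v w = q v by rewrite /t; case: cid2.
exists (fun a y => sat phi (vals_cat a (fun v => t v y))); split.
  pose g (b : vals M (ctx_cat X Y)) : vals M (ctx_cat X P) :=
    vals_cat (fun v => b (inl v)) (fun v => t v (fun v => b (inr v))).
  apply: (@dfn_app _ _ _ (sat phi) g); first exact: dfn_sat.
  case=> [x|v]; first exact: (@tm_var C (ctx_cat X Y) (inl x)).
  have [P' [u [q' [Cq' tu]]]] := tC v.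
  pose W := ctx_cat (ctx_cat X Y) P'.
  pose f (x : ctx_cat Y P') : term W (ctx_sort x) :=
    match x with
    | inl y => @tvar L W (inl (inr y))
    | inr p => @tvar L W (inr p)
    end.
  exists P', (tsubst f u), q'; split=> // b; rewrite eval_tsubst /= tu.
  suff -> : (fun v => Defs.eval (vals_cat b q') (f v)) =
      vals_cat (fun v => b (inr v)) q' by [].
  by apply/functional_extensionality_dep => -[].
move=> a; rewrite Aphi; suff -> : (fun v => t v w) = q by [].
by apply/functional_extensionality_dep.
Qed.

End Definable.

Ltac dfn_step :=
  lazymatch goal with
  | |- dfn _ (fun a => @?P a /\ @?Q a) => apply: dfn_and; cbv beta
  | |- dfn _ (fun a => @?P a \/ @?Q a) => apply: dfn_or; cbv beta
  | |- dfn _ (fun a => ~ (@?P a)) => apply: dfn_not; cbv beta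
  | |- dfn _ (fun a => @?P a <-> @?Q a) => apply: dfn_iff; cbv beta
  | |- dfn _ (fun a => @eq _ (@?x a) (@?y a)) => apply: dfn_eq; cbv beta
  | |- dfn _ (fun a => exists y : vals _ _, @?P a y) => apply: dfn_exists; cbv beta
  | |- dfn _ (fun a => exists y : home _, @?P a y) =>
      apply: dfn_exists_home; cbv beta
  | |- dfn _ (fun a => exists y : ('I_ _ -> home _), @?P a y) =>
      apply: dfn_exists_tuple; cbv beta
  | |- dfn _ (fun a => exists y : _, @?P a y) => apply: dfn_exists_fin => ?; cbv beta
  | |- dfn _ (fun a => forall y : vals _ _, @?P a y) => apply: dfn_forall; cbv beta
  | |- dfn _ (fun a => forall y : home _, @?P a y) =>
      apply: dfn_forall_home; cbv beta
  | |- dfn _ (fun a => forall y : ('I_ _ -> home _), @?P a y) =>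
      apply: dfn_forall_tuple; cbv beta
  | |- dfn _ (fun a => @?P a -> @?Q a) =>
      first [apply: dfn_imp_cst => ? | apply: dfn_imp]; cbv beta
  | |- dfn _ (fun a => forall y : _, @?P a y) => apply: dfn_forall_fin => ?; cbv beta
  end.

(* The sort of v is only convertible to the sort in the goal, hence exact. *)
Ltac tmv :=
  intros; lazymatch goal with
  | |- @tm ?L ?M ?C ?X _ (fun a => a ?v) => exact (@tm_var L M C X v)
  end.

Ltac inC :=
  solve [assumption
  | by eexists
  | match goal with H : rng ?p `<=` ?C |- ?C (elem (?p _)) =>
      by apply: H; eexists end
  | left; inC | right; inC].

Ltac tmc := intros; first [tmv | apply: tm_const; inC].

(** * Finite sets *)

Section Finiteness.
Variable T : Type.
Implicit Types F G : set T.

(** Excluding injective tuples of length [n.+1] makes a bound on cardinality first-order, see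
    [dfn_leqn]. *)
Definition leqn F n := ~ exists t : 'I_n.+1 -> T, injective t /\ forall i, F (t i).

Lemma infinite_enum F : infinite_set F ->
  exists x : nat -> T, injective x /\ forall i, F (x i).
Proof.
move/infiniteP/card_leP => [f].
have mT (n : nat) : n \in [set: nat] by rewrite inE.
exists (fun n => val (f (SigSub (mT n)))); split.
  move=> n m /val_inj /(@inj _ _ _ f); rewrite !inE => /(_ I I).
  by move=> e; have /= := congr1 val e.
by move=> i; apply/set_mem; exact: valP.
Qed.

Lemma infinite_tuple F n : infinite_set F ->
  exists t : 'I_n -> T, injective t /\ forall i, F (t i).
Proof.
move=> /infinite_enum [x [xI xF]]; exists (fun i => x (val i)).
by split=> // i j /xI /val_inj.
Qed.

Lemma leqn_finite F n : leqn F n -> finite_set F.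
Proof. by move=> h; apply: contrapT => /(@infinite_tuple _ n.+1)/h. Qed.

Lemma finite_leqn F : finite_set F -> exists n, leqn F n.
Proof.
case=> n /card_eqPle[/card_leP[f] _]; exists n => -[t [tI tF]].
pose g i := val (f (SigSub (mem_set (tF i)))).
have gn i : (g i < n)%N by have := valP (f (SigSub (mem_set (tF i)))); rewrite inE.
suff gI : injective (fun i => Ordinal (gn i)).
  by have := leq_card _ gI; rewrite !card_ord ltnn.
move=> i j [/val_inj /(@inj _ _ _ f)]; rewrite !inE => /(_ I I) e.
by apply: tI; have /= := congr1 val e.
Qed.

Lemma leqnW F n m : (n <= m)%N -> leqn F n -> leqn F m.
Proof.
move=> nm h [t [tI tF]]; apply: h.
have nm' : (n.+1 <= m.+1)%N by [].
exists (fun i => t (widen_ord nm' i)); split=> // i j /tI /(congr1 val) /= e.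
exact: val_inj.
Qed.

End Finiteness.

Definition upd (T : Type) k (x : 'I_k -> T) (i : 'I_k) (t : T) : 'I_k -> T :=
  fun j => if j == i then t else x j.

Lemma leqn_inj (T T' : Type) (F : set T) (G : set T') (h : T -> T') n :
  injective h -> (forall x, F x -> G (h x)) -> leqn G n -> leqn F n.
Proof.
move=> hI FG lG [t [tI tF]]; apply: lG; exists (h \o t); split.
  exact: inj_comp.
by move=> i; exact: FG.
Qed.

Lemma leqn_bigcup (S : finType) (T : Type) (F : S -> set T) n :
  (forall s, leqn (F s) n) -> leqn (\bigcup_s F s) (#|S| * n).
Proof.
move=> lF [t [tI tF]].
have /choice[f fF] : forall i, exists s, F s (t i).
  by move=> i; have [s _ Fs] := tF i; exists s.
have : (\sum_(s : S) #|[pred i | f i == s]| <= #|S| * n)%N.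
  apply: (@leq_trans (\sum_(s : S) n)); last by rewrite sum_nat_const.
  apply: leq_sum => s _; rewrite leqNgt; apply/negP => ltn.
  apply: (lF s); exists (fun i => t (enum_val (widen_ord ltn i))); split.
    by move=> i j /tI /enum_val_inj /(congr1 val) /= /val_inj.
  move=> i; have := enum_valP (widen_ord ltn i); set e := enum_val _.
  by rewrite inE => /eqP fe; have := fF e; rewrite fe.
suff -> : (\sum_(s : S) #|[pred i | f i == s]| = (#|S| * n).+1)%N by rewrite ltnn.
apply: (@etrans _ _ #|'I_(#|S| * n).+1|); last by rewrite card_ord.
rewrite -[RHS]sum1_card (partition_big f xpredT) //=.
by apply: eq_bigr => s _; rewrite sum1_card; apply: eq_card.
Qed.

(** Once the coordinates in [s] are confined to [0..N], at most [#|S| * n] values of a further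
    coordinate [i] are bad for some choice of them, so one value up to this bound is good for all
    choices. The resulting bound does not depend on [Th]. *)
Lemma nat_grid k n (s : seq 'I_k) : exists N, forall (Th : 'I_k -> set ('I_k -> nat)),
  (forall i x, leqn [set t | Th i (upd x i t)] n) -> forall z : 'I_k -> nat,
  exists r : 'I_k -> nat, [/\ forall j, j \notin s -> r j = z j,
    forall j, j \in s -> (r j <= N)%N & forall j, j \in s -> ~ Th j r].
Proof.
elim: s => [|i s [N IHs]]; first by exists 0 => Th _ z; exists z.
have [indep|indep] := boolP (i \in s).
  exists N => Th bTh z; have [r [rz rN rTh]] := IHs Th bTh z; exists r.
  have e j : j \in i :: s = (j \in s).
    by rewrite inE; case: eqP => // ->.
  by split=> j; rewrite e; auto.
pose S := {ffun 'I_k -> 'I_N.+1}.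
exists (maxn N (#|S| * n)) => Th bTh z.
pose y (f : S) : 'I_k -> nat := fun j => if j \in s then val (f j) else z j.
have [t tN tb] : exists2 t, (t <= #|S| * n)%N & forall f, ~ Th i (upd (y f) i t).
  apply: contrapT => nt.
  have := @leqn_bigcup S nat (fun f => [set t | Th i (upd (y f) i t)]) n.
  apply=> [f|]; first exact: bTh.
  exists val; split; first exact: val_inj.
  move=> t; apply: contrapT => nb; apply: nt; exists (val t).
    by have := ltn_ord t; rewrite ltnS.
  by move=> f Thf; apply: nb; exists f.
have [r [rz rN rTh]] := IHs Th bTh (upd z i t); exists r; split=> j.
- by rewrite inE negb_or => /andP[ji js]; rewrite rz // /upd (negPf ji).
- rewrite inE leq_max => /predU1P[->|/rN ->//].
  by rewrite rz // /upd eqxx tN orbT.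
- rewrite inE => /predU1P[->|]; last exact: rTh.
  pose f : S := [ffun j => inord (r j)].
  suff -> : r = upd (y f) i t by exact: tb.
  apply/functional_extensionality_dep => l; rewrite /upd /y; case: eqP => [->|li].
    by rewrite rz // /upd eqxx.
  case: ifPn => ls; first by rewrite ffunE /= inordK // ltnS rN.
  by rewrite rz // /upd; case: eqP.
Qed.

(** The order of quantifiers matters: the size of the grid is fixed before [Th], so [generic_scale]
    may choose [Th] in terms of the finitely many grid points. *)
Lemma grid_avoid (T : Type) k n (I : {set 'I_k}) (g : 'I_k -> nat -> T) :
  (forall i, i \in I -> injective (g i)) ->
  exists N, forall (Th : 'I_k -> set ('I_k -> T)),
    (forall i x, i \in I -> leqn [set t | Th i (upd x i t)] n) ->
    forall z : 'I_k -> T, exists2 r : 'I_k -> 'I_N.+1, True &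
      forall i, i \in I -> ~ Th i (fun j => if j \in I then g j (r j) else z j).
Proof.
move=> gI; have [N gN] := @nat_grid k n (enum I); exists N => Th bTh z.
pose x (r : 'I_k -> nat) j := if j \in I then g j (r j) else z j.
have [i u|r [_ rN rTh]] := gN (fun i r => i \in I /\ Th i (x r)) _ (fun=> 0).
  have [iI|niI] := boolP (i \in I); last by apply: leqnW (leq0n n) _ => -[t [_ /(_ ord0)[]]].
  apply: (leqn_inj (gI i iI) _ (bTh i (x u) iI)) => t [_].
  suff -> : x (upd u i t) = upd (x u) i (g i t) by [].
  apply/functional_extensionality_dep => j; rewrite /x /upd.
  by case: eqP => // ->; rewrite iI.
exists (fun j => inord (r j)) => // i iI Thi; apply: (rTh i); first by rewrite mem_enum.
split=> //; suff <- : (fun j => if j \in I then g j (inord (r j) : 'I_N.+1) else z j) = x r by [].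
apply/functional_extensionality_dep => j; rewrite /x; case: ifPn => // jI.
by rewrite inordK // ltnS rN // mem_enum.
Qed.

Lemma infinite_range (T : Type) (f : nat -> T) : injective f -> infinite_set (range f).
Proof.
move=> fI /finite_leqn[n]; apply; exists (fun i => f (val i)).
by split=> [i j /fI /val_inj|i]; last by exists (val i).
Qed.

(** Greedy choice: each new element avoids the finitely many already chosen and their neighbours. *)
Lemma locally_finite_free (A : set nat) (Rel : nat -> nat -> Prop) : infinite_set A ->
  (forall i, A i -> finite_set [set k | Rel i k \/ Rel k i]) ->
  exists H, [/\ H `<=` A, infinite_set H & forall i k, H i -> H k -> i <> k -> ~ Rel i k].
Proof.
move=> iA fR.
have /choice[nx nxP] : forall s : seq nat, exists m, (forall i, i \in s -> A i) ->
    [/\ A m, m \notin s & forall i, i \in s -> ~ (Rel i m \/ Rel m i)].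
  move=> s; have [sA|nsA] := pselect (forall i, i \in s -> A i); last by exists 0.
  suff /infinite_setN0[m [Am nm]] : infinite_set (A `\` ([set` s] `|`
      \bigcup_(i in [set` s]) [set k | Rel i k \/ Rel k i])).
    exists m => _; split=> //; first by apply/negP => ms; apply: nm; left.
    by move=> i is_ Rim; apply: nm; right; exists i.
  apply: infinite_setD => //; rewrite finite_setU; split; first exact: finite_seq.
  by apply: bigcup_finite; [exact: finite_seq|move=> i /sA; exact: fR].
pose S := fix S m := if m is m'.+1 then nx (S m') :: S m' else [::].
have SA m : forall i, i \in S m -> A i.
  elim: m => [//|m IHm] i /=; rewrite inE => /predU1P[->|/IHm //].
  by have [] := nxP _ IHm.
have memS m m' : (m < m')%N -> nx (S m) \in S m'.
  elim: m' => [//|m' IHm']; rewrite ltnS leq_eqVlt => /predU1P[->|/IHm' h].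
    by rewrite /= mem_head.
  by rewrite /= inE h orbT.
have ltne m m' : (m < m')%N -> nx (S m) <> nx (S m').
  by move=> mm' e; have [_ /negP nS _] := nxP _ (SA m'); apply: nS; rewrite -e; exact: memS.
have nR m m' : (m < m')%N -> ~ (Rel (nx (S m)) (nx (S m')) \/ Rel (nx (S m')) (nx (S m))).
  by move=> mm'; have [_ _] := nxP _ (SA m'); apply; exact: memS.
exists (range (fun m => nx (S m))); split.
- by move=> _ [m _ <-]; have [] := nxP _ (SA m).
- by apply: infinite_range => m m' e; case: (ltngtP m m') => // /ltne; rewrite e.
- move=> _ _ [m _ <-] [m' _ <-] ne Rm.
  by case: (ltngtP m m') => [/nR|/nR|e]; [auto|auto|rewrite e in ne].
Qed.

(** Induction on the out-degree. If infinitely many [i] point to one [k], restricting to them uses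
    up one arrow of each; otherwise finitely many arrows enter each vertex and the relation is
    locally finite. *)
Lemma infinite_free n (A : set nat) (Rel : nat -> nat -> Prop) : infinite_set A ->
  (forall i, A i -> leqn [set k | [/\ A k, k <> i & Rel i k]] n) ->
  exists H, [/\ H `<=` A, infinite_set H & forall i k, H i -> H k -> i <> k -> ~ Rel i k].
Proof.
elim: n A => [|n IHn] A iA lR.
  exists A; split=> // i k Ai Ak ik Rik; apply: (lR i Ai).
  exists (fun=> k); split; first by move=> u v _; rewrite !ord1.
  by move=> _; split=> // /esym.
pose R' i k := [/\ A i, A k, k <> i & Rel i k].
have [[k [Ak iAk]]|nk] := pselect (exists k, A k /\ infinite_set [set i | R' i k]).
  have [|H [HA iH Hfree]] := IHn [set i | R' i k] iAk.
    move=> i [Ai _ ki Rik] [t [tI tR]]; apply: (lR i Ai).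
    exists (fun j => oapp t k (unlift ord0 j)); split.
      have ne j : t j <> k by have [[_ _ /nesym]] := tR j.
      move=> j j'; case: (unliftP ord0 j) => [u ->|->]; case: (unliftP ord0 j') => [u' ->|->];
        rewrite ?liftK ?unlift_none //=; first by move/tI ->.
        by move/ne.
      by move/esym/ne.
    by move=> j; case: (unliftP ord0 j) => [u _|_] /=; [have [[]] := tR u|].
  by exists H; split=> // i /HA[].
have [|H [HA iH Hfree]] := @locally_finite_free A R' iA.
  move=> i Ai; apply: (@sub_finite_set _ _ ([set k | [/\ A k, k <> i & Rel i k]] `|`
      [set k | R' k i])).
    by move=> k [[]|]; [left|right].
  rewrite finite_setU; split; first exact: leqn_finite (lR i Ai).
  by apply: contrapT => h; apply: nk; exists i.
exists H; split=> // i k Hi Hk ik Rik; apply: (Hfree i k) => //.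
by split; [exact: HA|exact: HA|exact: nesym|].
Qed.

Section HittingSets.
Variables (T : Type) (m : nat).
Implicit Type Z : set ('I_m -> T).

Definition hits n (t : 'I_n -> T) Z :=
  forall s, Z s -> exists i, exists j, s i = t j.

(* Each hitting set of minimal size contains a coordinate of a given s in Z, *)
(* and the rest of it is a minimal hitting set of the members avoiding it.   *)
Lemma finite_min_hitting n Z :
  (forall k (t : 'I_k -> T), (k < n)%N -> ~ hits t Z) ->
  finite_set [set x | exists t : 'I_n -> T, hits t Z /\ exists j, x = t j].
Proof.
elim: n Z => [|n IHn] Z minZ.
  apply: (sub_finite_set _ (finite_set0 T)) => x [t [_ [[]]]].
  by [].
have [s Zs] : Z !=set0.
  apply: contrapT => Z0; have [] := minZ 0 (fun i : 'I_0 => False_rect T (notF (ltn_ord i))) isT.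
  by move=> s Zs; case: Z0; exists s.
pose Z' i : set ('I_m -> T) := [set r | Z r /\ forall j, r j <> s i].
have fin i : finite_set
    [set x | exists t : 'I_n -> T, hits t (Z' i) /\ exists j, x = t j].
  apply: IHn => k t kn hitt.
  pose t' (j : 'I_k.+1) := oapp t (s i) (unlift ord0 j).
  apply: (minZ k.+1 t' kn) => r Zr.
  have [[j rj]|nr] := pselect (exists j, r j = s i).
    by exists j, ord0; rewrite /t' unlift_none.
  have [|i' [j e]] := hitt r; first by split=> // j rj; case: nr; exists j.
  by exists i', (lift ord0 j); rewrite /t' liftK.
apply: (@sub_finite_set _ _ (\bigcup_(i in [set: 'I_m]) ([set s i] `|`
    [set x | exists t : 'I_n -> T, hits t (Z' i) /\ exists j, x = t j]))).
  move=> x [t [hitt [j ->]]]; have [i [j0 sij0]] := hitt _ Zs.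
  exists i => //; have [j' ->|jj] := unliftP j0 j; [right|left]; last first.
    by rewrite jj /= sij0.
  exists (fun k => t (lift j0 k)); split; last by exists j'.
  move=> r [Zr nr]; have [i' [k e]] := hitt _ Zr; exists i'.
  have [k' ek|ek] := unliftP j0 k; first by exists k'; rewrite -ek.
  by case: (nr i'); rewrite e ek sij0.
apply: bigcup_finite; first exact: finite_finset.
by move=> i _; rewrite finite_setU; split; [exact: finite_set1|exact: fin].
Qed.

End HittingSets.

(** * Saturation and algebraic closure *)

Section Small.
Variables (L : language) (M : structure L).
Implicit Types C : set (elt M).

Lemma card_le_fun T U (A : set T) (u0 : U) : (A #<= [set: U])%card ->
  exists f : T -> U, {in A &, injective f}.
Proof.
move/card_leP => [f].
pose g x := match pselect (A x) with
  | left h => val (f (SigSub (mem_set h))) | right _ => u0 end.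
exists g => x y; rewrite !inE => Ax Ay; rewrite /g.
case: pselect => // Ax'; case: pselect => // Ay'.
move/val_inj/(@inj _ _ _ f); rewrite !inE => /(_ I I) e.
by have /= := congr1 val e.
Qed.

Lemma fun_card_le T U (A : set T) (f : T -> U) :
  {in A &, injective f} -> (A #<= [set: U])%card.
Proof.
move=> fI; have [g] : $|{injfun A >-> [set: U]}| by apply/injfunPex; exists f.
exact: inj_card_le g.
Qed.

(** The map [sh] pushes the copy of [nat] inside [lang_symb L] onto the odd numbers, which leaves
    the even ones for [E]. *)
Lemma small_countable C (E : set (elt M)) :
  small C -> countable E -> small (C `|` E).
Proof.
move=> sC cE.
have [f fI] := @card_le_fun _ _ _ (inl (inl (inl 0)) : lang_symb L) sC.
have [g gI] := @card_le_fun _ _ _ 0 cE.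
pose sh (u : lang_symb L) : lang_symb L :=
  if u is inl (inl (inl n)) then inl (inl (inl n.*2.+1)) else u.
have shI : injective sh.
  move=> [[[n|s]|u]|r] [[[n'|s']|u']|r'] //= => -[].
  by move=> e; congr (inl (inl (inl _))); exact: double_inj.
pose h x : lang_symb L := if x \in C then sh (f x) else inl (inl (inl (g x).*2)).
apply: (@fun_card_le _ _ _ h) => x y.
have noeq u m : sh u <> inl (inl (inl m.*2)).
  case: u => [[[n|s]|u]|r] //= -[] /(congr1 odd).
  by rewrite /= !odd_double.
rewrite !inE /h => CEx CEy; case: ifPn => Cx; case: ifPn => Cy.
- by move/shI; exact: fI.
- by move/noeq.
- by move/esym/noeq.
- move=> [/double_inj]; apply: gI; rewrite inE.
    by case: CEx => // /mem_set; rewrite (negPf Cx).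
  by case: CEy => // /mem_set; rewrite (negPf Cy).
Qed.

Lemma countable_rng Y (w : vals M Y) : countable (rng w).
Proof.
apply: finite_set_countable; apply: finite_image; exact: finite_finset.
Qed.

Lemma small_rng C Y (w : vals M Y) : small C -> small (C `|` rng w).
Proof. by move=> sC; apply: small_countable => //; exact: countable_rng. Qed.

Lemma small0 : small (@set0 (elt M)).
Proof. exact: card_ge0. Qed.

End Small.

Section Saturated.
Variables (L : language) (M : structure L).
Hypothesis M_sat : saturated M.
Implicit Types (C D : set (elt M)) (X Y Z : ctx (sorts L)).

(** Saturation in terms of sets: in a directed family, nonemptiness of each member already gives
    finite satisfiability. *)
Lemma sat_dir C X (Fs : set (set (vals M X))) : small C -> Fs !=set0 ->
  (forall F, Fs F -> dfn C F /\ F !=set0) ->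
  (forall F G, Fs F -> Fs G -> exists2 H, Fs H & H `<=` F `&` G) ->
  exists a, forall F, Fs F -> F a.
Proof.
move=> sC [F0 F0s] Fne Fdir.
pose p : set (pformula M X) := [set phi | pf_over C phi /\ Fs (psat phi)].
have [||a ap] := M_sat (p := p) sC; last first.
- exists a => F FsF; have [dF _] := Fne _ FsF.
  have /definable_overP[phi oC eF] := dF.
  by rewrite eF; apply: ap; split=> //; rewrite -eF.
- move=> D Dp fD; suff [H FsH HD] : exists2 H, Fs H &
      forall phi, D phi -> H `<=` psat phi.
    have [_ [a Ha]] := Fne _ FsH; exists a => phi Dphi; exact: (HD _ Dphi).
  have /finite_seqP[s eD] : finite_set (D : set {classic pformula M X}) by [].
  have {}Dp phi : phi \in s -> p phi by move=> phis; apply: Dp; rewrite eD.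
  suff [H FsH HD] : exists2 H, Fs H &
      forall phi, phi \in s -> H `<=` psat phi.
    by exists H => // phi; rewrite eD; exact: HD.
  elim: s {eD} Dp => [|phi s IHs] sp; first by exists F0.
  have [|H FsH Hs] := IHs; first by move=> psi h; apply: sp; rewrite inE h orbT.
  have [_ Fsphi] := sp phi (mem_head _ _).
  have [K FsK KH] := Fdir _ _ FsH Fsphi; exists K => // psi.
  rewrite inE => /predU1P[->|/Hs sH] a /KH[] // Ha _; exact: sH.
- by move=> phi [].
Qed.

Definition dfn1 C (F : home M -> Prop) :=
  dfn C (fun a : vals M (home_ctx L 1) => F (a (ord0 : 'I_1))).

Definition dfnR C Y (R : vals M Y -> home M -> Prop) :=
  dfn C (fun b : vals M (ctx_cat Y (home_ctx L 1)) =>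
    R (fun v => b (inl v)) (b (inr (ord0 : 'I_1)))).

Definition alg C (x : home M) :=
  exists2 F : set (home M), dfn1 C F & finite_set F /\ F x.

(** Equality of types over [C]; one implication suffices because negations are available
    ([eqtp_sym]). *)
Definition eqtp C Y (w w' : vals M Y) :=
  forall R : vals M Y -> Prop, dfn C R -> R w -> R w'.

Lemma dfn_app1 C X F (x : vals M X -> home M) :
  dfn1 C F -> tm C x -> dfn C (fun a => F (x a)).
Proof.
move=> dF tx.
by apply: (@dfn_app _ _ _ _ _ _ (fun a => home1 (x a)) dF).
Qed.

Lemma dfn_app_home1 C X (R : vals M (home_ctx L 1) -> Prop)
    (x : vals M X -> home M) :
  dfn C R -> tm C x -> dfn C (fun a => R (home1 (x a))).
Proof.
move=> dR tx.
exact: (@dfn_app _ _ _ _ _ _ (fun a => home1 (x a)) dR).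
Qed.

Lemma dfn_appR C X Y R (g : vals M X -> vals M Y) (x : vals M X -> home M) :
  dfnR C R -> (forall v, tm C (fun a => g a v)) -> tm C x ->
  dfn C (fun a => R (g a) (x a)).
Proof.
move=> dR tg tx.
by apply: (@dfn_app _ _ _ _ _ _ (fun a => vals_cat (g a) (home1 (x a))) dR); case.
Qed.

Lemma dfn_inl C X Y (A : vals M X -> Prop) :
  dfn C A -> dfn C (fun b : vals M (ctx_cat X Y) => A (fun v => b (inl v))).
Proof.
move=> dA; apply: (@dfn_app _ _ C (ctx_cat X Y) X A (fun b v => b (inl v)) dA).
by tmv.
Qed.

Lemma dfn_inr C X Y (A : vals M Y -> Prop) :
  dfn C A -> dfn C (fun b : vals M (ctx_cat X Y) => A (fun v => b (inr v))).
Proof.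
move=> dA; apply: (@dfn_app _ _ C (ctx_cat X Y) Y A (fun b v => b (inr v)) dA).
by tmv.
Qed.

Lemma dfn_leqn C X (A : vals M X -> home M -> Prop) n :
  dfnR C A -> dfn C (fun a => leqn (A a) n).
Proof.
move=> dA; rewrite /leqn /injective; do 3 dfn_step.
  do 2 dfn_step; apply: dfn_imp; last exact: dfn_cst.
  by dfn_step; tmv.
dfn_step; apply: (dfn_appR dA); last by tmv.
by tmv.
Qed.

Lemma tm_rng C X Y (w : vals M Y) v : tm (C `|` rng w) (fun _ : vals M X => w v).
Proof. by apply: tm_const; right; exists v. Qed.

Lemma algS C C' x : C `<=` C' -> alg C x -> alg C' x.
Proof. by move=> CC' [F dF [fF Fx]]; exists F => //; exact: dfn_sub dF. Qed.

Lemma alg_mem C (x : home M) : C (elem x) -> alg C x.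
Proof.
move=> Cx; exists [set x]; last by split=> //; exact: finite_set1.
by apply: dfn_eq; [tmv|exact: tm_const].
Qed.

(** All fibres of [R] can be made finite, not only the one at [w]: if that one has at most [n]
    elements, fibres with more than [n] elements are discarded. *)
Lemma alg_adjoin C Y (w : vals M Y) x : alg (C `|` rng w) x <->
  exists R : vals M Y -> home M -> Prop,
    [/\ dfnR C R, forall w', finite_set (R w') & R w x].
Proof.
split=> [[F dF [fF Fx]]|[R [dR fR Rx]]]; last first.
  exists (R w); last by split; [exact: fR|exact: Rx].
  apply: (dfn_appR (R := R) (g := fun _ : vals M (home_ctx L 1) => w)
    (x := fun a : vals M (home_ctx L 1) => a (ord0 : 'I_1))); last by tmv.
    by apply: dfn_sub dR; exact: subsetUl.
  by move=> v; exact: tm_rng.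
have [R [dR FR]] := dfn_adjoin dF.
have [n Fn] := finite_leqn fF.
pose R0 w' y := R (home1 y) w'.
have dR0 : dfnR C R0.
  pose g (b : vals M (ctx_cat Y (home_ctx L 1))) :
    vals M (ctx_cat (home_ctx L 1) Y) :=
    vals_cat (home1 (b (inr (ord0 : 'I_1)))) (fun v => b (inl v)).
  apply: (@dfn_app _ _ _ _ _ _ g dR); case=> v; rewrite /g /= /home1; last by tmv.
  by tmv.
have eF : F = R0 w by apply/seteqP; split=> y; move: (FR (home1 y)) => [h1 h2];
  [exact: h1|exact: h2].
exists (fun w' y => R0 w' y /\ leqn (R0 w') n); split.
- apply: dfn_and; first exact: dR0.
  by apply: (@dfn_inl _ _ _ (fun w' => leqn (R0 w') n)); exact: dfn_leqn.
- move=> w'; have [ln|ln] := pselect (leqn (R0 w') n).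
    by apply: sub_finite_set (leqn_finite ln) => y [].
  by apply: sub_finite_set (finite_set0 _) => y [].
- by rewrite -eF.
Qed.

(** Without a bound, saturation would give a single [w] in all of [As] whose fibre has more than [n]
    elements for every [n]. *)
Lemma unif_bound_type C Y (As : set (vals M Y -> Prop))
    (R : vals M Y -> home M -> Prop) :
  small C -> As !=set0 -> (forall A, As A -> dfn C A) ->
  (forall A B, As A -> As B -> exists2 E, As E & forall w, E w -> A w /\ B w) ->
  dfnR C R -> (forall w, (forall A, As A -> A w) -> finite_set (R w)) ->
  exists n, forall w, (forall A, As A -> A w) -> leqn (R w) n.
Proof.
move=> sC [A0 AsA0] dA Adir dR fR; apply: contrapT => nb.
pose F (p : (vals M Y -> Prop) * nat) : set (vals M Y) :=
  [set w | p.1 w /\ ~ leqn (R w) p.2].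
have [|||w wF] := @sat_dir C Y (F @` [set p | As p.1]) sC.
- by exists (F (A0, 0)), (A0, 0).
- move=> _ [[A n] /= AsA <-]; split.
    by apply: dfn_and; [exact: dA|apply: dfn_not; exact: dfn_leqn].
  apply: contrapT => Fn; apply: nb; exists n => w Aw.
  by apply: contrapT => nl; apply: Fn; exists w; split => //; exact: Aw.
- move=> _ _ [[A n] /= AsA <-] [[B k] /= AsB <-].
  have [E AsE EAB] := Adir _ _ AsA AsB.
  exists (F (E, maxn n k)); first by exists (E, maxn n k).
  by move=> w [/= /EAB[Aw Bw] h]; split; split=> //=; apply: contra_not h;
     apply: leqnW; rewrite ?leq_maxl ?leq_maxr.
have Aw A : As A -> A w by move=> AsA; case: (wF (F (A, 0))) => //; exists (A, 0).
have [n Rn] := finite_leqn (fR _ Aw).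
by have [|_] := wF (F (A0, n)); first by exists (A0, n).
Qed.

Lemma unif_bound C Y (A : vals M Y -> Prop) (R : vals M Y -> home M -> Prop) :
  small C -> dfn C A -> dfnR C R -> (forall w, A w -> finite_set (R w)) ->
  exists n, forall w, A w -> leqn (R w) n.
Proof.
move=> sC dA dR fR.
have [|||w Aw|n Rn] := @unif_bound_type C Y [set A] R sC _ _ _ dR.
- by exists A.
- by move=> _ ->.
- by move=> _ _ -> ->; exists A.
- by apply: fR; exact: Aw.
- by exists n => w Aw; apply: Rn => _ ->.
Qed.

(** If all members were finite, [unif_bound] would give them a common bound [n]; but [n.+1] points
    of the union lie together in one member. *)
Lemma infinite_directed C Z (D : vals M Z -> Prop)
    (X : vals M Z -> home M -> Prop) :
  small C -> dfn C D -> dfnR C X -> D !=set0 ->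
  (forall c c', D c -> D c' ->
     exists2 c'', D c'' & X c `<=` X c'' /\ X c' `<=` X c'') ->
  infinite_set [set x | exists2 c, D c & X c x] ->
  exists2 c, D c & infinite_set (X c).
Proof.
move=> sC dD dX [c0 Dc0] Xdir Xinf; apply: contrapT => nX.
have [w Dw|n Xn] := @unif_bound C Z D X sC dD dX.
  by apply: contrapT => Xw; apply: nX; exists w.
have [t [tI tX]] := infinite_tuple n.+1 Xinf.
have [c Dc tc] : exists2 c, D c & forall i, i \in enum 'I_n.+1 -> X c (t i).
  elim: (enum _) => [|i s [c Dc cs]]; first by exists c0.
  have [d Dd dt] := tX i; have [e De [ce de]] := Xdir _ _ Dc Dd.
  exists e => // j; rewrite inE => /predU1P[->|js]; first exact: de.
  by apply: ce; exact: cs.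
by apply: (Xn _ Dc); exists t; split=> // i; apply: tc; rewrite mem_enum.
Qed.

(** The set [A] may need parameters outside [C]. It is replaced by the union of the hitting tuples
    of least length, which is [C]-definable, finite by [finite_min_hitting], and still meets every
    member of [Z]. *)
Lemma alg_hitting m C (Z : set ('I_m -> home M)) (A : set (home M)) :
  dfn C (Z : vals M (home_ctx L m) -> Prop) -> finite_set A ->
  (forall s, Z s -> exists i, A (s i)) ->
  forall s, Z s -> exists i, alg C (s i).
Proof.
move=> dZ fA ZA s Zs.
have : exists k, `[< exists t : 'I_k -> home M, hits t Z >].
  have /finite_seqP[r eA] : finite_set (A : set {classic home M}) by [].
  exists (size r); apply/asboolP; exists (fun i => tnth (in_tuple r) i) => u Zu.
  have [i Ai] := ZA _ Zu; exists i; have ir : u i \in r by move: Ai; rewrite eA.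
  have ur : (index (u i : {classic home M}) r < size r)%N by rewrite index_mem.
  exists (Ordinal ur); rewrite (tnth_nth (u i)) /=.
  by rewrite -[LHS](@nth_index {classic home M} (u i) _ r).
move/ex_minnP => [n /asboolP[t hitt] nmin].
have fH := @finite_min_hitting (home M) m n Z.
have [i [j e]] := hitt _ Zs; exists i.
exists [set x | exists t : 'I_n -> home M, hits t Z /\ exists j, x = t j]; last first.
  split; last by exists t; split=> //; exists j.
  apply: fH => k r kn hitr.
  have := nmin k; rewrite leqNgt kn => /(_ _)/negP; apply=> //.
  by apply/asboolP; exists r.
rewrite /dfn1 /=; dfn_step; dfn_step.
  rewrite /hits; do 2 dfn_step; last by do 2 dfn_step; dfn_step; tmv.
  exact: (@dfn_inr C _ (home_ctx L m) _ dZ).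
dfn_step; dfn_step; last by tmv.
by tmv.
Qed.

Lemma eqtp_refl C Y (w : vals M Y) : eqtp C w w.
Proof. by []. Qed.

Lemma eqtp_sym C Y (w w' : vals M Y) : eqtp C w w' -> eqtp C w' w.
Proof.
move=> h R dR Rw'; apply: contrapT => nR.
by have := h (fun v => ~ R v); apply => //; exact: dfn_not.
Qed.

Lemma eqtp_trans C Y (w w' w'' : vals M Y) :
  eqtp C w w' -> eqtp C w' w'' -> eqtp C w w''.
Proof. by move=> h h' R dR Rw; apply: h' => //; exact: h. Qed.

Lemma eqtpS C D Y (w w' : vals M Y) : C `<=` D -> eqtp D w w' -> eqtp C w w'.
Proof. by move=> CD h R dR; apply: h; exact: dfn_sub dR. Qed.

Lemma eqtp_inr C X Y (u u' : vals M X) (w w' : vals M Y) :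
  eqtp C (vals_cat u w) (vals_cat u' w') -> eqtp C w w'.
Proof.
move=> h R dR Ru.
by have := h (fun b => R (fun v => b (inr v))); apply => //; exact: dfn_inr.
Qed.

Lemma eqtp_cat C X Y (u : vals M X) (w w' : vals M Y) :
  eqtp (C `|` rng u) w w' -> eqtp C (vals_cat u w) (vals_cat u w').
Proof.
move=> h R dR Rw; apply: (h (fun v => R (vals_cat u v))) => //.
pose g (a : vals M Y) : vals M (ctx_cat X Y) := vals_cat u a.
apply: (@dfn_app _ _ _ _ _ R g); first by apply: dfn_sub dR; exact: subsetUl.
by case=> v; rewrite /g /=; [exact: tm_rng|tmv].
Qed.

(** Each condition on [w] over [u] is an existential condition on [u], so it can be met over [u'];
    saturation meets all of them at once. *)
Lemma eqtp_extend C X Y (u u' : vals M X) (w : vals M Y) : small C ->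
  eqtp C u u' -> exists w', eqtp C (vals_cat u w) (vals_cat u' w').
Proof.
move=> sC uu'.
pose F (R : vals M (ctx_cat X Y) -> Prop) : set (vals M Y) :=
  [set w' | R (vals_cat u' w')].
have [|||w' w'F] := @sat_dir (C `|` rng u') Y
    [set F R | R in [set R | dfn C R /\ R (vals_cat u w)]] (small_rng _ sC).
- by exists (F (fun=> True)), (fun=> True) => //; split=> //; exact: dfn_True.
- move=> _ [R [dR Rw] <-]; split.
    pose g (a : vals M Y) : vals M (ctx_cat X Y) := vals_cat u' a.
    apply: (@dfn_app _ _ _ _ _ R g); first by apply: dfn_sub dR; exact: subsetUl.
    by case=> v; rewrite /g /=; [exact: tm_rng|tmv].
  apply: (uu' (fun u => exists w, R (vals_cat u w))); last by exists w.
  apply: dfn_exists; apply: (dfn_ext _ dR) => b.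
  suff -> : vals_cat (fun v => b (inl v)) (fun v => b (inr v)) = b by [].
  by apply/functional_extensionality_dep => -[].
- move=> _ _ [R [dR Rw] <-] [R' [dR' Rw'] <-]; exists (F (fun b => R b /\ R' b)) => //.
  by exists (fun b => R b /\ R' b) => //; split=> //; exact: dfn_and.
exists w' => R dR Rw; apply: (w'F (F R)); by exists R.
Qed.

(* P. M. Neumann's lemma, for elements of the home sort. *)
Lemma eqtp_avoid C Y m (s : 'I_m -> home M) (w0 : vals M Y) : small C ->
  (forall i, ~ alg C (s i)) ->
  exists w, eqtp C w0 w /\ forall i, ~ alg (C `|` rng w) (s i).
Proof.
move=> sC sna; pose sv : vals M (home_ctx L m) := s.
pose ok (p : (vals M Y -> Prop) * (vals M Y -> home M -> Prop)) :=
  [/\ dfn C p.1, p.1 w0, dfnR C p.2 & forall w, finite_set (p.2 w)].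
pose F (p : (vals M Y -> Prop) * (vals M Y -> home M -> Prop)) : set (vals M Y) :=
  [set w | p.1 w /\ forall i, ~ p.2 w (s i)].
have [|||w wF] := @sat_dir (C `|` rng sv) Y (F @` ok) (small_rng _ sC).
- exists (F (fun=> True, fun _ _ => False)), (fun=> True, fun _ _ => False) => //.
  split=> //=; first exact: dfn_True.
  exact: dfn_False.
- move=> _ [[R th] [/= dR Rw0 dth fth] <-]; split.
    apply: dfn_and; first by apply: dfn_sub dR; exact: subsetUl.
    dfn_step; dfn_step.
    apply: (@dfn_appR _ _ _ _ (fun a => a) (fun=> _)).
    + by apply: dfn_sub dth; exact: subsetUl.
    + by tmv.
    + exact: (tm_rng _ _ (sv : vals M (home_ctx L m))).
  apply: contrapT => nF.
  (* [Z] is [C]-definable and contains [s], because no [w] in [R] avoids [s]. The finite fibre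
     [th w0] meets each member of [Z], so [alg_hitting] makes some [s i] algebraic over [C]. *)
  pose Z : set ('I_m -> home M) := [set r | forall w, R w -> exists i, th w (r i)].
  have [|r Zr||i] := @alg_hitting m C Z (th w0) _ (fth w0) _ s.
  + rewrite /Z /mkset; dfn_step; dfn_step; first exact: (@dfn_inr C (home_ctx L m) Y).
    by dfn_step; apply: (dfn_appR dth); tmv.
  + exact: Zr.
  + move=> w Rw; apply: contrapT => nth; apply: nF; exists w; split=> // i thi.
    by apply: nth; exists i.
  + exact: sna.
- move=> _ _ [[R th] [/= dR Rw0 dth fth] <-] [[R' th'] [/= dR' Rw0' dth' fth'] <-].
  exists (F (fun w => R w /\ R' w, fun w x => th w x \/ th' w x)).
    exists (fun w => R w /\ R' w, fun w x => th w x \/ th' w x) => //; split=> //=.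
    + exact: dfn_and.
    + exact: dfn_or.
    + by move=> w; rewrite -/(_ `|` _) finite_setU.
  by move=> w [/= [Rw R'w] h]; split; split=> //= i thi; apply: (h i); [left|right].
exists w; split=> [R dR Rw0|i].
  have [|//] := wF (F (R, fun _ _ => False)); exists (R, fun _ _ => False) => //.
  by split=> //=; exact: dfn_False.
move/alg_adjoin => [th [dth fth thi]].
have [|_] := wF (F (fun=> True, th)); last by move/(_ i).
by exists (fun=> True, th) => //; split=> //=; exact: dfn_True.
Qed.

Lemma eqtp_infinite C (y : home M) (R : home M -> Prop) :
  ~ alg C y -> dfn1 C R -> R y -> infinite_set [set x | R x].
Proof. by move=> ny dR Ry fR; apply: ny; exists R. Qed.

(** To escape a [D]-definable set of at most [k] elements, [k.+1] distinct solutions of the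
    condition on [y] are moved together by [eqtp_avoid]; one of them lies outside. *)
Lemma eqtp_avoid2 C D m (s : 'I_m -> home M) (y : home M) : small D ->
  C `<=` D -> (forall i, ~ alg C (s i)) -> ~ alg C y ->
  exists y', [/\ eqtp C (home1 y) (home1 y'), ~ alg D y' &
    forall i, ~ alg (C `|` rng (home1 y')) (s i)].
Proof.
move=> sD CD sna nay; have sC : small C by apply: card_le_trans sD; exact: subset_card_le.
pose sv : vals M (home_ctx L m) := s.
pose V := vals M (home_ctx L 1).
pose ok (p : (V -> Prop) * (home M -> Prop) * (V -> home M -> Prop)) :=
  [/\ dfn C p.1.1, p.1.1 (home1 y), dfn1 D p.1.2 /\ finite_set [set x | p.1.2 x],
      dfnR C p.2 & forall w, finite_set (p.2 w)].
pose F (p : (V -> Prop) * (home M -> Prop) * (V -> home M -> Prop)) : set V :=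
  [set w | [/\ p.1.1 w, ~ p.1.2 (w (ord0 : 'I_1)) & forall i, ~ p.2 w (s i)]].
have dF1 : dfnR C (fun (_ : V) (_ : home M) => False) by exact: dfn_False.
have fF0 : finite_set [set x : home M | False] by [].
have [|||w wF] := @sat_dir (D `|` rng sv) _ (F @` ok) (small_rng _ sD).
- exists (F (fun=> True, fun=> False, fun _ _ => False)).
  exists (fun=> True, fun=> False, fun _ _ => False) => //.
  split=> //=; first exact: dfn_True.
  by split=> //; exact: dfn_False.
- move=> _ [[[R T] th] [/= dR Ry [dT fT] dth fth] <-]; split.
    apply: (@dfn_ext _ _ _ _ (fun w => R w /\ ~ T (w (ord0 : 'I_1)) /\
       forall i, ~ th w (s i))).
      by move=> w; split=> [[? [? ?]]|[? ? ?]].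
    apply: dfn_and; first by apply: dfn_sub dR; apply: subset_trans CD _; exact: subsetUl.
    apply: dfn_and.
      by apply: dfn_not; apply: dfn_sub dT; exact: subsetUl.
    dfn_step; dfn_step.
    apply: (@dfn_appR _ _ _ _ (fun a => a) (fun=> _)).
    + by apply: dfn_sub dth; apply: subset_trans CD _; exact: subsetUl.
    + by tmv.
    + exact: (tm_rng _ _ (sv : vals M (home_ctx L m))).
  have [k Tk] := finite_leqn fT.
  have iR : infinite_set [set x | R (home1 x)].
    apply: (@eqtp_infinite C y (fun x => R (home1 x)) nay _ Ry).
    by apply: (dfn_app_home1 dR); tmv.
  have [t [tI tR]] := infinite_tuple k.+1 iR.
  have [u [tu una]] := @eqtp_avoid C (home_ctx L k.+1) m s t sC sna.
  have /(_ _)[||uI uR] := tu (fun u => injective (u : 'I_k.+1 -> home M) /\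
      forall i, R (home1 (u i))).
  + apply: dfn_and.
      rewrite /injective; dfn_step; dfn_step; apply: dfn_imp; last exact: dfn_cst.
      by dfn_step; tmv.
    by dfn_step; apply: (dfn_app_home1 dR); tmv.
  + by split.
  have [i nTi] : exists i, ~ T (u i).
    by apply: contrapT => h; apply: Tk; exists u; split=> // i; apply: contrapT => ?;
       apply: h; exists i.
  exists (home1 (u i)); split=> //= j thj; apply: (una j).
  apply: (@algS (C `|` rng (home1 (u i)))).
    by move=> x [?|[v _ <-]]; [left|right; exists i].
  by apply/alg_adjoin; exists th; split.
- move=> _ _ [[[R T] th] [/= dR Ry [dT fT] dth fth] <-] [[[R' T'] th']
    [/= dR' Ry' [dT' fT'] dth' fth'] <-].
  exists (F (fun w => R w /\ R' w, fun x => T x \/ T' x, fun w x => th w x \/ th' w x)).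
    exists (fun w => R w /\ R' w, fun x => T x \/ T' x, fun w x => th w x \/ th' w x) => //.
    split=> //=.
    + exact: dfn_and.
    + split; first exact: dfn_or.
      by rewrite -/([set x | T x] `|` [set x | T' x]) finite_setU.
    + exact: dfn_or.
    + by move=> w; rewrite -/(_ `|` _) finite_setU.
  move=> w [/= [Rw R'w] nT h]; split; split=> //=;
    try (by move=> Tw; apply: nT; auto); by move=> i thi; apply: (h i); auto.
have ew : w = home1 (w (ord0 : 'I_1)).
  by apply/functional_extensionality_dep => i; rewrite /home1 (ord1 i).
exists (w (ord0 : 'I_1)); split.
- move=> R dR Ry; rewrite -ew.
  have [|//] := wF (F (R, fun=> False, fun _ _ => False)).
  exists (R, fun=> False, fun _ _ => False) => //; split=> //=.
  by split=> //; exact: dfn_False.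
- move=> [T dT [fT Tw]].
  have [|_ /=] := wF (F (fun=> True, T, fun _ _ => False)); last by [].
  by exists (fun=> True, T, fun _ _ => False) => //; split=> //=; exact: dfn_True.
- move=> i; rewrite -ew => /alg_adjoin[th [dth fth thi]].
  have [|_ _ /(_ i)//] := wF (F (fun=> True, fun=> False, th)).
  exists (fun=> True, fun=> False, th) => //; split=> //=; first exact: dfn_True.
  by split=> //; exact: dfn_False.
Qed.

End Saturated.

Section Adjoin.
Variables (L : language) (M : structure L).
Implicit Types (C E : set (elt M)).

Lemma adjoin_mem C k (a : 'I_k -> home M) (I : {set 'I_k}) i :
  i \in I -> adjoin C a I (elem (a i)).
Proof. by move=> iI; right; exists i. Qed.

Lemma adjoinS C E k (a : 'I_k -> home M) (I J : {set 'I_k}) :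
  C `<=` E -> I \subset J -> adjoin C a I `<=` adjoin E a J.
Proof.
move=> CE IJ x [/CE|[i iI <-]]; first by left.
right; exists i => //=; exact: (fintype.subsetP IJ i iI).
Qed.

Lemma sub_adjoin C k (a : 'I_k -> home M) (I : {set 'I_k}) : C `<=` adjoin C a I.
Proof. by move=> x; left. Qed.

Lemma small_adjoin C k (a : 'I_k -> home M) (I : {set 'I_k}) :
  small C -> small (adjoin C a I).
Proof.
move=> sC; apply: small_countable => //; apply: finite_set_countable.
by apply: finite_image; exact: finite_finset.
Qed.

Definition indep E k (a : 'I_k -> home M) (I : {set 'I_k}) :=
  forall i, i \in I -> ~ alg (adjoin E a (I :\ i)) (a i).

Lemma indepS C E k (a : 'I_k -> home M) (I : {set 'I_k}) :
  C `<=` E -> indep E a I -> indep C a I.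
Proof. by move=> CE s i iI h; apply: (s i iI); apply: algS h; exact: adjoinS. Qed.

Lemma alg_eqtp_mem C D Y (w w' : vals M Y) (x : home M) : eqtp D w w' ->
  C `<=` D -> D (elem x) -> alg (C `|` rng w') x -> alg (C `|` rng w) x.
Proof.
move=> ww' CD Dx /alg_adjoin[R [dR fR Rx]]; apply/alg_adjoin; exists R; split=> //.
apply: (eqtp_sym ww' (R := fun w => R w x)) => //.
by apply: (dfn_appR (dfn_sub CD dR)); [tmv|exact: tm_const].
Qed.

End Adjoin.

(** * Independent points in boxes *)

Section Independence.
Variables (L : language) (M : structure L).
Hypothesis M_sat : saturated M.
Implicit Types (C E : set (elt M)) (X Y : ctx (sorts L)).

(* th w x expresses an algebraic dependence of x i on w and the x j for j in I, *)
(* j != i, whence finite lines in direction i.                                  *)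
Definition dependence E Y k (I : {set 'I_k}) (i : 'I_k)
    (th : vals M Y -> ('I_k -> home M) -> Prop) :=
  [/\ dfn E (fun b : vals M (ctx_cat Y (home_ctx L k)) =>
        th (fun v => b (inl v)) (fun j => b (inr j))),
      forall w x, finite_set [set t | th w (upd x i t)] &
      forall w (x x' : 'I_k -> home M), (forall j, j \in I -> x j = x' j) ->
        th w x -> th w x'].

Lemma dependence0 E Y k (I : {set 'I_k}) i : dependence E (Y := Y) I i (fun _ _ => False).
Proof. by split=> //; exact: dfn_False. Qed.

Lemma dependenceU E Y k (I : {set 'I_k}) i (th th' : vals M Y -> ('I_k -> home M) -> Prop) :
  dependence E I i th -> dependence E I i th' ->
  dependence E I i (fun w x => th w x \/ th' w x).
Proof.
move=> [dth fth Ith] [dth' fth' Ith']; split.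
- exact: dfn_or.
- move=> w x; rewrite -/([set t | th w (upd x i t)] `|` [set t | th' w (upd x i t)]).
  by rewrite finite_setU.
- by move=> w x x' xx' [?|?]; [left; exact: Ith xx' _|right; exact: Ith' xx' _].
Qed.

Lemma alg_dependence E Y (w : vals M Y) k (a : 'I_k -> home M) (I : {set 'I_k}) i :
  i \in I -> alg (adjoin (E `|` rng w) a (I :\ i)) (a i) ->
  exists2 th, dependence E I i th & th w a.
Proof.
move=> iI; pose J := I :\ i.
pose v (x : 'I_k -> home M) : vals M (home_ctx L #|J|) := fun u => x (enum_val u).
have enumJ (u : 'I_#|J|) : (enum_val u != i) && (enum_val u \in I).
  by have := enum_valP u; rewrite !inE.
move=> h.
have {h} : alg (E `|` rng (vals_cat w (v a))) (a i).
  apply: algS h => x [[?|[u _ <-]]|[j jJ <-]]; first by left.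
    by right; exists (inl u).
  right; exists (inr (enum_rank_in jJ j)) => //=.
  by rewrite /v enum_rankK_in.
move/alg_adjoin => [R [dR fR Ra]].
exists (fun w x => R (vals_cat w (v x)) (x i)) => //; split.
- pose g (b : vals M (ctx_cat Y (home_ctx L k))) : vals M (ctx_cat Y (home_ctx L #|J|)) :=
    vals_cat (fun u => b (inl u)) (v (fun j => b (inr j))).
  by apply: (dfn_appR (g := g) dR); [case=> u; rewrite /g /= /v; tmv|tmv].
- move=> w' x; apply: (sub_finite_set _ (fR (vals_cat w' (v x)))) => t /=.
  suff -> : v (upd x i t) = v x by rewrite /upd eqxx.
  apply/functional_extensionality_dep => u; rewrite /v /upd.
  by have /andP[/negPf ->] := enumJ u.
- move=> w' x x' xx'; rewrite xx' //; suff -> : v x = v x' by [].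
  apply/functional_extensionality_dep => u; rewrite /v xx' //.
  by have /andP[] := enumJ u.
Qed.

Lemma dfn_dependence E Y k (I : {set 'I_k}) i (th : vals M Y -> ('I_k -> home M) -> Prop)
    C X (g : vals M X -> vals M Y) (x : vals M X -> 'I_k -> home M) :
  dependence E I i th -> E `<=` C -> (forall v, tm C (fun a => g a v)) ->
  (forall j, tm C (fun a => x a j : M (home_sort L))) -> dfn C (fun a => th (g a) (x a)).
Proof.
move=> [dth _ _] EC tg tx.
pose h (a : vals M X) : vals M (ctx_cat Y (home_ctx L k)) :=
  vals_cat (g a) (x a : vals M (home_ctx L k)).
by apply: (@dfn_app _ _ _ _ _ _ h (dfn_sub EC dth)); case=> u; [exact: tg|exact: tx].
Qed.

Lemma dependence_bound E Y k (I : {set 'I_k})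
    (th : 'I_k -> vals M Y -> ('I_k -> home M) -> Prop) : small E ->
  (forall i, dependence E I i (th i)) ->
  exists n, forall i w x, leqn [set t | th i w (upd x i t)] n.
Proof.
move=> sE dth.
have /choice[f fb] : forall i, exists n, forall w x, leqn [set t | th i w (upd x i t)] n.
  move=> i; pose X := ctx_cat Y (home_ctx L k).
  have [||w _|n bn] := @unif_bound _ _ M_sat E X (fun=> True)
      (fun b t => th i (fun v => b (inl v)) (@upd (home M) k (fun j => b (inr j)) i t)) sE.
  - exact: dfn_True.
  - rewrite /dfnR; apply: (dfn_dependence (dth i)); [by []|by tmv|move=> j].
    by rewrite /upd; case: eqP => _; tmv.
  - by have [_ fin _] := dth i; exact: fin.
  - by exists n => w x; exact (bn (vals_cat w (x : vals M (home_ctx L k))) Logic.I).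
exists (\max_(i < k) f i)%N => i w x; apply: leqnW (fb i w x).
exact: leq_bigmax.
Qed.

(** Dependences are closed under union, so by saturation it is enough to avoid one per coordinate,
    which [grid_avoid] does along infinite sequences in the [O i]. The point [z0] only fills the
    coordinates outside [I]. *)
Lemma generic_in_box E k (z0 : home M) (I : {set 'I_k}) (O : 'I_k -> set (home M)) :
  small E -> (forall i, i \in I -> dfn1 E (O i) /\ infinite_set (O i)) ->
  exists z : 'I_k -> home M, (forall i, i \in I -> O i (z i)) /\ indep E z I.
Proof.
move=> sE OI.
pose Y := ctx0 (sorts L).
pose F (th : 'I_k -> vals M Y -> ('I_k -> home M) -> Prop) : set (vals M (home_ctx L k)) :=
  [set z | forall i, i \in I -> O i (z i) /\ ~ th i (vals0 M) z].
pose ok (th : 'I_k -> vals M Y -> ('I_k -> home M) -> Prop) :=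
  forall i, dependence E I i (th i).
have [|||z zF] := @sat_dir _ _ M_sat E _ (F @` ok) sE.
- by exists (F (fun _ _ _ => False)), (fun _ _ _ => False) => // i; exact: dependence0.
- move=> _ [th okth <-]; split.
    rewrite /F /mkset; dfn_step; dfn_step; apply: dfn_and.
      by apply: dfn_app1; [apply: (proj1 (OI _ _))|tmv].
    by dfn_step; apply: (dfn_dependence (okth _)) => //; tmv.
  have [n bn] := dependence_bound sE okth.
  have /choice[g gO] : forall i, exists g : nat -> home M, i \in I ->
      injective g /\ forall m, O i (g m).
    move=> i; have [iI|niI] := boolP (i \in I); last by exists (fun=> z0).
    by have [g gO] := infinite_enum (OI i iI).2; exists g.
  have [N gN] := @grid_avoid (home M) k n I g (fun i iI => (gO i iI).1).
  have [i x iI|r _ rP] := gN (fun i z => th i (vals0 M) z) _ (fun=> z0); first exact: bn.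
  exists (fun j => if j \in I then g j (r j) else z0) => i iI; split; last exact: rP.
  by rewrite iI; exact: (gO i iI).2.
- move=> _ _ [th okth <-] [th' okth' <-].
  exists (F (fun i w x => th i w x \/ th' i w x)).
    by exists (fun i w x => th i w x \/ th' i w x) => // i; exact: dependenceU.
  by move=> z zF; split=> i iI; have [Oz nth] := zF i iI; split=> // h; apply: nth; auto.
exists z; split=> [i iI|i iI h].
  have [|//] := zF (F (fun _ _ _ => False)) _ i iI.
  by exists (fun _ _ _ => False) => // j; exact: dependence0.
have [th dth thz] := @alg_dependence E Y (vals0 M) k z I i iI
  (algS (adjoinS (@subsetUl _ _ _) (fintype.subxx _)) h).
pose th' j := if j == i then th else fun _ _ => False.
have [|_] := zF (F th') _ i iI; last by rewrite /th' eqxx.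
by exists th' => // j; rewrite /th'; case: eqP => [->//|_]; exact: dependence0.
Qed.

End Independence.

(** * Patterns of dp-rank at least 2 in the home sort *)

Section DpRank.
Variables (L : language) (M : structure L).
Implicit Types (C E : set (elt M)) (X Y : ctx (sorts L)).

Lemma ord2P (i : 'I_2) : i = ord0 \/ i = ord_max.
Proof. by case: i => [[|[|//]] hi]; [left|right]; exact: val_inj. Qed.

Lemma row_formula Y (R : vals M Y -> home M -> Prop) : dfnR setT R ->
  exists phi : pformula M (ctx_cat (home_ctx L 1) Y), forall a y,
    psat phi (vals_cat a y) <-> R y (a (ord0 : 'I_1)).
Proof.
move=> dR; pose A (b : vals M (ctx_cat (home_ctx L 1) Y)) :=
  R (fun v => b (inr v)) (b (inl (ord0 : 'I_1))).
have /definable_overP[phi _ eA] : dfn setT A by apply: (dfn_appR dR); tmv.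
by exists phi => a y; rewrite -eA.
Qed.

Lemma dp_rank_gt1 Y0 Y1 (R0 : vals M Y0 -> home M -> Prop)
    (R1 : vals M Y1 -> home M -> Prop) (B0 : set (vals M Y0)) (B1 : set (vals M Y1)) :
  dfnR setT R0 -> dfnR setT R1 -> infinite_set B0 -> infinite_set B1 ->
  (forall b0 b1, B0 b0 -> B1 b1 -> exists e, (forall y, B0 y -> (R0 y e <-> y = b0)) /\
    (forall y, B1 y -> (R1 y e <-> y = b1))) ->
  dp_rank_gt [set: vals M (home_ctx L 1)] 1.
Proof.
move=> /row_formula[phi0 phi0R] /row_formula[phi1 phi1R] iB0 iB1 pattern.
pose Y (i : 'I_2) := match val i with 0 => Y0 | _ => Y1 end.
pose phi (i : 'I_2) : pformula M (ctx_cat (home_ctx L 1) (Y i)) :=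
  match val i as n return
    pformula M (ctx_cat (home_ctx L 1) (match n with 0 => Y0 | _ => Y1 end))
  with 0 => phi0 | _ => phi1 end.
pose B (i : 'I_2) : set (vals M (Y i)) :=
  match val i as n return set (vals M (match n with 0 => Y0 | _ => Y1 end))
  with 0 => B0 | _ => B1 end.
exists Y, phi, B; split; first by move=> i; case: (ord2P i) => ->.
move=> b Bb; have [e [e0 e1]] := pattern _ _ (Bb ord0) (Bb ord_max).
exists (home1 e) => // i; case: (ord2P i) => -> y By.
  by rewrite -(e0 y By); exact: phi0R.
by rewrite -(e1 y By); exact: phi1R.
Qed.

Lemma infinite_home1 (F : set (home M)) : infinite_set F ->
  infinite_set [set b : vals M (home_ctx L 1) | F (b (ord0 : 'I_1))].
Proof.
move=> iF fB; apply: iF; apply: (sub_finite_set _ (finite_image (fun b => b (ord0 : 'I_1)) fB)).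
by move=> x Fx; exists (home1 x).
Qed.

Lemma home1E (b : vals M (home_ctx L 1)) : b = home1 (b (ord0 : 'I_1)).
Proof. by apply/functional_extensionality_dep => i; rewrite /home1 (ord1 i). Qed.

End DpRank.

(** * The uniformity *)

Section Uniformity.
Variables (L : language) (M : structure L).
Hypothesis M_sat : saturated M.
Implicit Types (C E : set (elt M)) (X Y : ctx (sorts L)).
Variables (Q Z : ctx (sorts L)).
(** [U c] is the entourage of index [c], called a scale; [Dl p] is the index set cut out by the
    parameters [p], which are kept variable so that conjugates can replace them. *)
Variables (U : vals M Z -> home M -> home M -> Prop) (Dl : vals M Q -> vals M Z -> Prop).
Implicit Types (p q r : vals M Q) (c d : vals M Z) (x y z t : home M).

Hypothesis dU : dfn set0 (fun b : vals M (ctx_cat Z (home_ctx L 2)) =>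
  U (fun v => b (inl v)) (b (inr (ord0 : 'I_2))) (b (inr (ord_max : 'I_2)))).
Hypothesis dDl : dfn set0 (fun b : vals M (ctx_cat Q Z) =>
  Dl (fun v => b (inl v)) (fun v => b (inr v))).

Lemma dfn_U C X (c : vals M X -> vals M Z) (x y : vals M X -> home M) :
  (forall v, tm C (fun a => c a v)) -> tm C x -> tm C y ->
  dfn C (fun a => U (c a) (x a) (y a)).
Proof.
move=> tc tx ty.
pose g (a : vals M X) : vals M (ctx_cat Z (home_ctx L 2)) :=
  vals_cat (c a)
    ((fun i : 'I_2 => if i == ord0 then x a else y a) : vals M (home_ctx L 2)).
apply: (@dfn_app _ _ _ _ _ _ g (dfn_sub (@sub0set _ C) dU)); case=> [v|i] /=.
  exact: tc.
by rewrite /g /=; case: eqP.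
Qed.

Lemma dfn_D C X (p : vals M X -> vals M Q) (c : vals M X -> vals M Z) :
  (forall v, tm C (fun a => p a v)) -> (forall v, tm C (fun a => c a v)) ->
  dfn C (fun a => Dl (p a) (c a)).
Proof.
move=> tp tc; pose g (a : vals M X) : vals M (ctx_cat Q Z) := vals_cat (p a) (c a).
by apply: (@dfn_app _ _ _ _ _ _ g (dfn_sub (@sub0set _ C) dDl)); case=> v;
  [exact: tp|exact: tc].
Qed.

Definition ball_le c d := forall x y, U c x y -> U d x y.

Notation le := ball_le.

Ltac dfu := rewrite /dfnR /dfn1 /ball_le /subset;
  repeat first [dfn_step | apply: dfn_U | apply: dfn_D | by tmc].

(* The first-order content of the hypotheses on the uniformity with parameters p, *)
(* stated so as to pass to conjugates of p.                                       *)
Record good p : Prop := Good {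
  good_ne : exists c, Dl p c;
  good_refl : forall c x, Dl p c -> U c x x;
  good_sep : forall x y, x <> y -> exists c, Dl p c /\ ~ U c x y;
  good_sym : forall c x y, Dl p c -> U c x y -> U c y x;
  good_cap : forall c d, Dl p c -> Dl p d -> exists e, [/\ Dl p e, le e c & le e d];
  good_comp : forall c, Dl p c -> exists d, Dl p d /\
    forall x y z, U d x y -> U d y z -> U c x z;
  good_inf : forall c x, Dl p c -> infinite_set (U c x);
  good_int : forall S : set (home M), dfn1 setT S -> infinite_set S ->
    exists c x, Dl p c /\ U c x `<=` S }.

(** The last two clauses are not single formulas. For [good_inf] each cardinality is treated
    separately. For [good_int] saturation bounds by some [n] the fibres of [R] that contain no ball,
    and with [n] fixed this is a first-order property of [p]. *)
Lemma good_eqtp p q : eqtp set0 p q -> good p -> good q.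
Proof.
move=> pq gp; split.
- by apply: (pq (fun q => exists c, Dl q c)); [dfu|exact: good_ne].
- move: (good_refl gp) => h; apply: (pq (fun q => forall c x, Dl q c -> U c x x)) => //.
  by dfu.
- move: (good_sep gp) => h.
  by apply: (pq (fun q => forall x y, x <> y -> exists c, Dl q c /\ ~ U c x y)) => //; dfu.
- move: (good_sym gp) => h.
  by apply: (pq (fun q => forall c x y, Dl q c -> U c x y -> U c y x)) => //; dfu.
- have h : forall c d, Dl q c -> Dl q d -> exists e, Dl q e /\ le e c /\ le e d.
    apply: (pq (fun q => forall c d, Dl q c -> Dl q d ->
      exists e, Dl q e /\ le e c /\ le e d)); first by dfu.
    by move=> c d cp dp; have [e [? ? ?]] := good_cap gp cp dp; exists e.
  by move=> c d cq dq; have [e [? [? ?]]] := h c d cq dq; exists e.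
- move: (good_comp gp) => h.
  by apply: (pq (fun q => forall c, Dl q c -> exists d, Dl q d /\
    forall x y z, U d x y -> U d y z -> U c x z)) => //; dfu.
- move=> c x qc /finite_leqn[n].
  apply: (pq (fun q => forall c x, Dl q c -> ~ leqn (U c x) n)) => //.
    do 3 dfn_step; first by dfu.
    by dfn_step; apply: dfn_leqn; dfu.
  by move=> c' x' pc' /leqn_finite; exact: (good_inf gp).
- move=> S [Y [phi [z [_ Sphi]]]] iS.
  pose R (z : vals M Y) y := sat phi (vals_cat (home1 y) z).
  have eS : S = R z.
    by apply/seteqP; split=> y; move: (Sphi (home1 y)) => [h1 h2]; [exact: h1|exact: h2].
  have dR : dfnR set0 R.
    pose g (b : vals M (ctx_cat Y (home_ctx L 1))) : vals M (ctx_cat (home_ctx L 1) Y) :=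
      vals_cat (home1 (b (inr (ord0 : 'I_1)))) (fun v => b (inl v)).
    apply: (@dfn_app _ _ _ _ _ _ g (dfn_sat phi set0)).
    by case=> v; rewrite /g /= /home1; tmv.
  pose A q (z : vals M Y) := ~ exists c x, Dl q c /\ forall y, U c x y -> R z y.
  have dAR C X (f : vals M X -> vals M Y) (g : vals M X -> vals M Q) :
      (forall v, tm C (fun a => f a v)) -> (forall v, tm C (fun a => g a v)) ->
      dfn C (fun a => A (g a) (f a)).
    move=> tf tg; pose h (b : vals M X) : vals M (ctx_cat Q Y) := vals_cat (g b) (f b).
    have dA : dfn C (fun b : vals M (ctx_cat Q Y) => A (fun v => b (inl v)) (fun v => b (inr v))).
      rewrite /A; dfu.
      by apply: (dfn_appR (dfn_sub (@sub0set _ C) dR)); tmv.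
    by apply: (@dfn_app _ _ _ _ _ _ h dA); case.
  have [|||w nI|n Rn] := @unif_bound _ _ M_sat (set0 `|` rng p) Y (A p) R.
  + by apply: small_rng; exact: small0.
  + by apply: (@dAR _ _ (fun a => a) (fun=> p)); tmc.
  + exact: dfn_sub dR.
  + apply: contrapT => iR; apply: nI.
    have [|c [x [pc cxS]]] := good_int gp _ iR; last by exists c, x.
    rewrite /dfn1; apply: (dfn_appR (g := fun=> w) (dfn_sub (@sub0set _ setT) dR)).
      by move=> v; apply: tm_const.
    by tmv.
  have h : forall w, A q w -> leqn (R w) n.
    apply: (pq (fun q => forall w, A q w -> leqn (R w) n)) => //.
    dfn_step; dfn_step; first by apply: dAR; tmv.
    apply: (@dfn_inr _ _ _ _ _ (fun w => leqn (R w) n)).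
    exact: dfn_leqn.
  apply: contrapT => nex; apply: iS; rewrite eS; apply: (@leqn_finite _ _ n).
  by apply: h => -[c [x [qc cxS]]]; apply: nex; exists c, x; rewrite eS.
Qed.

(** * Conjugate uniformities have the same neighbourhoods at generic points *)

Definition finer p q y := forall d, Dl q d -> exists c, Dl p c /\ U c y `<=` U d y.

Lemma finer_trans p q r y : finer p q y -> finer q r y -> finer p r y.
Proof.
move=> pq qr d rd; have [c [qc cd]] := qr d rd; have [e [pe ec]] := pq c qc.
by exists e; split=> // z /ec /cd.
Qed.

Lemma dfn_finer C X (p q : vals M X -> vals M Q) (y : vals M X -> home M) :
  (forall v, tm C (fun a => p a v)) -> (forall v, tm C (fun a => q a v)) ->
  tm C y -> dfn C (fun a => finer (p a) (q a) (y a)).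
Proof.
move=> tp tq ty; pose Y := ctx_cat (ctx_cat Q Q) (home_ctx L 1).
pose R (b : vals M Y) := finer (fun v => b (inl (inl v))) (fun v => b (inl (inr v)))
  (b (inr (ord0 : 'I_1))).
have dR : dfn C R by rewrite /R /finer; dfu.
pose g (a : vals M X) : vals M Y := vals_cat (vals_cat (p a) (q a)) (home1 (y a)).
by apply: (@dfn_app _ _ _ _ _ _ g dR); case=> [[v|v]|v]; [exact: tp|exact: tq|exact: ty].
Qed.

(** Otherwise one [q]-scale [d] would contain no [p]-ball at infinitely many points, hence at all
    points of some [q]-ball. A smaller [q]-ball is infinite and contains a [p]-ball, which lies
    within [d] of its own centre. *)
Lemma finite_not_finer p q : good p -> good q ->
  finite_set [set y | ~ finer p q y].
Proof.
move=> gp gq; apply: contrapT => iB.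
pose X d y := forall c, Dl p c -> ~ U c y `<=` U d y.
have dX : dfnR (set0 `|` rng p `|` rng q) X by rewrite /X; dfu.
have [|||d d'||d qd iX] :=
    @infinite_directed _ _ M_sat (set0 `|` rng p `|` rng q) Z (Dl q) X _ _ dX.
- by do 2 apply: small_rng; exact: small0.
- apply: (@dfn_D _ _ (fun=> q) (fun d => d)); tmc.
- exact: good_ne gq.
- move=> qd qd'; have [e [qe ed ed']] := good_cap gq qd qd'; exists e => //.
  by split=> y yX c pc cy; apply: (yX c pc) => z /cy; [exact: ed|exact: ed'].
- apply: sub_infinite_set iB => y /= nf; apply: contrapT => nX; apply: nf.
  move=> d qd; apply: contrapT => nc; apply: nX; exists d => // c pc cd.
  by apply: nc; exists c.
have [|e [z [qe eX]]] := good_int gq _ iX; first by rewrite /X; dfu.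
have [e' [qe' ee']] := good_comp gq qd.
have [f [qf fe fe']] := good_cap gq qe qe'.
have [|u [w [pu uf]]] := good_int gp _ (good_inf gq (x := z) qf).
  by dfu.
have wf : U f z w by apply: uf; exact: (good_refl gp).
apply: (eX w (fe _ _ wf) u pu) => t /uf tf; apply: (ee' _ z).
  by apply: (good_sym gq qe'); exact: fe'.
exact: fe'.
Qed.

Definition split_at p q y := ~ (finer p q y /\ finer q p y).

Lemma dfn_split_at C X (p q : vals M X -> vals M Q) (y : vals M X -> home M) :
  (forall v, tm C (fun a => p a v)) -> (forall v, tm C (fun a => q a v)) ->
  tm C y -> dfn C (fun a => split_at (p a) (q a) (y a)).
Proof.
by move=> *; rewrite /split_at; dfn_step; dfn_step; apply: dfn_finer.
Qed.

Lemma split_at_trans p q r y : split_at p r y -> ~ split_at p q y -> split_at q r y.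
Proof.
move=> pr /contrapT[pq qp] [qr rq]; apply: pr.
by split; [exact: finer_trans pq qr|exact: finer_trans rq qp].
Qed.

Lemma split_at_sym p q y : split_at p q y -> split_at q p y.
Proof. by move=> h [? ?]; apply: h. Qed.

Lemma finite_split_at p q : good p -> good q -> finite_set [set y | split_at p q y].
Proof.
move=> gp gq; apply: (@sub_finite_set _ _ ([set y | ~ finer p q y] `|`
    [set y | ~ finer q p y])); last by rewrite finite_setU; split; exact: finite_not_finer.
by move=> y /not_andP.
Qed.

Lemma alg_split_at C p q y : good p -> good q -> split_at p q y ->
  alg (C `|` rng p `|` rng q) y.
Proof.
move=> gp gq pqy; exists [set y | split_at p q y]; last first.
  by split=> //; exact: finite_split_at.
by apply: dfn_split_at; tmc.
Qed.

Lemma alg_eqtp C Y (y y' : home M) (w w' : vals M Y) :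
  eqtp C (vals_cat (home1 y) w) (vals_cat (home1 y') w') ->
  alg (C `|` rng w) y -> alg (C `|` rng w') y'.
Proof.
move=> h /alg_adjoin[R [dR fR Ry]]; apply/alg_adjoin; exists R; split=> //.
apply: (h (fun b => R (fun v => b (inr v)) (b (inl ord0)))) => //.
by apply: (dfn_appR dR); tmv.
Qed.

(** Being conjugate to [p] is a type rather than a formula, whence the use of [unif_bound_type]. *)
Lemma split_at_bound p : good p -> exists n, forall q r,
  eqtp set0 p q -> eqtp set0 p r -> leqn [set y | split_at q r y] n.
Proof.
move=> gp; pose X := ctx_cat Q Q.
pose R (w : vals M X) y := split_at (fun v => w (inl v)) (fun v => w (inr v)) y.
pose B (A : vals M Q -> Prop) (w : vals M X) := A (fun v => w (inl v)) /\ A (fun v => w (inr v)).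
pose As := B @` [set A | dfn set0 A /\ A p].
have [||||w wA|n Rn] := @unif_bound_type _ _ M_sat set0 X As R (@small0 _ _).
- by exists (B (fun=> True)), (fun=> True) => //; split=> //; exact: dfn_True.
- by move=> _ [A [dA _] <-]; apply: dfn_and; [exact: dfn_inl|exact: dfn_inr].
- move=> _ _ [A [dA Ap] <-] [A' [dA' A'p] <-].
  exists (B (fun q => A q /\ A' q)).
    by exists (fun q => A q /\ A' q) => //; split=> //; exact: dfn_and.
  by move=> w [[? ?] [? ?]].
- by apply: dfn_split_at; tmv.
- by apply: finite_split_at; apply: good_eqtp gp => // A dA Ap;
    case: (wA (B A)) => //; exists A.
- exists n => q r pq pr; apply: (Rn (vals_cat q r)) => _ [A [dA Ap] <-].
  by split; [exact: pq|exact: pr].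
Qed.

(* If p0 and p1 disagree at y then, gluing conjugates of this configuration,  *)
(* one finds conjugates of p disagreeing at arbitrarily many points.          *)
Lemma not_split_at C p p0 p1 y : small C -> good p ->
  eqtp set0 p p0 -> eqtp set0 p p1 ->
  ~ alg (C `|` rng p0) y -> ~ alg (C `|` rng p1) y -> ~ split_at p0 p1 y.
Proof.
move=> sC gp pp0 pp1 ny0 ny1 sy.
have gd q : eqtp set0 p q -> good q by move=> pq; apply: good_eqtp gp.
(* The invariant [cont q] keeps one further disagreement in reserve, from which the next step of the
   induction starts. *)
pose cont q := exists y r, [/\ eqtp set0 p r, ~ alg (C `|` rng q) y,
  ~ alg (C `|` rng r) y & split_at q r y].
have [n bound] := split_at_bound gp.
suff [q [s [pq sI ss _ _]]] : exists q (s : 'I_n.+1 -> home M), [/\ eqtp set0 p q,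
    injective s, forall i, split_at p0 q (s i),
    forall i, ~ alg (C `|` rng q) (s i) & cont q].
  by apply: (bound p0 q pp0 pq); exists s.
elim: n.+1 => [|m [q [s [pq sI ss sna [u [r [pr nuq nur squr]]]]]]].
  by exists p0, (fun=> y); split;
     [exact: pp0|case|case|case|exists y, p1].
set D := C `|` rng q in sna nuq.
have sD : small D by exact: small_rng.
(* The pair [(u, r)] is moved over [D] to [(y', r')] with no [s i] algebraic over [D], [y'] and
   [r']. So [r'] agrees with [q], and disagrees with [p0], at each [s i]. As [y'] is not algebraic
   over [D] and [p0], there [q] agrees with [p0], and [r'] disagrees with both. *)
have [|y' [uy' ny' sy']] := @eqtp_avoid2 _ _ M_sat D (D `|` rng p0) m s u
    (small_rng _ sD) _ sna nuq; first exact: subsetUl.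
have [r1 ur1] := eqtp_extend M_sat r sD uy'.
have [r' [r1r' sr']] := eqtp_avoid M_sat r1 (small_rng (home1 y') sD) sy'.
have urr' : eqtp D (vals_cat (home1 u) r) (vals_cat (home1 y') r').
  exact: eqtp_trans ur1 (eqtp_cat r1r').
have CD : C `<=` D by exact: subsetUl.
have pr' : eqtp set0 p r'.
  apply: eqtp_trans pr _; apply: eqtpS (@sub0set _ D) _; exact: eqtp_inr urr'.
have sqr' : split_at q r' y'.
  apply: (urr' (fun b => split_at q (fun v => b (inr v)) (b (inl ord0)))) => //.
  by apply: dfn_split_at; tmc.
have nyr' : ~ alg (C `|` rng r') y'.
  by move=> h; apply: nur; apply: alg_eqtp h; apply: eqtp_sym; apply: eqtpS urr'.
have nyq : ~ alg (C `|` rng q) y'.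
  by move=> h; apply: ny'; apply: algS h; exact: subsetUl.
have nsr i : ~ split_at q r' (s i).
  move=> h; apply: (sr' i); apply: (algS _ (alg_split_at C (gd _ pq) (gd _ pr') h)).
  by move=> x [?|?]; [left; left|right].
pose s' (i : 'I_m.+1) := oapp s y' (unlift ord0 i).
exists r', s'; split=> //.
- have ne i : s i <> y'.
    move=> e; apply: ny'; rewrite -e.
    apply: (algS _ (alg_split_at C (gd _ pp0) (gd _ pq) (ss i))).
    by move=> x [[?|?]|?]; [left; left|right|left; right].
  move=> i j; rewrite /s'; case: (unliftP ord0 i) => [i' ->|->];
    case: (unliftP ord0 j) => [j' ->|->]; rewrite ?liftK ?unlift_none //=.
  + by move/sI ->.
  + by move/ne.
  + by move/esym/ne.
- move=> i; rewrite /s'; case: (unliftP ord0 i) => [i' _|_] /=.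
    apply: contrapT => h; apply: (nsr i').
    by apply: split_at_sym; apply: (split_at_trans (ss i')).
  apply: (split_at_trans sqr') => h; apply: ny'.
  apply: (algS _ (alg_split_at C (gd _ pq) (gd _ pp0) h)).
  by move=> x [[?|?]|?]; [left; left|left; right|right].
- move=> i; rewrite /s'; case: (unliftP ord0 i) => [i' _|_] //=.
  by move=> h; apply: (sr' i'); apply: algS h => x [?|?]; [left; left; left|right].
- by exists y', q; split=> //; exact: split_at_sym.
Qed.

Lemma good_common p (T : finType) (I : {set T}) (P : T -> vals M Z -> Prop) : good p ->
  (forall i c d, P i c -> le d c -> P i d) ->
  (forall i, i \in I -> exists c, Dl p c /\ P i c) ->
  exists c, Dl p c /\ forall i, i \in I -> P i c.
Proof.
move=> gp Pm PI; suff [c [pc h]] : exists c, Dl p c /\ forall i, i \in enum I -> P i c.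
  by exists c; split=> // i iI; apply: h; rewrite mem_enum.
have : forall i, i \in enum I -> exists c, Dl p c /\ P i c.
  by move=> i; rewrite mem_enum; exact: PI.
elim: (enum I) => [|i s IHs] h; first by have [c pc] := good_ne gp; exists c.
have [|c [pc cs]] := IHs; first by move=> j js; apply: h; rewrite inE js orbT.
have [d [pd id]] := h i (mem_head _ _).
have [e [pe ec ed]] := good_cap gp pc pd; exists e; split=> // j.
by rewrite inE => /predU1P[->|/cs jc]; [exact: Pm ed|exact: Pm ec].
Qed.

(** * Definable sets contain a box around their generic points *)

Section InteriorPoint.
Variables (p : vals M Q) (C : set (elt M)) (k : nat) (a : 'I_k -> home M).
Variables (I : {set 'I_k}) (A : set ('I_k -> home M)).
Hypotheses (gp : good p) (sC : small C) (aI : indep C a I) (Aa : A a).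
Hypothesis dA : dfn C (A : vals M (home_ctx L k) -> Prop).
Hypothesis AI : forall z z' : 'I_k -> home M,
  (forall i, i \in I -> z i = z' i) -> A z -> A z'.

(* Induction on J. To release a coordinate i, replace q by a conjugate p1 over the *)
(* other coordinates such that a i is not algebraic over them and p1: as W c       *)
(* increases when c shrinks, generically one W c is a neighborhood of a i. By      *)
(* not_split_at, p1 and q define the same neighborhoods of the a j.                *)
Lemma interior_point (J : {set 'I_k}) q : J \subset I -> eqtp set0 p q ->
  (forall j, j \in J -> ~ alg (adjoin C a (I :\: J) `|` rng q) (a j)) ->
  exists c, Dl q c /\ forall z : 'I_k -> home M,
    (forall i, i \in I :\: J -> z i = a i) ->
    (forall j, j \in J -> U c (a j) (z j)) -> A z.
Proof.
have gd q' : eqtp set0 p q' -> good q' by move=> pq'; exact: good_eqtp gp.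
move: {2}#|J| (erefl #|J|) => n; elim: n J q => [|n IHn] J q Jn JI pq naq.
  move/eqP: Jn; rewrite cards_eq0 => /eqP J0.
  have [c qc] := good_ne (gd _ pq); exists c; split=> // z za _.
  by apply: (AI _ Aa) => i iI; rewrite za // J0 finset.setD0.
have [i iJ] : exists i, i \in J by apply/finset.set0Pn; rewrite -card_gt0 Jn.
pose J' := J :\ i.
have J'n : #|J'| = n by move: Jn; rewrite (cardsD1 i) iJ => -[].
have iI : i \in I := fintype.subsetP JI i iJ.
have J'J : J' \subset J by exact: finset.subsetDl.
have J'I : J' \subset I by exact: fintype.subset_trans JI.
have nealg (K : {set 'I_k}) j : j \in I -> K \subset I :\ j -> ~ alg (adjoin C a K) (a j).
  by move=> jI KI h; apply: (aI jI); apply: algS h; exact: adjoinS.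
pose C0 := adjoin C a (I :\: J).
have IJ' : I :\: J \subset I :\: J' by apply: finset.setDS.
(* The conjugate [p2] meets the hypothesis of the induction for [J'], where [a i] has joined the
   fixed coordinates. *)
have [p2 [qp2 na2]] : exists p2, eqtp (adjoin C a (I :\: J')) q p2 /\
    forall j, j \in J' -> ~ alg (adjoin C a (I :\: J') `|` rng p2) (a j).
  have [|p2 [h1 h2]] := @eqtp_avoid _ _ M_sat (adjoin C a (I :\: J')) _ #|J'|
      (fun u => a (enum_val u)) q (small_adjoin _ _ sC).
    move=> u; apply: nealg; first exact: (fintype.subsetP J'I _ (enum_valP u)).
    apply/fintype.subsetP => j; rewrite !inE => /andP[njJ jI]; rewrite jI andbT.
    by apply: contraNN njJ => /eqP ->; have := enum_valP u; rewrite !inE.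
  exists p2; split=> // j jJ'.
  by have := h2 (enum_rank_in jJ' j); rewrite enum_rankK_in.
have pp2 : eqtp set0 p p2 by apply: eqtp_trans pq _; apply: eqtpS qp2.
have [c2 [p2c2 c2A]] := IHn J' p2 J'n J'I pp2 na2.
pose C1 := adjoin C a (I :\ i).
have C01 : C0 `<=` C1.
  by apply: adjoinS => //; apply/fintype.subsetP => j; rewrite !inE => /andP[njJ ->];
     rewrite andbT; apply: contraNN njJ => /eqP ->.
have [p1 [qp1 na1]] : exists p1, eqtp C1 q p1 /\ ~ alg (C1 `|` rng p1) (a i).
  have [|p1 [h1 h2]] := @eqtp_avoid _ _ M_sat C1 _ 1 (fun=> a i) q (small_adjoin _ _ sC).
    by move=> _; exact: aI.
  by exists p1; split=> //; exact: (h2 ord0).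
have pp1 : eqtp set0 p p1 by apply: eqtp_trans pq _; apply: eqtpS qp1.
have sC0 : small C0 by exact: small_adjoin.
have na1J j : j \in J -> ~ alg (C0 `|` rng p1) (a j).
  have [->|ji] := eqVneq j i => jJ h.
    by apply: na1; apply: algS h; exact: setSU.
  apply: (naq j jJ); apply: (alg_eqtp_mem qp1) h => //.
  by apply: adjoin_mem; rewrite !inE ji (fintype.subsetP JI).
have [c3 [p1c3 c3c2]] : exists c, Dl p1 c /\
    forall j, j \in J' -> U c (a j) `<=` U c2 (a j).
  apply: good_common => [|j c d h dc z /dc /h //|j jJ']; first exact: gd.
  have jJ := fintype.subsetP J'J j jJ'.
  have : ~ split_at p1 p2 (a j).
    apply: (not_split_at (C := C0) sC0 gp pp1 pp2); first exact: na1J.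
    by move=> h; apply: (na2 j jJ'); apply: algS h; apply: setSU; exact: adjoinS.
  by move=> /contrapT[/(_ _ p2c2)].
(* [W c] collects the values of coordinate [i] for which the box of scale [c] in the directions [J']
   stays inside [A]. *)
pose W c x := forall z : 'I_k -> home M, (forall j, j \in I :\: J -> z j = a j) ->
  z i = x -> (forall j, j \in J' -> U c (a j) (z j)) -> A z.
have Wm c d x : W c x -> le d c -> W d x.
  by move=> Wc dc z za zi zJ; apply: Wc => // j jJ'; apply: dc; exact: zJ.
have Wai : W c3 (a i).
  move=> z za zi zJ; apply: c2A => [j|j jJ']; last by apply: (c3c2 j jJ'); exact: zJ.
  rewrite !inE negb_and negbK => /andP[/orP[/eqP ->//|njJ] jI].
  by apply: za; rewrite inE njJ.
have memC1 j : j \in J' -> C1 (elem (a j)).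
  move=> jJ'; apply: adjoin_mem; rewrite !inE (fintype.subsetP J'I) // andbT.
  by move: jJ'; rewrite !inE => /andP[].
have dW : dfnR (C1 `|` rng p1) W.
  rewrite /dfnR /W; dfn_step; dfn_step.
    dfn_step; dfn_step; dfn_step; first by tmv.
    apply: tm_const; left; apply: (adjoinS (@subset_refl _ C) _); last first.
      exact: (adjoin_mem C a (I := I :\: J)).
    by apply/fintype.subsetP => j; rewrite !inE => /andP[njJ ->];
       rewrite andbT; apply: contraNN njJ => /eqP ->.
  dfn_step; first by dfu.
  dfn_step; last by apply: (@dfn_inr _ _ _ _ (home_ctx L k) _ (dfn_sub _ dA)) => u Cu; left; left.
  dfn_step; dfn_step; apply: dfn_U; try by tmc.
  by apply: tm_const; left; apply: memC1.
(* [Z1] consists of the points of the union of the [W c] that are interior to none of them. If it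
   contained [a i] it would be infinite, hence would meet some [W c] in an infinite set; that set
   contains a ball, whose centre is interior to [W c]. *)
pose Z1 x := (exists c, Dl p1 c /\ W c x) /\ forall c, Dl p1 c -> forall d, Dl p1 d ->
  ~ forall y, U d x y -> W c y.
have dZ1 : dfn1 (C1 `|` rng p1) Z1.
  by rewrite /Z1; dfu; apply: (dfn_appR dW); tmv.
have sC1 : small (C1 `|` rng p1) by apply: small_rng; exact: small_adjoin.
have nZ1 : ~ Z1 (a i).
  move=> Z1i.
  have iZ1 : infinite_set [set x | Z1 x] := eqtp_infinite na1 dZ1 Z1i.
  have [|||||c p1c iW] := @infinite_directed _ _ M_sat (C1 `|` rng p1) Z (Dl p1)
     (fun c x => W c x /\ Z1 x) sC1.
  - by dfu.
  - apply: dfn_and => //; apply: (@dfn_inr _ _ _ _ (home_ctx L 1) _ dZ1).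
  - exact: good_ne (gd _ pp1).
  - move=> c d pc pd; have [e [pe ec ed]] := good_cap (gd _ pp1) pc pd; exists e => //.
    by split=> x [Wx Zx]; split=> //; apply: Wm; eauto.
  - apply: sub_infinite_set iZ1 => x Zx; have [[c [pc Wx]] _] := Zx.
    by exists c.
  have [|d [y [pd dy]]] := good_int (gd _ pp1) _ iW.
    apply: dfn_and; last by apply: dfn_sub dZ1.
    by apply: (dfn_appR (g := fun=> c) (dfn_sub (@subsetT _ _) dW)); tmc.
  have [_ [_ /(_ _ p1c _ pd)]] := dy y (good_refl (gd _ pp1) _ pd).
  by apply=> z /dy[].
have [c4 [p1c4 c4A]] : exists c, Dl p1 c /\ forall z : 'I_k -> home M,
    (forall j, j \in I :\: J -> z j = a j) -> (forall j, j \in J -> U c (a j) (z j)) -> A z.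
  have [c [p1c [d [p1d dW']]]] : exists c, Dl p1 c /\ exists d, Dl p1 d /\
      forall y, U d (a i) y -> W c y.
    apply: contrapT => h; apply: nZ1; split; first by exists c3.
    by move=> c p1c d p1d dW'; apply: h; exists c; split=> //; exists d.
  have [e [pe ec ed]] := good_cap (gd _ pp1) p1c p1d; exists e; split=> // z za zJ.
  apply: (dW' (z i)) => //; first by apply: ed; exact: zJ.
  by move=> j jJ'; apply: ec; apply: zJ; exact: (fintype.subsetP J'J).
have [c5 [qc5 c5c4]] : exists c, Dl q c /\
    forall j, j \in J -> U c (a j) `<=` U c4 (a j).
  apply: good_common => [|j c d h dc z /dc /h //|j jJ]; first exact: gd.
  have : ~ split_at q p1 (a j).
    apply: (not_split_at (C := C0) sC0 gp pq pp1); first exact: naq.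
    exact: na1J.
  by move=> /contrapT[/(_ _ p1c4)].
exists c5; split=> // z za zJ; apply: c4A => // j jJ.
by apply: c5c4 => //; exact: zJ.
Qed.

End InteriorPoint.

Lemma interior_point_over p E k (a : 'I_k -> home M) (I : {set 'I_k})
    (A : set ('I_k -> home M)) :
  good p -> small E -> rng p `<=` E -> indep E a I -> A a ->
  dfn E (A : vals M (home_ctx L k) -> Prop) ->
  (forall z z' : 'I_k -> home M, (forall i, i \in I -> z i = z' i) -> A z -> A z') ->
  exists c, Dl p c /\ forall z : 'I_k -> home M,
    (forall i, i \in I -> U c (a i) (z i)) -> A z.
Proof.
move=> gp sE pE aI Aa dA AI.
have [j jI h|c [pc cA]] := interior_point gp sE aI Aa dA AI (fintype.subxx _) (eqtp_refl (w := p)).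
- apply: (aI j jI); apply: algS h => x [|/pE]; last by left.
  by apply: adjoinS => //; apply/fintype.subsetP => i; rewrite !inE andNb.
- by exists c; split=> // z zI; apply: cA => // i; rewrite !inE andNb.
Qed.

(* As E need not contain p, Neumann's lemma is used to replace p by a conjugate. *)
Lemma infinite_box p E k (a : 'I_k -> home M) (I : {set 'I_k})
    (A : set ('I_k -> home M)) :
  good p -> small E -> indep E a I -> A a ->
  dfn E (A : vals M (home_ctx L k) -> Prop) ->
  (forall z z' : 'I_k -> home M, (forall i, i \in I -> z i = z' i) -> A z -> A z') ->
  exists q c, [/\ good q, Dl q c & forall z : 'I_k -> home M,
    (forall i, i \in I -> U c (a i) (z i)) -> A z].
Proof.
move=> gp sE aI Aa dA AI.
have [|q [pq naq]] := @eqtp_avoid _ _ M_sat E _ #|I| (fun u => a (enum_val u)) p sE.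
  by move=> u h; apply: (aI _ (enum_valP u)); apply: algS h; exact: sub_adjoin.
have pq0 : eqtp set0 p q by exact: eqtpS pq.
have gq := good_eqtp pq0 gp.
have [j jI h|c [qc cA]] := interior_point gp sE aI Aa dA AI (fintype.subxx _) pq0.
- apply: (naq (enum_rank_in jI j)); rewrite enum_rankK_in //; apply: algS h.
  by apply: setSU => x [//|[i]]; rewrite /= !inE andNb.
- by exists q, c; split=> // z zI; apply: cA => // i; rewrite !inE andNb.
Qed.

Lemma le_trans c d e : le c d -> le d e -> le c e.
Proof. by move=> cd de x y /cd /de. Qed.

(** Otherwise one dependence holds at [a] for all scales below [c0]. By [interior_point_over], every
    point of a box around [a] is then dependent for all small enough scales. A finite grid in the
    box has a common such scale, which contradicts [grid_avoid]. *)
Lemma generic_scale p E k (a : 'I_k -> home M) (I : {set 'I_k}) c0 :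
  good p -> small E -> rng p `<=` E -> indep E a I -> Dl p c0 ->
  exists c, [/\ Dl p c, le c c0 & indep (E `|` rng c) a I].
Proof.
move=> gp sE pE aI pc0.
pose F (th : 'I_k -> vals M Z -> ('I_k -> home M) -> Prop) : set (vals M Z) :=
  [set c | (Dl p c /\ le c c0) /\ forall i, i \in I -> ~ th i c a].
pose ok (th : 'I_k -> vals M Z -> ('I_k -> home M) -> Prop) :=
  forall i, dependence E I i (th i).
pose av : vals M (home_ctx L k) := a.
have [|||c cF] := @sat_dir _ _ M_sat (E `|` rng c0 `|` rng av) _ (F @` ok)
  (small_rng _ (small_rng _ sE)).
- by exists (F (fun _ _ _ => False)), (fun _ _ _ => False) => // i; exact: dependence0.
- move=> _ [th okth <-]; split.
    have pE' : rng p `<=` E `|` rng c0 `|` rng av by move=> x /pE; left; left.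
    rewrite /F /mkset; dfn_step; first by dfu.
    do 3 dfn_step; apply: (dfn_dependence (okth _)); [by move=> x; left; left|by tmv|].
    by move=> j; apply: tm_const; right; exists j.
  apply: contrapT => nF.
  pose Y : set ('I_k -> home M) := [set u | exists c0, Dl p c0 /\ forall c, Dl p c ->
    le c c0 -> exists i, i \in I /\ th i c u].
  have [|||c1 [pc1 c1Y]] := @interior_point_over p E k a I Y gp sE pE aI.
  + exists c0; split=> // c pc cc0; apply: contrapT => nth; apply: nF; exists c.
    by split=> // i iI thi; apply: nth; exists i.
  + rewrite /Y /mkset; dfn_step; dfn_step; first by dfu.
    dfn_step; dfn_step; first by dfu.
    dfn_step; first by dfu.
    dfn_step; dfn_step; first exact: dfn_cst.
    by apply: (dfn_dependence (okth _)) => //; tmv.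
  + move=> z z' zz' [c [pc cI]]; exists c; split=> // d pd dc.
    have [i [iI thi]] := cI d pd dc; exists i; split=> //.
    by have [_ _ Ith] := okth i; exact: Ith zz' thi.
  have [n bn] := dependence_bound M_sat sE okth.
  have /choice[g gO] : forall i, exists g : nat -> home M,
      injective g /\ forall m, U c1 (a i) (g m).
    by move=> i; apply: infinite_enum; exact: (good_inf gp).
  (* The grid is fixed here, before the scale [d] that has to suit all of its points. *)
  have [N gN] := @grid_avoid (home M) k n I g (fun i _ => (gO i).1).
  pose x (r : {ffun 'I_k -> 'I_N.+1}) j := if j \in I then g j (r j) else a j.
  have [d [pd dP]] : exists d, Dl p d /\ forall r : {ffun 'I_k -> 'I_N.+1}, r \in [set: _]%SET ->
      exists i, i \in I /\ th i d (x r).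
    have [|r _|d [pd dP]] := @good_common p _ [set: {ffun 'I_k -> 'I_N.+1}]%SET
      (fun f d => forall c, Dl p c -> le c d -> exists i, i \in I /\ th i c (x f)) gp.
    * by move=> r c d rc dc e pe ed; apply: rc => //; exact: le_trans ed dc.
    * have /c1Y[c [pc cI]] : forall i, i \in I -> U c1 (a i) (x r i).
        by move=> i iI; rewrite /x iI; exact: (gO i).2.
      by exists c.
    * by exists d; split=> // r rT; exact: dP.
  have [i y _|r _ rP] := gN (fun i u => th i d u) _ a; first exact: bn.
  have [|i [iI]] := dP [ffun j => r j]; first by rewrite finset.in_setT.
  suff -> : x [ffun j => r j] = fun j => if j \in I then g j (r j) else a j by exact: rP.
  by apply/functional_extensionality_dep => j; rewrite /x ffunE.
- move=> _ _ [th okth <-] [th' okth' <-].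
  exists (F (fun i w u => th i w u \/ th' i w u)).
    by exists (fun i w u => th i w u \/ th' i w u) => // i; exact: dependenceU.
  by move=> c [? h]; split; split=> // i iI thi; apply: (h i iI); auto.
have [pc cc0] : Dl p c /\ le c c0.
  have [|//] := cF (F (fun _ _ _ => False)).
  by exists (fun _ _ _ => False) => // j; exact: dependence0.
exists c; split=> // i iI /(alg_dependence iI)[th dth thc].
pose th' j := if j == i then th else fun _ _ => False.
have [|_ /(_ i iI)] := cF (F th'); last by rewrite /th' eqxx.
by exists th' => // j; rewrite /th'; case: eqP => [->//|_]; exact: dependence0.
Qed.

(** ** dp-minimality *)

Hypothesis M_dp : ~ dp_rank_gt [set: vals M (home_ctx L 1)] 1.

(** Assumes three properties instead of [good p], since [good_uniformity] uses it to establish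
    [good p]. *)
Lemma separate p (F : set (home M)) x : (exists c, Dl p c) ->
  (forall y, x <> y -> exists c, Dl p c /\ ~ U c x y) ->
  (forall c d, Dl p c -> Dl p d -> exists e, [/\ Dl p e, le e c & le e d]) ->
  finite_set F -> exists c, Dl p c /\ forall t, F t -> U c x t -> t = x.
Proof.
move=> ne sep cap /finite_leqn[n lF].
have /finite_seqP[s eF] : finite_set (F : set {classic home M}) by exact: leqn_finite lF.
suff [c [pc cs]] : exists c, Dl p c /\
    forall t : {classic home M}, t \in s -> U c x t -> t = x.
  by exists c; split=> // t; rewrite eF; exact: cs.
elim: s {eF} => [|y s [c [pc cs]]]; first by have [c pc] := ne; exists c.
have [->|xy] := pselect (y = x :> home M).
  by exists c; split=> // t; rewrite inE => /predU1P[//|]; exact: cs.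
have [d [pd nd]] := sep _ (not_eq_sym xy).
have [e [pe ec ed]] := cap _ _ pc pd; exists e; split=> // t.
by rewrite inE => /predU1P[-> /ed //|ts /ec]; exact: cs.
Qed.

Lemma small_ball p c x : good p -> Dl p c -> exists d, Dl p d /\ le d c /\
  forall y z, U d x y -> U d x z -> U c y z.
Proof.
move=> gp pc; have [d [pd dc]] := good_comp gp pc.
have [e [pe ec ed]] := good_cap gp pc pd; exists e; split=> //; split=> // y z xy xz.
by apply: (dc _ x); [apply: (good_sym gp)|] => //; exact: ed.
Qed.

(* Otherwise e runs over a box O0 x O1 of pairs (x0, x1), and the rows      *)
(* x0 = b0, x1 = b1 (b0 in O0, b1 in O1) witness dp-rank at least 2.        *)
Lemma exchange p E (x : 'I_2 -> home M) e : good p -> small E -> rng p `<=` E ->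
  indep E x [set: 'I_2]%SET ->
  ~ (alg (E `|` rng (home1 e)) (x ord0) /\ alg (E `|` rng (home1 e)) (x ord_max)).
Proof.
move=> gp sE pE xI [/alg_adjoin[R0 [dR0 fR0 Rx0]] /alg_adjoin[R1 [dR1 fR1 Rx1]]].
have [c0 [pc0 sep0]] :=
  separate (good_ne gp) (good_sep gp (x := x ord0)) (good_cap gp) (fR0 (home1 e)).
have [c1 [pc1 sep1]] :=
  separate (good_ne gp) (good_sep gp (x := x ord_max)) (good_cap gp) (fR1 (home1 e)).
have [c' [pc' c'0 c'1]] := good_cap gp pc0 pc1.
(* The scale enters the definition of [A] below, so it is chosen with [x] still independent over [E]
   and [c]. *)
have [c [pc cc' xIc]] := generic_scale gp sE pE xI pc'.
pose S (R : vals M (home_ctx L 1) -> home M -> Prop) z e :=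
  R (home1 e) z /\ forall t, R (home1 e) t -> U c z t -> t = z.
pose A : set ('I_2 -> home M) := [set z | exists e, S R0 (z ord0) e /\ S R1 (z ord_max) e].
have sEc : small (E `|` rng c) by exact: small_rng.
have dS R X (zt et : vals M X -> home M) : dfnR E R -> tm (E `|` rng c) zt ->
    tm (E `|` rng c) et -> dfn (E `|` rng c) (fun b => S R (zt b) (et b)).
  move=> dR tz te; pose h (b : vals M X) : vals M (ctx_cat (home_ctx L 1) (home_ctx L 1)) :=
    vals_cat (home1 (zt b)) (home1 (et b)).
  have dS : dfn (E `|` rng c) (fun b : vals M (ctx_cat (home_ctx L 1) (home_ctx L 1)) =>
      S R (b (inl (ord0 : 'I_1))) (b (inr (ord0 : 'I_1)))).
    rewrite /S; dfu.
      apply: (dfn_appR (dfn_sub (@subsetUl _ _ _) dR)); [by rewrite /home1; tmv|by tmv].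
    apply: (dfn_appR (dfn_sub (@subsetUl _ _ _) dR)); [by rewrite /home1; tmv|by tmv].
  by apply: (@dfn_app _ _ _ _ _ _ h dS); case=> v; rewrite /h /= /home1.
have [||||d [pd dA]] := @interior_point_over p _ 2 x _ A gp sEc _ xIc.
- by move=> u /pE; left.
- exists e; split; split=> // t Rt ct; [apply: sep0 => //|apply: sep1 => //].
    by apply: c'0; exact: cc'.
  by apply: c'1; exact: cc'.
- rewrite /A /mkset; dfn_step; dfn_step; apply: dS => //; tmv.
- move=> z z' zz' [e' [h0 h1]]; exists e'.
  by rewrite -!zz' ?finset.in_setT.
(* Any two points of these balls are within [c] of each other, so the uniqueness clause of [S] rules
   out every other member of the row. *)
have [d0 [pd0 [d0c d0d0]]] := small_ball (x ord0) gp pc.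
have [d1 [pd1 [d1c d1d1]]] := small_ball (x ord_max) gp pc.
have [f' [pf' f'd0 f'd1]] := good_cap gp pd0 pd1.
have [f [pf ff' fd]] := good_cap gp pf' pd.
apply: M_dp; apply: (@dp_rank_gt1 _ _ (home_ctx L 1) (home_ctx L 1)
   (fun b e => R0 (home1 e) (b (ord0 : 'I_1))) (fun b e => R1 (home1 e) (b (ord0 : 'I_1)))
   [set b | U f (x ord0) (b (ord0 : 'I_1))] [set b | U f (x ord_max) (b (ord0 : 'I_1))]).
- by apply: (dfn_appR (dfn_sub (@subsetT _ _) dR0)); rewrite /home1; tmv.
- by apply: (dfn_appR (dfn_sub (@subsetT _ _) dR1)); rewrite /home1; tmv.
- by apply: infinite_home1; exact: (good_inf gp).
- by apply: infinite_home1; exact: (good_inf gp).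
move=> b0 b1 /= fb0 fb1.
pose z (i : 'I_2) := if i == ord0 then b0 (ord0 : 'I_1) else b1 (ord0 : 'I_1).
have [|e' [[Rb0 u0] [Rb1 u1]]] := dA z.
  by move=> i _; case: (ord2P i) => ->; rewrite /z /=; exact: fd.
exists e'; split=> b fb; split.
- move=> Rb; rewrite (home1E b) (home1E b0); congr home1; apply: u0 => //.
  by apply: d0d0; apply: f'd0; exact: ff'.
- by move=> ->.
- move=> Rb; rewrite (home1E b) (home1E b1); congr home1; apply: u1 => //.
  by apply: d1d1; apply: f'd1; exact: ff'.
- by move=> ->.
Qed.

(** * Infinitesimal scales *)

Implicit Types (w : vals M Z) (e : home M).
Variable p : vals M Q.
Hypothesis gp : good p.

Definition near0 (S : vals M Z -> Prop) :=
  exists c0, Dl p c0 /\ forall c, Dl p c -> le c c0 -> S c.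

(** More is asked than to lie below the scales with parameters in [E] ([infinitesimal_le]): the
    threshold [c0] of an [E]-definable property need not have its parameters in [E]. *)
Definition infinitesimal E w := Dl p w /\ forall S, dfn E S -> near0 S -> S w.

Lemma near0I (S S' : vals M Z -> Prop) : near0 S -> near0 S' ->
  near0 (fun c => S c /\ S' c).
Proof.
move=> [c [pc cS]] [c' [pc' c'S]]; have [d [pd dc dc']] := good_cap gp pc pc'.
by exists d; split=> // e pe ed; split; [apply: cS|apply: c'S] => //; exact: le_trans ed _.
Qed.

Lemma infinitesimalS E E' w : E `<=` E' -> infinitesimal E' w -> infinitesimal E w.
Proof. by move=> EE' [pw wS]; split=> // S dS; apply: wS; exact: dfn_sub dS. Qed.

Lemma ex_infinitesimal E : small E -> rng p `<=` E -> exists w, infinitesimal E w.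
Proof.
move=> sE pE; pose F (S : vals M Z -> Prop) : set (vals M Z) := [set c | Dl p c /\ S c].
have [|||w wF] := @sat_dir _ _ M_sat E Z (F @` [set S | dfn E S /\ near0 S]) sE.
- have [c pc] := good_ne gp.
  exists (F (fun=> True)), (fun=> True) => //; split; first exact: dfn_True.
  by exists c.
- move=> _ [S [dS [c [pc cS]]] <-]; split; last by exists c; split=> //; exact: cS.
  by rewrite /F /mkset; dfn_step => //; dfu.
- move=> _ _ [S [dS eS] <-] [S' [dS' eS'] <-]; exists (F (fun c => S c /\ S' c)).
    by exists (fun c => S c /\ S' c) => //; split; [exact: dfn_and|exact: near0I].
  by move=> c [pc [Sc S'c]].
have [pw _] : F (fun=> True) w.
  have [c pc] := good_ne gp.
  by apply: wF; exists (fun=> True) => //; split; [exact: dfn_True|exists c].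
exists w; split=> // S dS eS.
by have [|//] := wF (F S); exists S.
Qed.

Lemma infinitesimal_le E c0 w : rng c0 `<=` E -> Dl p c0 -> infinitesimal E w -> le w c0.
Proof.
move=> cE pc0 [pw lw]; apply: (lw (fun c => le c c0)); first by rewrite /ball_le; dfu.
by exists c0.
Qed.

Lemma near0_finite (F : set (home M)) (S : home M -> vals M Z -> Prop) :
  finite_set F -> (forall x, F x -> near0 (S x)) ->
  near0 (fun c => forall x, F x -> S x c).
Proof.
move=> fF; have /finite_seqP[s eF] : finite_set (F : set {classic home M}) by [].
move=> FS; suff [c0 [pc0 h]] : near0 (fun c => forall x : {classic home M}, x \in s -> S x c).
  by exists c0; split=> // c pc cc0 x; rewrite eF; exact: h.
have {FS} : forall x : {classic home M}, x \in s -> near0 (S x).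
  by move=> x xs; apply: FS; rewrite eF.
elim: s {eF} => [|x s IHs] h; first by have [c pc] := good_ne gp; exists c.
have [|c [pc cP]] := near0I (h x (mem_head _ _)) (IHs _).
  by move=> y ys; apply: h; rewrite inE ys orbT.
exists c; split=> // d pd dc y; have [Sx Ss] := cP d pd dc.
by rewrite inE => /predU1P[->//|]; exact: Ss.
Qed.

Lemma dfn_adjoin1 C X (S : vals M X -> Prop) e : dfn (C `|` rng (home1 e)) S ->
  exists2 R, dfnR C R & forall a, S a <-> R a e.
Proof.
move=> /dfn_adjoin[R [dR SR]]; exists (fun a x => R a (home1 x)) => //; rewrite /dfnR.
pose h (b : vals M (ctx_cat X (home_ctx L 1))) : vals M (ctx_cat X (home_ctx L 1)) :=
  vals_cat (fun v => b (inl v)) (home1 (b (inr (ord0 : 'I_1)))).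
by apply: (@dfn_app _ _ _ _ _ _ h dR); case=> v; rewrite /h /= /home1; tmv.
Qed.

(** A property [R c x] is replaced by the conjunction of the [R c y] over those [y] in the finite
    set [F] for which it holds at all small scales. This is definable over [E]. *)
Lemma infinitesimal_alg E w x : infinitesimal E w -> rng p `<=` E -> alg E x ->
  infinitesimal (E `|` rng (home1 x)) w.
Proof.
move=> [pw wS] pE [F dF [fF Fx]]; split=> // S /dfn_adjoin1[R dR SR] eS.
have := wS (fun c => forall y, F y -> near0 (fun c => R c y) -> R c y).
move=> h; apply/SR; apply: h => //.
- dfn_step; dfn_step; first by apply: (dfn_app1 dF); tmv.
  dfn_step; last by apply: (dfn_appR dR); tmv.
  rewrite /near0; dfn_step; dfn_step; first by dfu.
  dfn_step; dfn_step; first by dfu.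
  dfn_step; first by dfu.
  by apply: (dfn_appR dR); tmv.
- apply: near0_finite => // y Fy.
  have [[c0 [pc0 h]]|h] := pselect (near0 (fun c => R c y)).
    by exists c0; split=> // c pc cc0 _; exact: h.
  by have [c0 pc0] := good_ne gp; exists c0.
- by have [c0 [pc0 c0S]] := eS; exists c0; split=> // c pc cc0; apply/SR; exact: c0S.
Qed.

(** Both points may be added to [E] by [infinitesimal_alg]; then failure of [U c x y] is a definable
    property of all small [c]. *)
Lemma infinitesimal_apart E w x y : infinitesimal E w -> rng p `<=` E -> alg E x -> alg E y ->
  x <> y -> ~ U w x y.
Proof.
move=> lw pE ax ay xy.
have pE' : rng p `<=` E `|` rng (home1 x) by move=> u /pE; left.
have l2 := infinitesimal_alg (infinitesimal_alg lw pE ax) pE' (algS (@subsetUl _ _ _) ay).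
apply: (l2.2 (fun c => ~ U c x y)).
  apply: dfn_not; apply: (@dfn_U _ _ (fun c => c) (fun=> x) (fun=> y)).
  - by tmv.
  - by apply: tm_const; left; right; exists ord0.
  - by apply: tm_const; right; exists ord0.
have [c [pc nc]] := good_sep gp xy.
by exists c; split=> // d _ dc /dc.
Qed.

(** In a counterexample [e] encodes two independent data: the point [x], up to finitely many values,
    and a threshold scale that [x] does not control. Varying both gives two rows of a pattern. *)
Lemma infinitesimal_transfer E x e w : small E -> rng p `<=` E -> ~ alg E x ->
  alg (E `|` rng (home1 e)) x -> infinitesimal (E `|` rng (home1 x)) w ->
  infinitesimal (E `|` rng (home1 e)) w.
Proof.
move=> sE pE nx /alg_adjoin[th [dth fth thx]] [pw lw].
split=> // S /dfn_adjoin1[R dR SR] [cS [pcS hS]].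
apply: contrapT => /SR nS.
(* We build an infinite set of points z and decreasing scales c_j such that, for   *)
(* all z and j, some t has th t z for no other of these points z, and has R c t    *)
(* for all c <= c_(j+1) but not for all c <= c_j: a pattern of dp-rank at least 2. *)
have [|w' _|n bn] := unif_bound M_sat (A := fun=> True) sE _ dth; [exact: dfn_True|exact: fth|].
pose Sd t c := forall d, Dl p d -> le d c -> R d t.
have dSd C X (t : vals M X -> home M) (c : vals M X -> vals M Z) : E `<=` C -> tm C t ->
    (forall v, tm C (fun a => c a v)) -> dfn C (fun a => Sd (t a) (c a)).
  move=> EC tt tc.
  have dS : dfn E (fun b : vals M (ctx_cat Z (home_ctx L 1)) =>
      Sd (b (inr (ord0 : 'I_1))) (fun v => b (inl v))).
    by rewrite /Sd; do 2 dfn_step; [dfu|dfn_step; [dfu|apply: (dfn_appR dR); tmv]].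
  pose h (a : vals M X) : vals M (ctx_cat Z (home_ctx L 1)) := vals_cat (c a) (home1 (t a)).
  by apply: (@dfn_app _ _ _ _ _ _ h (dfn_sub EC dS)); case=> v; rewrite /h /= /home1.
have Sd_le t c d : le d c -> Sd t c -> Sd t d.
  by move=> dc h u pu ud; apply: h => //; exact: le_trans ud dc.
have dT C X (t z : vals M X -> home M) : E `<=` C -> tm C t -> tm C z ->
    dfn C (fun a => th (home1 (t a)) (z a)).
  by move=> EC tt tz; apply: (dfn_appR (dfn_sub EC dth)).
(* [t] determines [z] up to finitely many values and has a threshold, but [c] is too large to be
   one. *)
pose G z c t := th (home1 t) z /\ (exists c0, Dl p c0 /\ Sd t c0) /\ ~ Sd t c.
have dG C X (z t : vals M X -> home M) (c : vals M X -> vals M Z) : E `<=` C -> tm C z ->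
    tm C t -> (forall v, tm C (fun a => c a v)) -> dfn C (fun a => G (z a) (c a) (t a)).
  move=> EC tz tt tc; have pC : rng p `<=` C by move=> u /pE /EC.
  rewrite /G; dfn_step; first exact: dT.
  have dn : dfn1 E (fun t => exists c0, Dl p c0 /\ Sd t c0).
    by rewrite /dfn1; dfn_step; dfn_step; [dfu|apply: dSd => //; tmv].
  by dfn_step; [apply: (dfn_app1 (dfn_sub EC dn))|dfn_step; apply: dSd].
have G_le z c d t : le d c -> G z d t -> G z c t.
  by move=> dc [thz [ev nSd]]; split=> //; split=> // /(Sd_le _ _ _ dc).
(* If no [t] existed for [c], none would exist for smaller scales, hence none for [w]; but [e] is
   one for [w]. *)
have Gx c : Dl p c -> exists t, G x c t.
  move=> pc; apply: contrapT => nG; apply: (lw (fun d => ~ exists t, G x d t)).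
  - dfn_step; dfn_step; apply: dG; [exact: subsetUl| |tmv|tmv].
    by apply: tm_const; right; exists ord0.
  - by exists c; split=> // d _ dc [t /(G_le _ _ _ _ dc) Gt]; apply: nG; exists t.
  - exists e; split=> //; split=> [|/(_ w pw (fun _ _ h => h))//].
    by exists cS; split=> // d pd dc; apply/SR; exact: hS.
have [xs [xsI xsG]] : exists xs : nat -> home M, injective xs /\
    forall i c, Dl p c -> exists t, G (xs i) c t.
  have [|xs [xsI xsG]] := @infinite_enum _ [set z | forall c, Dl p c -> exists t, G z c t].
    apply: (eqtp_infinite nx) => //; rewrite /dfn1.
    by dfn_step; dfn_step; [dfu|dfn_step; apply: dG => //; tmv].
  by exists xs.
pose Ex := E `|` range (fun i => elem (xs i)).
have sEx : small Ex.
  by apply: small_countable => //; exact: card_image_le.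
have pEx : rng p `<=` Ex by move=> u /pE; left.
(* A single scale [w1] serves all the [xs i], so that one free set [H] can be extracted before any
   actual scale is considered. *)
have [w1 lw1] := ex_infinitesimal sEx pEx.
have /choice[es esG] : forall i, exists t, G (xs i) w1 t.
  by move=> i; apply: xsG; have [] := lw1.
have [||H [_ iH Hfree]] := @infinite_free n setT (fun i k => th (home1 (es i)) (xs k)).
- exact: infinite_nat.
- move=> i _; apply: (leqn_inj xsI (G := th (home1 (es i)))) => [k [_ _]//|]; exact: bn.
pose N i c t := G (xs i) c t /\ forall k, H k -> k <> i -> ~ th (home1 t) (xs k).
(* For finitely many [k] the condition is definable over [Ex]; failing at [c] it would fail at [w1],
   where [es i] satisfies it. Saturation then handles all [k] in [H]. *)
have exN i c : H i -> Dl p c -> exists t, N i c t.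
  move=> Hi pc; pose F m : set (vals M (home_ctx L 1)) := [set t | G (xs i) c (t (ord0 : 'I_1)) /\
     forall k : 'I_m, H k -> k <> i :> nat -> ~ th (home1 (t (ord0 : 'I_1))) (xs k)].
  have [|||t tF] := @sat_dir _ _ M_sat (Ex `|` rng c) _ (range F) (small_rng _ sEx).
  - by exists (F 0), 0.
  - move=> _ [m _ <-]; have dF E' X (d : vals M X -> vals M Z) (t : vals M X -> home M) :
        Ex `<=` E' -> (forall v, tm E' (fun a => d a v)) -> tm E' t ->
        dfn E' (fun a => G (xs i) (d a) (t a) /\
          forall k : 'I_m, H k -> k <> i :> nat -> ~ th (home1 (t a)) (xs k)).
      move=> EE' td tt; have EE u : E u -> E' u by move=> Eu; apply: EE'; left.
      have tx k Y : tm E' (fun _ : vals M Y => xs k).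
        by apply: tm_const; apply: EE'; right; exists k.
      dfn_step; first exact: dG.
      by apply: dfn_forall_fin => k; do 2 apply: dfn_imp_cst => _; dfn_step; exact: dT.
    split; first by apply: dF; [exact: subsetUl|tmc|tmv].
    apply: contrapT => nF; apply: (lw1.2 (fun d => ~ exists t, G (xs i) d t /\
          forall k : 'I_m, H k -> k <> i :> nat -> ~ th (home1 t) (xs k))).
    + by dfn_step; dfn_step; apply: dF => //; tmv.
    + exists c; split=> // d _ dc [t [Gt nt]]; apply: nF; exists (home1 t).
      by split=> //; exact: G_le dc Gt.
    + by exists (es i); split=> // k Hk ki; apply: Hfree => //; exact: nesym.
  - move=> _ _ [m _ <-] [m' _ <-]; exists (F (maxn m m')); first by exists (maxn m m').
    move=> t [Gt nt]; split; split=> // k Hk.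
      exact: (nt (widen_ord (leq_maxl m m') k)).
    exact: (nt (widen_ord (leq_maxr m m') k)).
  exists (t (ord0 : 'I_1)); split; first by have [] := tF (F 0) (ex_intro2 _ _ 0 Logic.I erefl).
  move=> k; have [_ /(_ ord_max)//] := tF (F k.+1) (ex_intro2 _ _ k.+1 Logic.I erefl).
have /choice[nx' nxP] : forall c, exists d, Dl p c -> [/\ Dl p d, le d c &
    forall i, H i -> exists t, N i c t /\ Sd t d].
  move=> c; have [pc|npc] := pselect (Dl p c); last by exists c.
  have /choice[f fN] : forall i, exists t, H i -> N i c t.
    by move=> i; have [/exN/(_ pc)[t Nt]|nHi] := pselect (H i); [exists t|exists x].
  pose Ef := E `|` range (fun i => elem (f i)) `|` rng c.
  have sEf : small Ef.
    by apply: small_rng; apply: small_countable => //; exact: card_image_le.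
  have pEf : rng p `<=` Ef by move=> u /pE; left; left.
  (* Infinitesimal over all the [f i] at once, [d] is a common threshold for these infinitely many
     points. *)
  have [d ld] := ex_infinitesimal sEf pEf.
  exists d => _; split; [by have [] := ld|apply: infinitesimal_le ld => //; exact: subsetUr|].
  move=> i Hi; exists (f i); split; first exact: fN.
  apply: (ld.2 (Sd (f i))).
    apply: dSd; [by move=> u Eu; left; left| |by tmv].
    by apply: tm_const; left; right; exists i.
  have [[_ [[b [pb Sb]] _]] _] := fN i Hi; exists b; split=> // a _ ab; exact: Sd_le ab Sb.
have [c0 pc0] := good_ne gp.
pose c j := iter j nx' c0.
have pc j : Dl p (c j) by elim: j => //= j /nxP[].
have c_le j m : (j <= m)%N -> le (c m) (c j).
  move=> jm; rewrite -(subnK jm); elim: (m - j) => [//|u IHu]; rewrite addSn.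
  by apply: le_trans IHu; have [] := nxP _ (pc (u + j)).
have cN i j : H i -> exists t, N i (c j) t /\ Sd t (c j.+1).
  by move=> Hi; have [_ _] := nxP _ (pc j); apply.
have row i j m t : N i (c j) t -> Sd t (c j.+1) ->
    (~ Sd t (c m) /\ Sd t (c m.+1)) <-> m = j.
  move=> [[_ [_ nSt]] _] St; split=> [[nSm Sm]|->//].
  case: (ltngtP m j) => // [mj|jm].
    by case: nSt; apply: Sd_le Sm; exact: c_le.
  by case: nSm; apply: Sd_le St; exact: c_le.
have [i0 Hi0] := infinite_setN0 iH.
apply: M_dp; apply: (@dp_rank_gt1 _ _ (home_ctx L 1) (ctx_cat Z Z)
   (fun b t => th (home1 t) (b (ord0 : 'I_1)))
   (fun b t => ~ Sd t (fun v => b (inl v)) /\ Sd t (fun v => b (inr v)))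
   [set home1 (xs i) | i in H] (range (fun j => vals_cat (c j) (c j.+1)))).
- by apply: dT; [exact: subsetT|tmv|tmv].
- rewrite /dfnR; dfn_step; first by dfn_step; apply: dSd; [exact: subsetT|tmv|tmv].
  by apply: dSd; [exact: subsetT|tmv|tmv].
- have eH : ((fun i => home1 (xs i)) @` H #= H)%card.
    by apply: inj_card_eq => i k _ _ /(congr1 (fun b => b (ord0 : 'I_1))) /xsI.
  by rewrite (eq_finite_set eH).
- apply: infinite_range => j m ejm; have [t [Nt St]] := cN i0 m Hi0.
  apply/(row i0 m j t Nt St).
  have el : c j = c m.
    by apply/functional_extensionality_dep => v; have := congr1 (fun b => b (inl v)) ejm.
  have er : c j.+1 = c m.+1.
    by apply/functional_extensionality_dep => v; have := congr1 (fun b => b (inr v)) ejm.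
  by rewrite el er; apply/(row i0 m m t Nt St).
- move=> _ _ [i Hi <-] [j _ <-]; have [t [Nt St]] := cN i j Hi; exists t; split.
    move=> _ [k Hk <-]; split=> [thk|->]; last by have [[]] := Nt.
    have [->//|ki] := pselect (k = i); by case: (Nt.2 k Hk ki).
  move=> _ [m _ <-]; split=> [h|->].
    by have -> : m = j by apply/(row i j m t Nt St).
  by apply/(row i j j t Nt St).
Qed.

(** * Independence and infinitesimals when parameters are added *)

Lemma alg_closed E x y : alg E x -> alg (E `|` rng (home1 x)) y -> alg E y.
Proof.
move=> [F dF [fF Fx]] /alg_adjoin[R [dR fR Ry]].
exists (\bigcup_(t in F) R (home1 t)); last first.
  by split; [apply: bigcup_finite => // t _; exact: fR|exists x].
apply: (@dfn_ext _ _ _ _ (fun a : vals M (home_ctx L 1) =>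
  exists t, F t /\ R (home1 t) (a (ord0 : 'I_1)))).
  by move=> a; split=> [[t [Ft Rt]]|[t Ft Rt]]; exists t.
dfn_step; dfn_step; first by apply: (dfn_app1 dF); tmv.
by apply: (dfn_appR dR); rewrite /home1; tmv.
Qed.

Lemma adjoin_setD1 E k (a : 'I_k -> home M) (I : {set 'I_k}) i :
  adjoin E a I `<=` adjoin E a (I :\ i) `|` rng (home1 (a i)).
Proof.
move=> u [Eu|[j jI <-]]; first by left; left.
have [->|ji] := eqVneq j i; first by right; exists ord0.
by left; right; exists j => //=; rewrite !inE ji.
Qed.

Lemma adjoin_swap E k (a : 'I_k -> home M) (I : {set 'I_k}) F :
  adjoin (E `|` F) a I = adjoin E a I `|` F.
Proof. by rewrite /adjoin setUAC. Qed.

(** If, besides [a m], some [a q] became algebraic without the help of [a m], then [a m] and [a q]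
    would both be algebraic over [e] and the remaining coordinates, against [exchange]. *)
Lemma indep_adjoin1 E k (a : 'I_k -> home M) (I : {set 'I_k}) e : small E -> rng p `<=` E ->
  indep E a I -> indep (E `|` rng (home1 e)) a I \/ exists m, [/\ m \in I,
    alg (adjoin E a (I :\ m) `|` rng (home1 e)) (a m) & indep (E `|` rng (home1 e)) a (I :\ m)].
Proof.
move=> sE pE aI; have [|nI] := pselect (indep (E `|` rng (home1 e)) a I); [by left|right].
have {nI} [m [mI am]] : exists m, m \in I /\ alg (adjoin E a (I :\ m) `|` rng (home1 e)) (a m).
  apply: contrapT => nm; apply: nI => m mI; rewrite adjoin_swap => am.
  by apply: nm; exists m.
exists m; split=> // q qI; rewrite adjoin_swap => aq.
pose x (i : 'I_2) := if i == ord0 then a m else a q.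
pose E' := adjoin E a (I :\ m :\ q).
have mq : m != q by move: qI; rewrite !inE => /andP[]; rewrite eq_sym.
have qI' : q \in I by move: qI; rewrite !inE => /andP[].
have sub : adjoin E a (I :\ m) `<=` E' `|` rng (home1 (a q)) by exact: adjoin_setD1.
apply: (@exchange p E' x e) => //.
- exact: small_adjoin.
- by move=> u /pE; left.
- move=> i _; case: (ord2P i) => -> ax.
    apply: (aI m mI); apply: algS ax => u [|[j]].
      by apply: adjoinS => //; exact: finset.subsetDl.
    rewrite /= !inE; case: (ord2P j) => -> //= _ <-; rewrite /x /=.
    by apply: adjoin_mem; rewrite !inE eq_sym mq.
  apply: (aI q qI'); apply: algS ax => u [|[j]].
    by apply: adjoinS => //; apply: finset.setSD; exact: finset.subsetDl.
  rewrite /= !inE; case: (ord2P j) => -> //= _ <-; rewrite /x /=.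
  by apply: adjoin_mem; rewrite !inE mq.
rewrite /x /=; split=> //; apply: (alg_closed aq); apply: algS am.
by move=> u [/sub[|]|]; [left; left|right|left; right].
Qed.

(** Each coordinate of [b] costs at most one coordinate of [a]. *)
Lemma indep_adjoin E k (a : 'I_k -> home M) (I : {set 'I_k}) l (b : 'I_l -> home M)
    (J : {set 'I_l}) : small E -> rng p `<=` E -> indep E a I ->
  exists I' : {set 'I_k}, [/\ I' \subset I, (#|I| <= #|I'| + #|J|)%N & indep (adjoin E b J) a I'].
Proof.
have [n] := ubnP #|J|; elim: n => // n IHn in E I J * => Jn sE pE aI.
have [->|[j jJ]] := finset.set_0Vmem J.
  exists I; split; [exact: fintype.subxx|by rewrite leq_addr|].
  by apply: indepS aI => u [//|[j]]; rewrite /= inE.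
have cJ : #|J| = #|J :\ j|.+1 by rewrite (cardsD1 j) jJ.
rewrite cJ ltnS in Jn; pose Ej := E `|` rng (home1 (b j)).
have sEj : small Ej by exact: small_rng.
have pEj : rng p `<=` Ej by move=> u /pE; left.
have sub : adjoin E b J `<=` adjoin Ej b (J :\ j) by rewrite adjoin_swap; exact: adjoin_setD1.
have [aIj|[m [mI _ aIj]]] := indep_adjoin1 (b j) sE pE aI.
  have [I' [I'I cI aI']] := IHn _ _ _ Jn sEj pEj aIj; exists I'; split=> //.
    by rewrite cJ addnS ltnW.
  exact: indepS aI'.
have [I' [I'I cI aI']] := IHn _ _ _ Jn sEj pEj aIj; exists I'; split=> //.
- by apply: fintype.subset_trans I'I _; exact: finset.subsetDl.
- by rewrite (cardsD1 m) mI cJ addnS.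
- exact: indepS aI'.
Qed.

Lemma indep_escape E k (a : 'I_k -> home M) (I : {set 'I_k}) l (b : 'I_l -> home M)
    (J : {set 'I_l}) : small E -> rng p `<=` E -> indep E a I -> (#|J| < #|I|)%N ->
  exists i, i \in I /\ ~ alg (adjoin E b J) (a i).
Proof.
move=> sE pE aI JI; have [I' [I'I cI aI']] := indep_adjoin b J sE pE aI.
have /card_gt0P[i iI'] : (0 < #|I'|)%N by rewrite -(ltn_add2r #|J|); exact: leq_trans cI.
exists i; split; first exact: (fintype.subsetP I'I).
by move=> ai; apply: (aI' i iI'); apply: algS ai => u; left.
Qed.

(** Steinitz replacement: coordinates of [a] are traded for those of [b], and
    [infinitesimal_transfer] carries [w] along. If some [b j] leaves [a] independent on [I], the
    remaining coordinates of [b] are too few to make all of them algebraic, which is the first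
    alternative. *)
Lemma infinitesimal_basis E k (a : 'I_k -> home M) (I : {set 'I_k}) l (b : 'I_l -> home M)
    (J : {set 'I_l}) w : small E -> rng p `<=` E -> indep E a I -> (#|J| <= #|I|)%N ->
  infinitesimal (adjoin E a I) w ->
  (exists i, i \in I /\ ~ alg (adjoin E b J) (a i)) \/ infinitesimal (adjoin E b J) w.
Proof.
have [n] := ubnP #|J|; elim: n => // n IHn in E I J * => Jn sE pE aI JI lw.
have [J0|[j jJ]] := finset.set_0Vmem J.
  by right; rewrite J0; apply: infinitesimalS lw => u [|[i]]; [left|rewrite /= inE].
have cJ : #|J| = #|J :\ j|.+1 by rewrite (cardsD1 j) jJ.
rewrite cJ in JI; rewrite cJ ltnS in Jn; pose Ej := E `|` rng (home1 (b j)).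
have sEj : small Ej by exact: small_rng.
have pEj : rng p `<=` Ej by move=> u /pE; left.
have sub : adjoin E b J `<=` adjoin Ej b (J :\ j) by rewrite adjoin_swap; exact: adjoin_setD1.
have [aIj|[m [mI am aIj]]] := indep_adjoin1 (b j) sE pE aI.
  have [i [iI ai]] := indep_escape b sEj pEj aIj JI; left; exists i; split=> // bi.
  by apply: ai; exact: algS bi.
have [||[i [iI ai]]|lw'] := IHn Ej (I :\ m) (J :\ j) Jn sEj pEj aIj.
- by rewrite (cardsD1 m) mI in JI.
- rewrite adjoin_swap; apply: (infinitesimal_transfer (x := a m)).
  + exact: small_adjoin.
  + by move=> u /pE; left.
  + exact: aI.
  + exact: am.
  + apply: infinitesimalS lw => u [|[v _ <-]]; last exact: adjoin_mem.
    by apply: adjoinS => //; exact: finset.subsetDl.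
- left; exists i; split; first by move: iI; rewrite !inE => /andP[].
  by move=> bi; apply: ai; exact: algS bi.
- by right; exact: infinitesimalS lw'.
Qed.

(** Take [t] different from [y] and infinitesimally close to it. If [t] made some [a m] algebraic,
    the scale would stay infinitesimal over [t] and the other coordinates; there [y] and [t] are
    algebraic, so they could not be that close. *)
Lemma indep_near1 E k (a : 'I_k -> home M) (I : {set 'I_k}) y c0 : small E -> rng p `<=` E ->
  indep E a I -> alg (adjoin E a I) y -> Dl p c0 ->
  exists t, U c0 y t /\ indep (E `|` rng (home1 t)) a I.
Proof.
move=> sE pE aI ay pc0.
have sE1 : small (adjoin E a I `|` rng c0) by apply: small_rng; exact: small_adjoin.
have [|w lw] := ex_infinitesimal sE1; first by move=> u /pE; left; left.
have wc0 : le w c0 by apply: infinitesimal_le lw => //; exact: subsetUr.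
have [t [Ut /= ty]] : (U w y `\` [set y]) !=set0.
  apply: infinite_setN0; apply: infinite_setD; last exact: finite_set1.
  by apply: (good_inf gp); have [] := lw.
exists t; split; first exact: wc0.
have [//|[m [mI am _]]] := indep_adjoin1 t sE pE aI; exfalso.
pose E' := adjoin E a (I :\ m); have pE' : rng p `<=` E' by move=> u /pE; left.
have lt : infinitesimal (E' `|` rng (home1 t)) w.
  apply: (infinitesimal_transfer (x := a m)) => //.
  - exact: small_adjoin.
  - exact: aI.
  - apply: infinitesimalS lw => u [|[v _ <-]]; left; last exact: adjoin_mem.
    by apply: (@adjoinS _ _ E E _ a (I :\ m) I) => //; exact: finset.subsetDl.
apply: (infinitesimal_apart lt _ _ _ (nesym ty)) => //.
- by move=> u /pE'; left.
- apply: (alg_closed am); apply: algS ay => u au.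
  have [|] := @adjoin_setD1 E k a I m u au; first by left; left.
  by right.
- by apply: alg_mem; right; exists ord0.
Qed.

Lemma indep_near E k (a : 'I_k -> home M) (I : {set 'I_k}) l (y : 'I_l -> home M) c0 :
  small E -> rng p `<=` E -> indep E a I -> (forall j, alg (adjoin E a I) (y j)) -> Dl p c0 ->
  exists q : 'I_l -> home M, (forall j, U c0 (y j) (q j)) /\ indep (adjoin E q [set: 'I_l]%SET) a I.
Proof.
move=> sE pE aI ay pc0.
suff h (J : {set 'I_l}) : exists q : 'I_l -> home M,
    (forall j, j \in J -> U c0 (y j) (q j)) /\ indep (adjoin E q J) a I.
  by have [q [yq aq]] := h [set: 'I_l]%SET; exists q; split=> // j; apply: yq; rewrite inE.
have [n] := ubnP #|J|; elim: n => // n IHn in J *.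
have [->|[j jJ]] := finset.set_0Vmem J => Jn.
  exists y; split; first by move=> j; rewrite inE.
  by apply: indepS aI => u [//|[i]]; rewrite /= inE.
have [|q [yq aq]] := IHn (J :\ j); first by move: Jn; rewrite (cardsD1 j) jJ ltnS.
have [|||t' [yt' at']] := @indep_near1 (adjoin E q (J :\ j)) k a I (y j) c0 _ _ aq _ pc0.
- exact: small_adjoin.
- by move=> u /pE; left.
- by apply: algS (ay j) => u; apply: adjoinS => [|]; [left|exact: fintype.subxx].
exists (upd q j t'); split=> [i iJ|].
  by rewrite /upd; have [->//|ij] := eqVneq i j; apply: yq; rewrite !inE ij.
apply: indepS at' => u [Eu|[i iJ <-]]; first by left; left.
rewrite /upd; have [_|ij] := eqVneq i j; first by right; exists ord0.
by left; apply: adjoin_mem; rewrite !inE ij.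
Qed.

Definition gen E k (a : 'I_k -> home M) (I : {set 'I_k}) := forall i, alg (adjoin E a I) (a i).

Lemma alg_trans E k (a : 'I_k -> home M) (I : {set 'I_k}) y :
  (forall i, i \in I -> alg E (a i)) -> alg (adjoin E a I) y -> alg E y.
Proof.
have [n] := ubnP #|I|; elim: n => // n IHn in I *.
have [->|[i iI]] := finset.set_0Vmem I => In aI ay.
  by apply: algS ay => u [//|[j]]; rewrite /= inE.
apply: (IHn (I :\ i)); first by move: In; rewrite (cardsD1 i) iI ltnS.
  by move=> j; rewrite inE => /andP[_]; exact: aI.
apply: (@alg_closed _ (a i)); last exact: algS (@adjoin_setD1 _ _ _ _ _) ay.
by apply: algS (aI i iI) => u; left.
Qed.

Lemma gen_minimal E k (a : 'I_k -> home M) (I : {set 'I_k}) : gen E a I ->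
  (forall J, gen E a J -> (#|I| <= #|J|)%N) -> indep E a I.
Proof.
move=> gI mI i iI ai; have : gen E a (I :\ i).
  by move=> j; apply: (alg_closed ai); exact: algS (@adjoin_setD1 _ _ _ _ _) (gI j).
by move/mI; rewrite [#|I|](cardsD1 i) iI ltnn.
Qed.

Lemma ex_basis E k (a : 'I_k -> home M) : exists I : {set 'I_k}, gen E a I /\ indep E a I.
Proof.
have gT : `[< gen E a [set: 'I_k]%SET >].
  by apply/asboolP => i; apply: alg_mem; apply: adjoin_mem; rewrite inE.
case: (arg_minnP (P := fun I => `[< gen E a I >]) (fun I : {set 'I_k} => #|I|) gT).
move=> I /asboolP gI mI.
by exists I; split=> //; apply: gen_minimal => // J /asboolP /mI.
Qed.

Lemma eq_indep E k (a b : 'I_k -> home M) (I : {set 'I_k}) :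
  (forall i, i \in I -> a i = b i) -> indep E a I -> indep E b I.
Proof.
move=> ab aI i iI bi; apply: (aI i iI); rewrite ab //; apply: algS bi => u [|[j jI <-]].
  by left.
rewrite -ab; first exact: adjoin_mem.
by move: jI; rewrite /= !inE => /andP[].
Qed.

(** Exchanges the base [C] for an unrelated small set [E]: the projection of [F] to the coordinates
    in [I] contains a box with infinite sides, which has a point independent over [E]. *)
Lemma generic_near C E k (z0 : home M) (b : 'I_k -> home M) (I : {set 'I_k})
    (F : set ('I_k -> home M)) :
  small C -> small E -> dfn C (F : vals M (home_ctx L k) -> Prop) -> F b -> indep C b I ->
  exists b', F b' /\ indep E b' I.
Proof.
move=> sC sE dF Fb bI.
have [|||q [c [gq qc box]]] := @infinite_box p C k b I
    [set z | exists b', F b' /\ forall i, i \in I -> b' i = z i] gp sC bI.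
- by exists b.
- rewrite /mkset; dfn_step; dfn_step; last first.
    by dfn_step; apply: dfn_imp_cst => _; dfn_step; tmv.
  exact: (@dfn_inr _ _ _ (home_ctx L k) (home_ctx L k) F dF).
- by move=> z z' zz' [b' [Fb' b'z]]; exists b'; split=> // i iI; rewrite b'z // zz'.
pose bv : vals M (home_ctx L k) := b.
have sE' : small (E `|` rng c `|` rng bv) by apply: small_rng; exact: small_rng.
have [|z [zO zI]] := @generic_in_box _ _ M_sat _ k z0 I (fun i => [set t | U c (b i) t]) sE'.
  move=> i iI; split; last exact: (good_inf gq).
  rewrite /mkset; dfu; apply: tm_const; right; by exists i.
have [b' [Fb' b'z]] := box z zO; exists b'; split=> //.
apply: (@eq_indep _ _ z); first by move=> i /b'z.
by apply: indepS zI => u Eu; left; left.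
Qed.

(** * Comparison of [A] with a disjoint set contained in its closure *)

Variables (k : nat) (A F : set ('I_k -> home M)) (E : set (elt M)).
Hypotheses (sE : small E) (pE : rng p `<=` E) (dA : dfn E (A : vals M (home_ctx L k) -> Prop)).
Hypothesis FA : forall b, F b -> ~ A b.
Hypothesis Fcl : forall b, F b -> forall c, Dl p c -> exists a, A a /\ forall j, U c (b j) (a j).

(** Closeness is measured from an auxiliary [y] near [b], since [b] on [I] has to stay independent
    over the parameters. If no point of [A] near [y] agreed with [b] on [I], none would agree there
    with any [z] whose coordinates in [I] are near those of [b]. A point of [A] close enough to [b],
    taken as [z], refutes this. *)
Lemma near_same_basis b (I : {set 'I_k}) c0 : F b -> indep E b I -> gen E b I -> Dl p c0 ->
  exists a, [/\ A a, forall i, i \in I -> a i = b i & forall j, U c0 (b j) (a j)].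
Proof.
move=> Fb bI gI pc0; have [c1 [pc1 c1c1]] := good_comp gp pc0.
have [c [pc cc1 bIc]] := generic_scale gp sE pE bI pc1.
have [c' [pc' c'c']] := good_comp gp pc.
have sEc : small (E `|` rng c) by exact: small_rng.
have pEc : rng p `<=` E `|` rng c by move=> u /pE; left.
have [|y [by_ bIy]] := indep_near (y := b) sEc pEc bIc _ pc'.
  by move=> j; apply: algS (gI j) => u; apply: adjoinS => //; left.
pose yv : vals M (home_ctx L k) := y.
pose X := [set z : 'I_k -> home M | ~ exists a, A a /\
  (forall i, i \in I -> a i = z i) /\ forall j, U c (y j) (a j)].
have [[a [Aa [ab ya]]]|nX] := pselect (exists a, A a /\
  (forall i, i \in I -> a i = b i) /\ forall j, U c (y j) (a j)).
  exists a; split=> // j; apply: (c1c1 _ (y j)); apply: cc1 => //.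
  by apply: c'c' (by_ j) _; exact: (good_refl gp).
have [||||e [pe eX]] := @interior_point_over p
    (adjoin (E `|` rng c) y [set: 'I_k]%SET) k b I X gp _ _ bIy nX.
- exact: small_adjoin.
- by move=> u /pEc; left.
- rewrite /X /mkset; dfn_step; dfn_step; dfn_step.
    apply: (@dfn_inr _ _ _ (home_ctx L k) (home_ctx L k) A).
    by apply: dfn_sub dA => u Eu; left; left.
  dfn_step; first by dfn_step; apply: dfn_imp_cst => _; dfn_step; tmv.
  dfn_step; apply: dfn_U; [|apply: tm_const; apply: adjoin_mem; exact: finset.in_setT|tmv].
  by move=> v; apply: tm_const; left; right; exists v.
- move=> z z' zz' nz [a [Aa [az' ya]]]; apply: nz; exists a; split=> //; split=> // i iI.
  by rewrite az' // zz'.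
have [d [pd dc' de]] := good_cap gp pc' pe.
have [a [Aa ba]] := Fcl Fb pd.
case: (eX a) => [i _|]; first exact: de.
exists a; split=> //; split=> // j; apply: (c'c' _ (b j)); last exact: dc'.
exact: (good_sym gp).
Qed.

(** The final contradiction: [a] and [b] lie within [w], yet [w] is infinitesimal over a basis of
    [a], over which [b] is algebraic too because it shares with [a] its coordinates in [I]. *)
Lemma frontier_rank C b0 (I0 : {set 'I_k}) : home M -> small C ->
  dfn C (F : vals M (home_ctx L k) -> Prop) -> F b0 -> indep C b0 I0 ->
  (forall a, A a -> exists J : {set 'I_k}, (#|J| <= #|I0|)%N /\ gen E a J) -> False.
Proof.
move=> z0 sC dF Fb0 bI0 Agen.
have [b [Fb bI0']] := generic_near z0 sC sE dF Fb0 bI0.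
have [I [gI bI]] := ex_basis E b.
have I0I : (#|I0| <= #|I|)%N.
  rewrite leqNgt; apply/negP => II0.
  have [i [_]] := indep_escape b sE pE bI0' II0.
  by apply; exact: gI.
pose bv : vals M (home_ctx L k) := b.
have [|w lw] := ex_infinitesimal (small_rng bv sE); first by move=> u /pE; left.
have [a [Aa ab ba]] := near_same_basis Fb bI gI lw.1.
have [J [JI0 gJ]] := Agen a Aa.
have [j bj] : exists j, b j <> a j.
  apply: contrapT => h; apply: (FA Fb); suff <- : a = b by [].
  by apply/functional_extensionality_dep => j; apply: contrapT => /nesym baj; apply: h; exists j.
have lI : infinitesimal (adjoin E b I) w.
  by apply: infinitesimalS lw => u [|[i _ <-]]; [left|right; exists i].
have [[i [iI]]|lJ] :=
    infinitesimal_basis a sE pE bI (leq_trans JI0 I0I) lI.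
  by rewrite -ab //; apply; exact: gJ.
apply: (infinitesimal_apart lJ _ _ (gJ j) bj) => //.
  by move=> u /pE; left.
apply: (@alg_trans _ k b I); first by move=> i iI; rewrite -ab //; exact: gJ.
by apply: algS (gI j) => u; apply: adjoinS; [left|exact: fintype.subxx].
Qed.

End Uniformity.

(** * Topology and dimension *)

Section UniformTopology.
Variables (T : Type) (B : set (set (T * T))).
Hypotheses (B0 : B !=set0)
  (B_cap : forall U V, B U -> B V -> exists2 W, B W & W `<=` U `&` V)
  (B_refl : forall U x, B U -> U (x, x))
  (B_comp : forall U, B U -> exists2 V, B V & (V \; V)%relation `<=` U).

Lemma nbhs_uniform_space (x : uniform_space B) N :
  nbhs x N <-> exists2 U, B U & forall y, U (x, y) -> N y.
Proof.
rewrite nbhsE; split=> [[O [/(open_uniform_spaceE B0 B_cap) oO Ox] ON]|[U BU UN]].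
  by have [U BU UO] := oO x Ox; exists U => // y Uxy; apply: ON; apply: UO; exact/mem_set.
(* The interior of the [U]-ball around [x]; it is open by [B_comp]. *)
exists [set y : uniform_space B | exists2 V, B V & forall z, V (y, z) -> U (x, z)]; last first.
  by move=> y [V BV VU]; apply: UN; apply: VU; exact: B_refl.
split; last by exists U.
apply/(open_uniform_spaceE B0 B_cap) => y [V BV VU]; have [W BW WV] := B_comp BV.
exists W => // z /set_mem /= Wyz; exists W => // t Wzt; apply: VU; apply: WV.
by exists z.
Qed.

Lemma closure_uniform_space k (A : set ('I_k -> T)) b :
  closure (A : set (prod_topology (fun _ : 'I_k => uniform_space B))) b <->
  forall U, B U -> exists a, A a /\ forall i, U (b i, a i).
Proof.
pose P : topologicalType := prod_topology (fun _ : 'I_k => uniform_space B).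
split=> [clA U BU|h N bN].
  have : nbhs (b : P) [set a : P | forall i, U (b i, a i)].
    apply: (@filter_forall P 'I_k (fun i => [set a : P | U (b i, a i)]) (nbhs (b : P))) => i.
    have := @proj_continuous 'I_k (fun=> uniform_space B : topologicalType) i b
      [set y | U (b i, y)].
    by apply; apply/nbhs_uniform_space; exists U.
  by move=> /clA[a [Aa Ua]]; exists a.
(* The filter generated by the uniform boxes around [b]; it converges to [b] because each of its
   projections does. *)
pose G : set_system ('I_k -> T) := filter_from B (fun U => [set a | forall i, U (b i, a i)]).
have FG : Filter G.
  apply: filter_from_filter => // U V BU BV; have [W BW WUV] := B_cap BU BV.
  by exists W => // a Wa; split=> i; have [] := WUV _ (Wa i).
have [U BU UN] : G N.
  move: N bN; change (G --> (b : P)).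
  apply/(@cvg_sup _ 'I_k (fun i => Topological.class (initial_topology
      (fun f : 'I_k -> uniform_space B => f i))) G b) => i N [_ [[O oO <-] /= Ob ON]].
  have /nbhs_uniform_space[U BU UO] : nbhs (b i : uniform_space B) O by exact: open_nbhs_nbhs.
  by exists U => // a Ua; apply: ON; exact: UO.
by have [a [Aa Ua]] := h U BU; exists a; split=> //; exact: UN.
Qed.

End UniformTopology.

(** * Dimension in terms of independent generating subtuples *)

Section Dimension.
Variables (L : language) (M : structure L).
Implicit Types (C E : set (elt M)).

Lemma aclP C x : acl C x <-> alg C x.
Proof.
split=> [[phi [oC fphi phix]]|[F dF [fF Fx]]].
  have dphi : dfn C (psat phi) by apply/definable_overP; exists phi.
  exists (fun y => psat phi (home1 y)).
    by apply: dfn_app_home1 dphi _; tmv.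
  split=> //; apply: (sub_finite_set _ (finite_image (fun b => b (ord0 : 'I_1)) fphi)).
  by move=> y phiy; exists (home1 y).
have /definable_overP[phi oC ephi] : dfn C (fun a : vals M (home_ctx L 1) => F (a (ord0 : 'I_1))).
  by [].
exists phi; split=> //; rewrite -ephi //.
apply: (sub_finite_set _ (finite_image (@home1 L M) fF)) => b Fb.
by exists (b (ord0 : 'I_1)) => //; rewrite -home1E.
Qed.

Lemma dim_tupleP C k (a : 'I_k -> home M) : exists I : {set 'I_k},
  [/\ dim_tuple C a = #|I|, gen C a I & indep C a I].
Proof.
have genP (I : {set 'I_k}) : `[< forall i, acl (adjoin C a I) (a i) >] = `[< gen C a I >].
  by congr asbool; apply/propext; split=> h i; apply/aclP; exact: h.
have gT : `[< forall i, acl (adjoin C a [set: 'I_k]%SET) (a i) >].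
  by rewrite genP; apply/asboolP => i; apply: alg_mem; apply: adjoin_mem; exact: finset.in_setT.
rewrite /dim_tuple; case: arg_minnP => // I; rewrite genP => /asboolP gI mI.
exists I; split=> //; apply: gen_minimal => // J gJ.
by apply: mI; rewrite genP; apply/asboolP.
Qed.

(** Nonemptiness of [A] puts the right-hand side above [-oo], which settles the case of an empty
    [F]. *)
Lemma dim_over_lt C C' k (F A : set ('I_k -> home M)) : A !=set0 ->
  (forall b, F b -> exists2 a, A a & (dim_tuple C' b < dim_tuple C a)%N) ->
  (dim_over C' F < dim_over C A)%E.
Proof.
move=> [a0 Aa0] h.
have le_dim a : A a -> ((dim_tuple C a)%:Z%:E <= dim_over C A)%E.
  move=> Aa; have [I [eI _ _]] := dim_tupleP C a.
  have lI : (dim_tuple C a < k.+1)%N by rewrite eI ltnS -[X in (_ <= X)%N]card_ord max_card.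
  apply: (@Order.TotalTheory.bigmax_sup _ _ _ _ (Ordinal lI)) => //.
  by apply/asboolP; exists a.
apply/Order.TotalTheory.bigmax_ltP; split.
  by apply: Order.POrderTheory.lt_le_trans (le_dim _ Aa0); rewrite ltNyr.
move=> l /asboolP[b Fb <-]; have [a Aa lt_ba] := h b Fb.
by apply: Order.POrderTheory.lt_le_trans (le_dim _ Aa); rewrite lte_fin.
Qed.

End Dimension.

(** * From the hypotheses on the uniformity to [good] *)

Section GoodParameters.
Variables (L : language) (M : structure L).
Implicit Types (C E : set (elt M)).

(** The finitely many parameters of one definition form a small set, so [xget] does not fall back on
    its default. *)
Lemma ex_defining_set k (A : set ('I_k -> home M)) : dfn setT (A : vals M (home_ctx L k) -> Prop) ->
  let C := xget set0 [set C : set (elt M) |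
    small C /\ definable_over C (A : set (vals M (home_ctx L k)))] in
  small C /\ dfn C (A : vals M (home_ctx L k) -> Prop).
Proof.
move=> dA C.
suff [sC /definable_overP dC] : small C /\ definable_over C (A : set (vals M (home_ctx L k))).
  by [].
apply: (@xgetPex _ set0 [set C : set (elt M) |
  small C /\ definable_over C (A : set (vals M (home_ctx L k)))]).
have [P [phi [q [_ Aphi]]]] := dA.
exists (set0 `|` rng q); split; first by apply: small_rng; exact: small0.
by apply/definable_overP; exists P, phi, q; split=> // v; right; exists v.
Qed.

(** Serves to show that [B] has a member: the empty family has full intersection, which is the
    diagonal only if there is at most one point. *)
Lemma two_points : dp_rank_ge [set: vals M (home_ctx L 1)] 1 -> exists x y : home M, x <> y.
Proof.
move=> [Y [phi [B [iB pattern]]]].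
have [t [tI tB]] := infinite_enum (iB ord0).
have pt n : exists a : vals M (home_ctx L 1), forall m,
    psat (phi ord0) (vals_cat a (t m)) <-> m = n.
  have [|a _ aP] := pattern (fun i => ecast i (vals M (Y i)) (esym (ord1 i)) (t n)).
    by move=> i; rewrite (ord1 i) /= eq_axiomK.
  exists a => m; rewrite (aP ord0) //= eq_axiomK; split=> [/tI//|->//].
have [a aP] := pt 0; have [b bP] := pt 1.
exists (a (ord0 : 'I_1)), (b (ord0 : 'I_1)) => ab.
have eab : a = b by rewrite (home1E a) (home1E b) ab.
by have := (aP 0).2 erefl; rewrite eab => /bP.
Qed.

Variables (Q Z : ctx (sorts L)).
Variables (U : vals M Z -> home M -> home M -> Prop) (Dl : vals M Q -> vals M Z -> Prop).
Variables (p : vals M Q) (B : set (set (home M * home M))).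
Hypothesis BE : B = [set [set xy | U c xy.1 xy.2] | c in Dl p].
Hypotheses (B_unif : definable_uniformity B) (M_dp : dp_minimal M).

Lemma good_uniformity : isolated [set: uniform_space B] = set0 ->
  (forall S : set (uniform_space B),
     definable [set a : vals M (home_ctx L 1) | S (a ord0)] ->
     infinite_set S -> S° !=set0) -> good U Dl p.
Proof.
move=> no_isolated interiors.
have BU c : Dl p c -> B [set xy | U c xy.1 xy.2] by rewrite BE; exists c.
have refl c x : Dl p c -> U c x x.
  move=> /BU Bc; have : diagonal (x, x) by [].
  by rewrite -(du_diagonal B_unif) => /(_ _ Bc).
have sep x y : x <> y -> exists c, Dl p c /\ ~ U c x y.
  move=> xy; apply: contrapT => h; apply: xy.
  suff : diagonal (x, y) by [].
  rewrite -(du_diagonal B_unif) BE => _ [c pc <-] /=; apply: contrapT => nU.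
  by apply: h; exists c.
have ne : exists c, Dl p c.
  by have [x [y /sep[c [pc _]]]] := two_points M_dp.1; exists c.
have cap c d : Dl p c -> Dl p d -> exists e, [/\ Dl p e, ball_le U e c & ball_le U e d].
  move=> /BU Bc /BU Bd; have [W] := du_cap B_unif Bc Bd.
  rewrite BE => -[e pe <-] h; exists e; split=> // x y Uxy; by have [] := h (x, y) Uxy.
have comp c : Dl p c -> exists d, Dl p d /\ forall x y z, U d x y -> U d y z -> U c x z.
  move=> /BU Bc; have [W] := du_comp B_unif Bc.
  rewrite BE => -[d pd <-] h; exists d; split=> // x y z xy yz.
  by apply: (h (x, z)); exists y.
have B0 : B !=set0 by have [c /BU] := ne; eexists; eassumption.
have Brefl W x : B W -> W (x, x) by rewrite BE => -[c pc <-]; exact: refl.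
have nbhsP := @nbhs_uniform_space _ B B0 (du_cap B_unif) Brefl (du_comp B_unif).
split=> //.
- move=> c x y pc Uxy; have := du_sym B_unif (BU c pc).
  by move=> /(congr1 (fun W => W (y, x))) /= e; rewrite -e.
(* Inside a finite ball a smaller scale isolates [x]. *)
- move=> c x pc fU; have [d [pd dx]] := separate ne (sep x) cap fU.
  have [e [pe ec ed]] := cap _ _ pc pd.
  suff : isolated [set: uniform_space B] x by rewrite no_isolated.
  split; first exact/mem_set.
  exists [set x : uniform_space B]; last by rewrite setIT.
  apply/nbhsP; exists [set xy | U e xy.1 xy.2]; first exact: BU.
  by move=> y /= Uxy; apply: dx; [exact: ec|exact: ed].
- move=> S dS iS; have [|x] := interiors S _ iS; first exact/definable_overP.
  move=> /nbhsP[W]; rewrite BE => -[c pc <-] h; exists c, x; split=> // y; exact: h.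
Qed.

End GoodParameters.

Theorem proposition4p3 (L : language) (T : set (sentence L)) (M : structure L)
  (T_complete : complete_theory T) (T_NIP : NIP T)
  (M_models : models M T) (M_saturated : saturated M) (M_dp : dp_minimal M)
  (B : set (set (home M * home M))) (B_unif : definable_uniformity B)
  (no_isolated : isolated [set: uniform_space B] = set0)
  (interiors : forall S : set (uniform_space B),
     definable [set a : vals M (home_ctx L 1) | S (a ord0)] ->
     infinite_set S -> S° !=set0)
  (k : nat) (A : set ('I_k -> home M))
  (A_definable : definable (A : set (vals M (home_ctx L k))))
  (A_nonempty : A !=set0) :
  (def_dim (frontier B A) < def_dim A)%E.
Proof.
have [Z [phi [D [/definable_overP[Q [psi [p [_ Dpsi]]]] BE]]]] := du_definable B_unif.
pose U (c : vals M Z) x y := sat phi (vals_cat (home2 x y) c).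
pose Dl (q : vals M Q) c := sat psi (vals_cat c q).
have eD : D = Dl p by apply/seteqP; split=> c /Dpsi.
rewrite eD in BE.
have dU : dfn set0 (fun b : vals M (ctx_cat Z (home_ctx L 2)) =>
  U (fun v => b (inl v)) (b (inr (ord0 : 'I_2))) (b (inr (ord_max : 'I_2)))).
  pose g (b : vals M (ctx_cat Z (home_ctx L 2))) : vals M (ctx_cat (home_ctx L 2) Z) :=
    vals_cat (home2 (b (inr (ord0 : 'I_2))) (b (inr (ord_max : 'I_2)))) (fun v => b (inl v)).
  apply: (@dfn_app _ _ _ _ _ _ g (dfn_sat phi _)); case=> v; rewrite /g /=; last by tmv.
  case: (ord2P v) => ->.
    exact: (@tm_var L M set0 (ctx_cat Z (home_ctx L 2)) (inr (ord0 : 'I_2))).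
  exact: (@tm_var L M set0 (ctx_cat Z (home_ctx L 2)) (inr (ord_max : 'I_2))).
have dDl : dfn set0 (fun b : vals M (ctx_cat Q Z) =>
    Dl (fun v => b (inl v)) (fun v => b (inr v))).
  pose g (b : vals M (ctx_cat Q Z)) : vals M (ctx_cat Z Q) :=
    vals_cat (fun v => b (inr v)) (fun v => b (inl v)).
  by apply: (@dfn_app _ _ _ _ _ _ g (dfn_sat psi _)); case=> v; rewrite /g /=; tmv.
have gp : good U Dl p by exact: good_uniformity BE B_unif M_dp no_isolated interiors.
have dA : dfn setT (A : vals M (home_ctx L k) -> Prop) by apply/definable_overP.
have clP b : closure (A : set (prod_topology (fun _ : 'I_k => uniform_space B))) b <->
    forall c, Dl p c -> exists a, A a /\ forall j, U c (b j) (a j).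
  have BU c : Dl p c -> B [set xy | U c xy.1 xy.2] by rewrite BE; exists c.
  have Brefl W x : B W -> W (x, x) by rewrite BE => -[c pc <-]; exact: (good_refl gp).
  have B0 : B !=set0 by have [c /BU] := good_ne gp; eexists; eassumption.
  rewrite (closure_uniform_space B0 (du_cap B_unif) Brefl (du_comp B_unif)).
  split=> [h c /BU /h//|h W]; rewrite BE => -[c pc <-]; exact: h.
have dF : dfn setT (frontier B A : vals M (home_ctx L k) -> Prop).
  apply: (@dfn_ext _ _ _ (home_ctx L k) (fun b => (forall c, Dl p c -> exists a : 'I_k -> home M,
      A a /\ forall j, U c (b j) (a j)) /\ ~ A b) (frontier B A)).
    by move=> b; rewrite /frontier /setD /mkset clP.
  dfn_step; last exact: dfn_not.
  dfn_step; dfn_step; first by apply: (dfn_D dDl) => v; [apply: tm_const|tmv].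
  dfn_step; dfn_step; first exact: (@dfn_inr _ _ _ _ (home_ctx L k) A dA).
  by dfn_step; apply: (dfn_U dU); tmv.
rewrite /def_dim; move: (ex_defining_set dF) (ex_defining_set dA) => /=.
set C1 := (X in dim_over X (frontier B A)); set C2 := (X in dim_over X A).
(* The two dimensions are computed over sets [C1] and [C2] chosen separately. A frontier point whose
   dimension over [C1] is at least that over [C2] of every point of [A] is refuted by
   [frontier_rank], with [E] equal to [C2] together with [p]. *)
move=> [sC1 dC1] [sC2 dC2]; apply: dim_over_lt => // b Fb; apply: contrapT => h.
have [I0 [eI0 gI0 bI0]] := dim_tupleP C1 b.
have [x0 _] := two_points M_dp.1.
apply: (@frontier_rank _ _ M_saturated Q Z U Dl dU dDl M_dp.2 p gp k A (frontier B A)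
  (C2 `|` rng p) (small_rng p sC2) _ _ _ _ _ b I0 x0 sC1 dC1 Fb bI0).
- exact: subsetUr.
- by apply: dfn_sub dC2; exact: subsetUl.
- by move=> b' [].
- by move=> b' [/clP].
- move=> a Aa; have [J [eJ gJ _]] := dim_tupleP C2 a; exists J; split.
    rewrite leqNgt; apply/negP => lt; apply: h; exists a => //.
    by rewrite eJ (leq_trans _ lt) // ltnS -eI0.
  by move=> i; apply: algS (gJ i); apply: adjoinS => [u|]; [left|exact: fintype.subxx].
Qed.
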